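(* Let $m,n\ge 1$ be integers, let $1<p_{1},\dots,p_{m}<\infty$ and let $p$ be defined by $\frac{1}{p}=\sum_{j=1}^{m}\frac{1}{p_{j}}$. Let $\mathcal{R}$ be the family of all rectangles in $\mathbb{R}^n$ with sides parallel to the coordinate axes, and let $\{\Psi_{j}\}_{j=1}^{m}$ be Young functions such that $\Psi_{j}\in B^{*}_{p_{j}}$ for each $j=1,\dots,m$. Let $\vec{\omega}=(\omega_{1},\dots,\omega_{m})$ be an $m$-tuple of weights on $\mathbb{R}^n$ such that $\nu_{\vec{\omega}}:=\prod_{j=1}^{m}\omega_{j}^{p/p_{j}}\in A_{\infty,\mathcal{R}}$. Then there exists a constant $C>0$ such that for all $m$-tuples $\vec f=(f_1,\dots,f_m)$ of nonnegative locally integrable functions on $\mathbb{R}^n$, $$\int_{\mathbb{R}^{n}}\big[\mathcal{M}_{\mathcal{R}}^{\vec{\Psi}}(\vec{f})(y)\big]^{p}\,\nu_{\vec{\omega}}(y)\,dy\leq C\prod_{j=1}^{m}\|f_{j}\|^{p}_{L^{p_{j}}(M_{\mathcal{R}}\omega_{j})}.$$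
   Context: A weight is a nonnegative locally integrable function on $\mathbb{R}^n$. For a weight $w$ (or a $[0,\infty]$-valued measurable function), $\|f\|_{L^{q}(w)}=\left(\int_{\mathbb{R}^n}|f|^{q}w\,dx\right)^{1/q}$. The strong maximal function is $M_{\mathcal{R}}f(x)=\sup_{R\in\mathcal{R},\,R\ni x}\frac{1}{|R|}\int_{R}|f(y)|\,dy$, where $\mathcal{R}$ is the family of all rectangles in $\mathbb{R}^n$ with sides parallel to the coordinate axes. A Young function is a continuous, convex, increasing function $\Phi:[0,\infty]\to[0,\infty]$ with $\Phi(0)=0$ and $\Phi(t)\to\infty$ as $t\to\infty$. For a set $E$ of finite (positive) measure, $\|f\|_{\Phi,E}=\inf\left\{\lambda>0:\frac{1}{|E|}\int_{E}\Phi\left(\frac{|f(x)|}{\lambda}\right)dx\leq 1\right\}$. The multilinear strong maximal function with Orlicz norms is $\mathcal{M}_{\mathcal{R}}^{\vec{\Psi}}(\vec{f})(x)=\sup_{R\in\mathcal{R},\,R\ni x}\prod_{j=1}^{m}\|f_{j}\|_{\Psi_{j},R}$. Strong $B^{*}_{p}$ condition ($1<p<\infty$): a Young function $\Phi$ on which $\Phi\in B^{*}_{p}$ holds is one for which there is a constant $c>0$ with $\int_{c}^{\infty}\frac{\Phi_{n}(\Phi(t))}{t^{p}}\frac{dt}{t}<\infty$, where $\Phi_{n}(t)=t[\log(e+t)]^{n-1}$ and $n$ is the dimension of $\mathbb{R}^n$. For $1<q<\infty$, a weight $\omega$ is in $A_{q,\mathcal{R}}$ if $\sup_{R\in\mathcal{R}}\left(\frac{1}{|R|}\int_{R}\omega\,dx\right)\left(\frac{1}{|R|}\int_{R}\omega^{1-q'}dx\right)^{q/q'}<\infty$,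 where $\frac1q+\frac1{q'}=1$; and $A_{\infty,\mathcal{R}}=\bigcup_{q>1}A_{q,\mathcal{R}}$. *)

(* Defs.v *)
From HB Require Import structures.
From mathcomp Require Import all_boot all_order all_algebra.
From mathcomp Require Import all_classical all_reals all_analysis.

Set Implicit Arguments.
Unset Strict Implicit.
Unset Printing Implicit Defensive.

Import Order.TTheory GRing.Theory Num.Theory.
Import numFieldNormedType.Exports.

Local Open Scope classical_set_scope.
Local Open Scope ring_scope.
Local Open Scope ereal_scope.

Section rectangles.
Context {R : realType} {n : nat}.
Implicit Types a b : 'rV[R]_n.

Definition nondegenerate a b := forall i, (a ord0 i < b ord0 i)%R.

Definition rectangle a b : set 'rV[R]_n :=
  [set x | forall i, x ord0 i \in `[a ord0 i, b ord0 i]].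

Definition volume a b : R := (\prod_(i < n) (b ord0 i - a ord0 i))%R.

(* Only closed rectangles: averages and Luxemburg norms over a rectangle ignore
   its boundary, so a supremum over the rectangles containing x is the same if
   non-closed ones are added. *)
Definition rectangles : set (set 'rV[R]_n) :=
  [set A | exists a b, nondegenerate a b /\ A = rectangle a b].

Lemma volume_ge0 a b : nondegenerate a b -> (0 <= volume a b)%R.
Proof. by move=> ab; apply: prodr_ge0 => i _; rewrite subr_ge0 ltW. Qed.

End rectangles.
Arguments rectangles : clear implicits.

Section lebesgue_outer_measure.
Context (R : realType) (n : nat).
Implicit Types A : set 'rV[R]_n.

(* The index set D makes the cover at most countable; it may be empty or
   finite. *)
Definition rectangle_cover A (D : set nat) (a b : nat -> 'rV[R]_n) :=
  (forall k, D k -> nondegenerate (a k) (b k)) /\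
  A `<=` \bigcup_(k in D) rectangle (a k) (b k).

Definition lebesgue_outer A : \bar R :=
  ereal_inf [set y | exists D a b, rectangle_cover A D a b /\
    y = \esum_(k in D) (volume (a k) (b k))%:E].

Let outer0 : lebesgue_outer set0 = 0.
Proof.
apply/eqP; rewrite eq_le; apply/andP; split.
  apply: ereal_inf_lbound; exists set0, (fun=> 0%R), (fun=> 0%R).
  by split; [split | rewrite esum_set0].
apply: le_ereal_inf_tmp => _ [D [a [b [[ab _] ->]]]].
by apply: esum_ge0 => k /ab/volume_ge0; rewrite lee_fin.
Qed.

Let outer_ge0 A : 0 <= lebesgue_outer A.
Proof.
apply: le_ereal_inf_tmp => _ [D [a [b [[ab _] ->]]]].
by apply: esum_ge0 => k /ab/volume_ge0; rewrite lee_fin.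
Qed.

Let le_outer : {homo lebesgue_outer : A B / A `<=` B >-> A <= B}.
Proof.
move=> A B AB; apply: ereal_inf_le_tmp => _ [D [a [b [[ab BD] ->]]]].
by exists D, a, b; split => //; split => //; exact: subset_trans BD.
Qed.

Let outer_sigma_subadditive : sigma_subadditive lebesgue_outer.
Proof.
move=> A; have [[i ioo]|] := pselect (exists i, lebesgue_outer (A i) = +oo).
  rewrite (eseries_pinfty _ _ ioo) ?leey// => k _.
  by rewrite -ltNye (lt_le_trans _ (outer_ge0 _)).
rewrite -forallNE => Aoo.
suff add2e (e : {posnum R}) : lebesgue_outer (\bigcup_k A k) <=
    \sum_(i <oo) lebesgue_outer (A i) + e%:num%:E.
  by apply/lee_addgt0Pr => _/posnumP[].
rewrite (le_trans _ (epsilon_trick _ _ _))//.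
pose P k (c : set nat * (nat -> 'rV[R]_n) * (nat -> 'rV[R]_n)) :=
  rectangle_cover (A k) c.1.1 c.1.2 c.2 /\
  \esum_(l in c.1.1) (volume (c.1.2 l) (c.2 l))%:E <=
    lebesgue_outer (A k) + (e%:num / (2 ^ k.+1)%:R)%:E.
have [G PG] : {G & forall k, P k (G k)}.
  apply: (@choice _ _ P) => k.
  have e0 : (0 < e%:num / (2 ^ k.+1)%:R)%R by [].
  have fA : lebesgue_outer (A k) \is a fin_num.
    by rewrite ge0_fin_numE// ltey; exact/eqP/Aoo.
  have [_ [D [a [b [cA ->]]]] lt] := lb_ereal_inf_adherent e0 fA.
  by exists (D, a, b); split => //; exact: ltW.
have /card_esym/ppcard_eqP[f] := card_nat2.
pose Q := [set: nat] `*`` (fun k => (G k).1.1).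
apply: (@le_trans _ _ (\esum_(p in Q)
    (volume ((G p.1).1.2 p.2) ((G p.1).2 p.2))%:E)).
  apply: ereal_inf_lbound.
  exists (f @^-1` Q), (fun k => (G (f k).1).1.2 (f k).2),
    (fun k => (G (f k).1).2 (f k).2); split; first split.
  - by move=> k [_ Gk]; exact: (PG _).1.1.
  - move=> x [i _ Aix]; have [j Dj xj] := (PG i).1.2 _ Aix.
    by exists (f^-1%FUN (i, j)); rewrite /= invK ?inE.
  - apply: (@reindex_esum _ _ _ (f @^-1` Q) Q f); split.
    + by move=> k.
    + by move=> k l _ _; apply: (@inj _ _ setT f); rewrite inE.
    + by move=> p Qp; exists (f^-1%FUN p); rewrite /= invK ?inE.
rewrite -(@esum_esum _ _ _ _ _
  (fun k l => (volume ((G k).1.2 l) ((G k).2 l))%:E)); last first.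
  by move=> k l _ /(PG k).1.1/volume_ge0; rewrite lee_fin.
rewrite [leRHS]nneseries_esumT; last by move=> k; rewrite adde_ge0.
by apply: le_esum => k _; exact: (PG k).2.
Qed.

HB.instance Definition _ := isOuterMeasure.Build R 'rV[R]_n lebesgue_outer
  outer0 outer_ge0 le_outer outer_sigma_subadditive.

End lebesgue_outer_measure.

(* R^n with its sigma-algebra of Lebesgue measurable sets; it is a synonym of
   'rV[R]_n, from which the topology is taken. *)
Notation euclidean R n := (caratheodory_type (@lebesgue_outer R n)).

Section lebesgue.
Context {R : realType} {n : nat}.
Let outer : {outer_measure set 'rV[R]_n -> \bar R} := @lebesgue_outer R n.
Definition lebesgue : {measure set (euclidean R n) -> \bar R} :=
  (outer : set (caratheodory_type outer) -> \bar R).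
End lebesgue.

Section weights.
Context {R : realType} {n : nat}.
Local Notation T := (euclidean R n).
Implicit Types (f w : T -> R) (A : set T) (x : T) (q : R).

Definition locally_integrable_Rn f :=
  measurable_fun [set: T] f /\
  forall K : set 'rV[R]_n, compact K -> \int[lebesgue]_(x in K) `|f x|%:E < +oo.

Definition weight w := (forall x, (0 <= w x)%R) /\ locally_integrable_Rn w.

Definition average (g : T -> \bar R) A : \bar R :=
  (lebesgue A)^-1 * \int[lebesgue]_(x in A) g x.

Definition strong_maximal f x : \bar R :=
  ereal_sup [set average (fun y => `|f y|%:E) A | A in
    [set A | rectangles R n A /\ A x]].

(* ||f||_{L^q(W)} *)
Definition weighted_norm q (W : T -> \bar R) f : \bar R :=
  (\int[lebesgue]_x ((`|f x| `^ q)%:E * W x)) `^ q^-1.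

(* w^(1 - q') is written as the inverse of w^(q' - 1) because it is +oo where
   w = 0, whereas powR and poweR send 0 to 0 for a negative exponent. *)
Definition muckenhoupt q w :=
  let q' := (q / (q - 1))%R in
  weight w /\
  ereal_sup [set average (fun x => (w x)%:E) A *
                 average (fun x => ((w x)%:E `^ (q' - 1))^-1) A `^ (q / q')
            | A in rectangles R n] < +oo.

Definition muckenhoupt_oo w := exists q, (1 < q)%R /\ muckenhoupt q w.

End weights.

Section young_functions.
Context {R : realType}.
Implicit Types Phi : \bar R -> \bar R.

(* Functions [0, +oo] -> [0, +oo]; values at negative arguments are ignored. *)
Definition young Phi :=
  [/\ forall t, 0 <= t -> 0 <= Phi t,
      {within [set t | 0 <= t], continuous Phi},
      forall s t (l : R), 0 <= s -> 0 <= t -> (0 <= l <= 1)%R ->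
        Phi (l%:E * s + (1 - l)%:E * t) <= l%:E * Phi s + (1 - l)%:E * Phi t,
      forall s t, 0 <= s -> s <= t -> Phi s <= Phi t &
      Phi 0 = 0 /\ Phi t%:E @[t --> +oo%R] --> +oo].

(* Phi_n(t) = t [log (e + t)]^(n-1) *)
Definition Llog n (t : \bar R) : \bar R :=
  t * lne ((expR 1)%:E + t) ^+ n.-1.

Definition strong_Bp n (p : R) Phi := exists c : R, (0 < c)%R /\
  \int[lebesgue_measure]_(t in `[c, +oo[)
    (Llog n (Phi t%:E) * ((t `^ p)^-1 * t^-1)%:E) < +oo.

Context {n : nat}.
Local Notation T := (euclidean R n).

Definition luxemburg Phi (f : T -> R) (A : set T) : \bar R :=
  ereal_inf [set l%:E | l in [set l : R | (0 < l)%R /\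
    average (fun x => Phi (`|f x| / l)%:E) A <= 1]].

Definition orlicz_maximal m (Psi : 'I_m -> \bar R -> \bar R)
    (f : 'I_m -> T -> R) (x : T) : \bar R :=
  ereal_sup [set \prod_(j < m) luxemburg (Psi j) (f j) A | A in
    [set A | rectangles R n A /\ A x]].

End young_functions.

(* Main.v *)
(** Everything is first proved, with constants independent of the grid, for
    boxes that are unions of cells of a finite uniform grid; the theorem follows
    by refining the grid and Fatou's lemma, since a rectangle is contained in
    such a box of at most 2^n times its volume.

    On a grid, let B run through the boxes.  Every f_j is replaced by
    g_j = f_j (M w_j)^(1/p_j), M being the maximal function over the boxes:
    Hoelder's inequality bounds nu(B) by |B| prod_j (avg_B w_j)^(p/p_j), and
    (avg_B w_j)^(1/p_j) ||f_j||_B <= ||g_j||_B.  A greedy selection by decreasing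
    value of prod_j ||f_j||_B yields boxes B with disjoint parts E(B) of at least
    half the volume of B, such that more than half of every discarded box is
    covered by chosen boxes of no smaller value; as nu is in A_infinity the
    discarded boxes only cost a constant.  A second use of
    Hoelder's inequality reduces the theorem to
    sum_B |E(B)| ||g||_B^q <= C int g^q for Psi in B*_q.  Slicing over the dyadic
    levels of ||g||_B, this is an L log^(n-1) L weak type estimate for the strong
    maximal function, summed against the B*_q integral.  That estimate, and the
    weighted one behind the selection, come from iterating one-dimensional
    maximal functions, the weight being A_q along every line parallel to an
    axis. *)

Require Import Defs.
From HB Require Import structures.
From mathcomp Require Import all_boot all_order all_algebra.
From mathcomp Require Import all_classical all_reals all_analysis.
From mathcomp Require Import measurable_realfun.
From mathcomp Require Import zify ring lra.

Set Implicit Arguments.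
Unset Strict Implicit.
Unset Printing Implicit Defensive.

Import Order.TTheory GRing.Theory Num.Theory.
Import numFieldNormedType.Exports.

Local Open Scope ring_scope.

(** * Maximal functions on a finite grid *)

(** Passing to g_j removes the weights w_j from the Luxemburg norms, so the Orlicz estimate concerns
    Lebesgue measure alone, while nu enters only through the selection and through nu(B). The
    selection is run on the p-th powers of prod_j ||f_j||_B; the sum to be bounded is then linear in
    the selected values, for every p > 0.

    The delicate point is the iteration over directions: a one-dimensional weak type estimate
    controls level sets only, so its right side is sliced dyadically and the next direction is
    applied to every slice. The two uses tame the slices differently. For nu, only the indicator of
    the selected set at level 1/2 matters: it is at most 1 and the lowest level reached is 2^-(n+1),
    so n + 1 slices suffice and the constant is finite at the exponent q of A_q itself. In the
    Orlicz estimate the number of slices is unbounded and is paid for by the logarithm; the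
    direction applied first is handled by a plain weak (1,1) bound, which leaves n - 1 sums and
    hence the power n - 1.

    Cells make selections, maxima and level sets finite, and let a sum over parallel lines be
    treated by a mere reindexing. *)

Section interval_cover.
Context {R : realDomainType}.
Implicit Types (W g : nat -> R) (X : pred nat).

Lemma sum_nat_cond_le W X a b : (forall k, 0 <= W k) ->
  \sum_(a <= s < b | X s) W s <= \sum_(a <= s < b) W s.
Proof.
by move=> W0; rewrite big_mkcond; apply: ler_sum => k _; case: ifP.
Qed.

(** Sweep from the left: points outside [X] are skipped, and a point [k] of [X] is left by jumping
    to its [r]. The intervals used are disjoint and cover [X], so no constant is lost. *)
Lemma right_interval_cover W g X N : (forall k, 0 <= W k) ->
    (forall k, 0 <= g k) ->
    (forall k, (k < N)%N -> X k -> exists2 r, (k < r <= N)%N &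
      \sum_(k <= s < r) W s <= \sum_(k <= s < r) g s) ->
  \sum_(0 <= s < N | X s) W s <= \sum_(0 <= s < N) g s.
Proof.
move=> W0 g0 H.
suff C d x : (x + d = N)%N ->
  \sum_(x <= s < N | X s) W s <= \sum_(x <= s < N) g s by exact: (C N).
elim/ltn_ind: d x => -[|d] IH x xN.
  by rewrite !big_geq//; lia.
case: (boolP (X x)) => [Xx|nXx]; last first.
  have xltN : (x < N)%N by lia.
  rewrite big_ltn_cond// (negbTE nXx) (big_ltn xltN).
  by rewrite (le_trans (IH d _ _ _))// ?lerDr//; lia.
have [|r rN Hr] := H x _ Xx; first lia.
rewrite (@big_cat_nat _ _ _ r)//=; [|lia|lia].
rewrite [leRHS](@big_cat_nat _ _ _ r)//=; [|lia|lia].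
apply: lerD; first exact: le_trans (sum_nat_cond_le _ _ _ W0) Hr.
by apply: (IH (N - r)%N); lia.
Qed.

(** The mirror image, sweeping from the right. Truncating at [l] keeps the hypothesis, since the
    interval of a point below [l] ends at that point. *)
Lemma left_interval_cover W g X N : (forall k, 0 <= W k) ->
    (forall k, 0 <= g k) ->
    (forall k, (k < N)%N -> X k -> exists2 l, (l <= k)%N &
      \sum_(l <= s < k.+1) W s <= \sum_(l <= s < k.+1) g s) ->
  \sum_(0 <= s < N | X s) W s <= \sum_(0 <= s < N) g s.
Proof.
move=> W0 g0; elim/ltn_ind: N => -[|N] IH H; first by rewrite !big_geq.
case: (boolP (X N)) => [XN|nXN]; last first.
  rewrite big_mkcond !big_nat_recr//= (negbTE nXN) addr0 -big_mkcond/=.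
  rewrite (le_trans (IH N _ _))// ?lerDl// => k kN; apply: H; lia.
have [|l lN Hl] := H N _ XN; first lia.
rewrite (@big_cat_nat _ _ _ l)//=; [|lia].
rewrite [leRHS](@big_cat_nat _ _ _ l)//=; [|lia].
apply: lerD; last exact: le_trans (sum_nat_cond_le _ _ _ W0) Hl.
by apply: IH => // k kl; apply: H; lia.
Qed.

(* An interval [l, r) around k with W-mass at most its g-mass has at least one
   of its halves [k, r), [l, k] with W-mass at most twice its g-mass, so two
   one-sided covering arguments suffice. *)
Lemma interval_cover W g X N : (forall k, 0 <= W k) ->
    (forall k, 0 <= g k) ->
    (forall k, (k < N)%N -> X k -> exists l r, (l <= k < r)%N /\ (r <= N)%N /\
      \sum_(l <= s < r) W s <= \sum_(l <= s < r) g s) ->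
  \sum_(0 <= s < N | X s) W s <= 4 * \sum_(0 <= s < N) g s.
Proof.
move=> W0 g0 H.
pose g2 k := 2 * g k.
have g20 k : 0 <= g2 k by rewrite mulr_ge0.
pose XR k := [exists r : 'I_N.+1, (k < r)%N &&
  (\sum_(k <= s < r) W s <= \sum_(k <= s < r) g2 s)].
pose XL k := [exists l : 'I_N.+1, (l <= k)%N &&
  (\sum_(l <= s < k.+1) W s <= \sum_(l <= s < k.+1) g2 s)].
have HR : \sum_(0 <= s < N | XR s) W s <= \sum_(0 <= s < N) g2 s.
  apply: right_interval_cover => // k kN /existsP[r /andP[kr ?]].
  by exists r => //; rewrite kr -ltnS ltn_ord.
have HL : \sum_(0 <= s < N | XL s) W s <= \sum_(0 <= s < N) g2 s.
  apply: left_interval_cover => // k kN /existsP[l /andP[kl ?]].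
  by exists l.
have -> : 4 * \sum_(0 <= s < N) g s =
    \sum_(0 <= s < N) g2 s + \sum_(0 <= s < N) g2 s.
  by rewrite /g2 -!mulr_sumr; ring.
apply: le_trans (lerD HR HL).
rewrite big_mkcond (big_mkcond XR) (big_mkcond XL) -big_split/=.
rewrite big_nat_cond [leRHS]big_nat_cond.
apply: ler_sum => k; rewrite andbT => /andP[_ kN].
case: ifP => // Xk; last by apply: addr_ge0; case: ifP.
have : XR k || XL k.
  have [l [r [lkr [rN Hlr]]]] := H k kN Xk.
  apply/negPn/negP; rewrite negb_or => /andP[/existsPn nR /existsPn nL].
  have rN1 : (r < N.+1)%N by [].
  have lN1 : (l < N.+1)%N by lia.
  have := nR (Ordinal rN1); have := nL (Ordinal lN1).
  have /andP[-> ->] := lkr => /=.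
  rewrite -!ltNge /g2 -!mulr_sumr => {}nL {}nR.
  move: Hlr nL nR.
  rewrite (@big_cat_nat _ _ _ k)//=; [|lia|lia].
  rewrite [\sum_(l <= s < r) g s](@big_cat_nat _ _ _ k)//=; [|lia|lia].
  rewrite !big_nat_recr//=; [|lia|lia].
  rewrite [\sum_(k <= s < r) W s]big_ltn; last lia.
  rewrite [\sum_(k <= s < r) g s]big_ltn; last lia.
  have := W0 k; have := g0 k.
  have : 0 <= \sum_(k.+1 <= s < r) W s by exact: sumr_ge0.
  have : 0 <= \sum_(l <= s < k) W s by exact: sumr_ge0.
  lra.
case/orP => ->; first by rewrite lerDl; case: ifP.
by rewrite lerDr; case: ifP.
Qed.

End interval_cover.

Lemma ler_powR2r {R : realType} (q x y : R) : 0 <= q -> 0 <= x -> x <= y ->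
  x `^ q <= y `^ q.
Proof.
move=> q0 x0 xy; apply: ge0_ler_powR => //; rewrite nnegrE//.
exact: le_trans xy.
Qed.

(** * Coordinate lines of the grid *)

Section cells.
Context {n N : nat}.
Notation Z := {ffun 'I_n -> 'I_N.+1}.

Definition upd (k : Z) (i : 'I_n) (s : 'I_N.+1) : Z :=
  [ffun j => if j == i then s else k j].

(** An involution on pairs of a cell and a coordinate value; reindexing by it is the finite form of
    Fubini's theorem along the lines in direction [i]. *)
Definition upd_swap i (ks : Z * 'I_N.+1) := (upd ks.1 i ks.2, ks.1 i).

Lemma upd_id k i s : upd k i s i = s.
Proof. by rewrite ffunE eqxx. Qed.

Lemma upd_upd k i s t : upd (upd k i s) i t = upd k i t.
Proof. by apply/ffunP => j; rewrite !ffunE; case: eqP. Qed.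

Lemma upd_self k i : upd k i (k i) = k.
Proof. by apply/ffunP => j; rewrite !ffunE; case: eqP => [->|]. Qed.

Lemma upd_swapK i : involutive (upd_swap i).
Proof. by case=> k s; rewrite /upd_swap/= upd_id upd_upd upd_self. Qed.

Lemma sum_upd (V : nmodType) (F : Z -> V) i :
  \sum_k \sum_s F (upd k i s) = (\sum_k F k) *+ N.+1.
Proof.
rewrite pair_big/= (reindex_inj (inv_inj (upd_swapK i)))/=.
under eq_bigr do rewrite upd_upd upd_self.
rewrite -(pair_big xpredT xpredT (fun k _ => F k))/=.
under eq_bigr do rewrite sumr_const card_ord.
by rewrite sumrMnl.
Qed.

Lemma sum_interval (V : nmodType) (F : 'I_N.+1 -> V) l r : (r <= N.+1)%N ->
  \sum_(l <= s < r) F (inord s) = \sum_(s : 'I_N.+1 | (l <= s < r)%N) F s.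
Proof.
move=> rN; rewrite (big_nat_widen _ _ _ _ _ rN) (@big_nat_widenl _ _ _ l 0)//.
rewrite big_mkord; apply: eq_big => [s|s _]; first by rewrite andbC.
by rewrite inord_val.
Qed.

Section line_cover.
Context {R : realDomainType}.

(** [interval_cover] is applied on the line through each cell. Summing these bounds over all cells
    counts every cell [N.+1] times on both sides, so no representatives of the lines have to be
    chosen. *)
Lemma line_cover (W g : Z -> R) (X : pred Z) i :
    (forall k, 0 <= W k) -> (forall k, 0 <= g k) ->
    (forall k, X k -> exists l r, (l <= k i < r)%N /\ (r <= N.+1)%N /\
      \sum_(s : 'I_N.+1 | (l <= s < r)%N) W (upd k i s) <=
      \sum_(s : 'I_N.+1 | (l <= s < r)%N) g (upd k i s)) ->
  \sum_(k | X k) W k <= 4 * \sum_k g k.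
Proof.
move=> W0 g0 H; rewrite -(@ler_pMn2r _ N.+1)// -mulrnAr -!(sum_upd _ i).
rewrite big_mkcond/= -(sum_upd _ i) mulr_sumr; apply: ler_sum => k _.
pose W' s := W (upd k i (inord s)); pose g' s := g (upd k i (inord s)).
rewrite (_ : \sum_(s < N.+1) g _ = \sum_(0 <= s < N.+1) g' s); last first.
  by rewrite big_mkord; apply: eq_bigr => s _; rewrite /g' inord_val.
rewrite -big_mkcond/= (_ : \sum_(s < N.+1 | _) W _ =
    \sum_(0 <= s < N.+1 | X (upd k i (inord s))) W' s); last first.
  rewrite big_mkord; apply: eq_big => s; first by rewrite inord_val.
  by rewrite /W' inord_val.
apply: interval_cover => [s|s|s sN Xs]; rewrite /W' /g'//.
have [l [r [lsr [rN H']]]] := H _ Xs.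
exists l, r; move: lsr H'; rewrite upd_id inordK// => -> H'; split => //.
split => //; rewrite (sum_interval (fun t => W (upd k i t)))//.
rewrite (sum_interval (fun t => g (upd k i t)))//.
under eq_bigr do rewrite -(upd_upd k i (inord s)).
by under [leRHS]eq_bigr do rewrite -(upd_upd k i (inord s)).
Qed.

End line_cover.
End cells.

(** * One-dimensional weak type estimates *)

Section axis_maximal.
Context {n N : nat} {R : realType}.
Notation Z := {ffun 'I_n -> 'I_N.+1}.
Implicit Types (h W : Z -> R) (k : Z).

Definition axis_avg i (l r : nat) h (k : Z) : R :=
  (\sum_(s : 'I_N.+1 | (l <= s < r)%N) h (upd k i s)) / (r - l)%:R.

Definition axis_max i h (k : Z) : R :=
  \big[Num.max/0]_(lr : 'I_N.+2 * 'I_N.+2 | (lr.1 <= k i < lr.2)%N)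
    axis_avg i lr.1 lr.2 h k.

Lemma axis_avg_le_max i l r h k : (l <= k i < r)%N -> (r <= N.+1)%N ->
  axis_avg i l r h k <= axis_max i h k.
Proof.
move=> lkr rN.
have rN' : (r < N.+2)%N by [].
have lN' : (l < N.+2)%N by case/andP: lkr => lk kr; lia.
exact: (le_bigmax_cond 0 (fun lr : 'I_N.+2 * 'I_N.+2 =>
  axis_avg i lr.1 lr.2 h k) (j := (Ordinal lN', Ordinal rN'))).
Qed.

Lemma axis_max_ge0 i h k : 0 <= axis_max i h k.
Proof. exact: bigmax_ge_id. Qed.

Lemma axis_max_gt i h k s : 0 <= s -> s < axis_max i h k ->
  exists l r, (l <= k i < r)%N /\ (r <= N.+1)%N /\ s < axis_avg i l r h k.
Proof.
move=> s0 sM; apply: contrapT => H; move: sM; rewrite ltNge => /negP; apply.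
apply: bigmax_le => // -[l r]/= lkr; rewrite leNgt; apply/negP => ?.
by apply: H; exists l, r; split => //; split => //; rewrite -ltnS.
Qed.

Lemma card_interval l r : (r <= N.+1)%N ->
  \sum_(s : 'I_N.+1 | (l <= s < r)%N) (1 : R) = (r - l)%:R.
Proof.
move=> rN; rewrite -(sum_interval (fun=> 1))//.
by rewrite big_const_nat iter_addr addr0.
Qed.

Lemma le_axis_avg i l r h h' k :
  (forall s : 'I_N.+1, (l <= s < r)%N -> h (upd k i s) <= h' (upd k i s)) ->
  axis_avg i l r h k <= axis_avg i l r h' k.
Proof. by move=> hh'; rewrite ler_wpM2r ?invr_ge0//; exact: ler_sum. Qed.

Lemma axis_avgD_cst i l r h c k : (l < r)%N -> (r <= N.+1)%N ->
  axis_avg i l r (fun x => h x + c) k = axis_avg i l r h k + c.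
Proof.
move=> lr rN; rewrite /axis_avg big_split/= mulrDl; congr (_ + _).
rewrite -[c in LHS]mulr1 -mulr_sumr card_interval// mulfK// pnatr_eq0.
by rewrite subn_eq0 -ltnNge.
Qed.

Lemma axis_max_le i h c k : 0 <= c -> (forall k, h k <= c) ->
  axis_max i h k <= c.
Proof.
move=> c0 hc; apply: bigmax_le => // -[l r]/= /andP[lk kr].
apply: (@le_trans _ _ (axis_avg i l r (fun=> 0 + c) k)).
  by apply: le_axis_avg => s _; rewrite add0r.
rewrite axis_avgD_cst; last 2 first.
- by lia.
- by rewrite -ltnS.
by rewrite /axis_avg big1// mul0r add0r.
Qed.

Section weighted.
Variables (W : Z -> R) (q K : R).
Hypotheses (W0 : forall k, 0 <= W k) (q1 : 1 <= q) (K0 : 0 <= K).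

(** The A_q condition along all lines parallel to an axis, in its form tested on functions: it
    contains no negative power of [W], so [W] may vanish on cells. *)
Definition axis_weighted := forall i k l r h, (forall k, 0 <= h k) ->
  (l <= k i < r)%N -> (r <= N.+1)%N ->
  (\sum_(s : 'I_N.+1 | (l <= s < r)%N) W (upd k i s)) * (axis_avg i l r h k) `^ q <=
  K * \sum_(s : 'I_N.+1 | (l <= s < r)%N) (W (upd k i s) * h (upd k i s) `^ q).

Hypothesis HW : axis_weighted.

Let q0 : 0 <= q. Proof. exact: le_trans q1. Qed.

(** The part of [h] below [s / 2] contributes at most [s / 2] to an average, so an average of [h]
    above [s] leaves at least [s / 2] to the truncation [h']. This costs [2 ^ q], and the 4 is that
    of [line_cover]. *)
Lemma axis_weak i h s : (forall k, 0 <= h k) -> 0 < s ->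
  s `^ q * \sum_(k | s < axis_max i h k) W k <=
  4 * (K * 2 `^ q) * \sum_(k | s / 2 < h k) W k * h k `^ q.
Proof.
move=> h0 s0; rewrite -mulrA [X in _ <= _ * X]mulr_sumr [X in _ <= _ * X]big_mkcond/=.
rewrite mulr_sumr.
pose h' k := if s / 2 < h k then h k else 0.
have h'0 k : 0 <= h' k by rewrite /h'; case: ifP.
rewrite (_ : \sum_i0 _ = \sum_k K * 2 `^ q * (W k * h' k `^ q)); last first.
  apply: eq_bigr => k _; rewrite /h'; case: ifP => // _.
  by rewrite powR0 ?mulr0// gt_eqF// (lt_le_trans _ q1).
apply: (line_cover (i := i)) => [k|k|k].
- by rewrite mulr_ge0// powR_ge0.
- by rewrite !mulr_ge0// powR_ge0.
move=> /(axis_max_gt (ltW s0))[l [r [lkr [rN sav]]]].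
exists l, r; split => //; split => //.
have lr : (l < r)%N by lia.
have sav' : s <= 2 * axis_avg i l r h' k.
  have : axis_avg i l r h k <= axis_avg i l r (fun x => h' x + s / 2) k.
    apply: le_axis_avg => t _; rewrite /h'; case: ltP; rewrite ?add0r//.
    by move=> _; rewrite lerDl; lra.
  by rewrite axis_avgD_cst// => /(lt_le_trans sav); lra.
have av0 : 0 <= axis_avg i l r h' k by lra.
rewrite -!mulr_sumr (mulrC K) -mulrA.
apply: le_trans (_ : 2 `^ q * ((\sum_(t : 'I_N.+1 | (l <= t < r)%N)
   W (upd k i t)) * axis_avg i l r h' k `^ q) <= _); last first.
  by rewrite ler_wpM2l ?powR_ge0//; apply: HW.
rewrite mulrCA mulrC ler_wpM2l ?sumr_ge0// -powRM//.
by rewrite ler_powR2r// ltW.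
Qed.

(** One term suffices, that of the largest [i] with [2 ^+ i * t < y]. The whole sum is kept because
    it is additive in the level sets of [y]. *)
Lemma dyadic_layer (y t : R) L : 0 < t -> t < y -> y <= 2 ^+ L * t ->
  y `^ q <= \sum_(0 <= i < L | 2 ^+ i * t < y) (2 * (2 ^+ i * t)) `^ q.
Proof.
move=> t0 ty; elim: L => [|L IH] yL.
  by move: yL; rewrite expr0 mul1r leNgt ty.
have S0 : 0 <= \sum_(0 <= i < L | 2 ^+ i * t < y) (2 * (2 ^+ i * t)) `^ q.
  by apply: sumr_ge0 => i _; exact: powR_ge0.
rewrite big_mkcond big_nat_recr//= -big_mkcond/=.
case: ltP => [|/IH]; last by rewrite addr0.
move=> _; apply: ler_wpDl => //; apply: ler_powR2r => //.
  exact: ltW (lt_trans t0 ty).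
by rewrite mulrA -exprS.
Qed.

(** The right side of [axis_weak] is expressed by level sets of [h] alone; when [h] is itself a
    maximal function in another direction, these are again of the kind being estimated, which
    permits iteration. *)
Lemma axis_layers i h s L : (forall k, 0 <= h k) -> 0 < s ->
  (forall k, h k <= 2 ^+ L * (s / 2)) ->
  s `^ q * \sum_(k | s < axis_max i h k) W k <=
  4 * K * 2 `^ q * 2 `^ q * \sum_(0 <= j < L)
    (2 ^+ j * (s / 2)) `^ q * \sum_(k | 2 ^+ j * (s / 2) < h k) W k.
Proof.
move=> h0 s0 hL; apply: le_trans (axis_weak i h0 s0) _.
rewrite [4 * (K * _)]mulrA -[leRHS]mulrA ler_wpM2l ?mulr_ge0 ?powR_ge0//.
rewrite mulr_sumr; under [leRHS]eq_bigr do rewrite mulr_sumr mulr_sumr big_mkcond/=.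
rewrite exchange_big/= big_mkcond/=; apply: ler_sum => k _.
case: ifPn => [sh|_]; last first.
  apply: sumr_ge0 => j _; case: ifP => // _.
  by rewrite !mulr_ge0// powR_ge0.
rewrite -big_mkcond/=; have s20 : 0 < s / 2 by rewrite divr_gt0.
have := ler_wpM2l (W0 k) (dyadic_layer s20 sh (hL k)).
move=> /le_trans; apply; rewrite mulr_sumr; apply: ler_sum => j _.
rewrite powRM//; last by rewrite mulr_ge0// ?exprn_ge0// ltW.
by rewrite mulrC -mulrA.
Qed.

End weighted.
End axis_maximal.

(* The multiplicity of the level 2^M after j one-dimensional weak type
   estimates, each of which sums over the levels above a given one. *)
Fixpoint layer_weight (j M : nat) : nat :=
  if j is j'.+1 then \sum_(0 <= k < M.+1) layer_weight j' k else (M == 0).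

(** Each further prefix sum costs at most a factor [M]. When [2 ^+ M] is comparable to a function
    value, this power of [M] is the power of its logarithm. *)
Lemma sum_layer_weight j M : (\sum_(0 <= k < M) layer_weight j k <= M ^ j)%N.
Proof.
elim: j M => [|j IH] M.
  rewrite expn0; case: M => [|M]; first by rewrite big_geq.
  by rewrite big_nat_recl// big1.
case: M => [|M]; first by rewrite big_geq.
rewrite expnS -[X in (X * _)%N]subn0 -sum_nat_const_nat.
rewrite big_nat_cond [leqRHS]big_nat_cond; apply: leq_sum => k /=.
rewrite andbT => kM; apply: leq_trans (IH _) _.
by case: (j) => [|j'] //; rewrite leq_exp2r.
Qed.

(** Grouping by the total level [M + i] turns one more one-dimensional estimate into one more prefix
    sum, the recursion of [layer_weight]. *)
Lemma triangle_sum (R : comPzRingType) (c : nat -> nat) (G : nat -> R) L :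
  \sum_(0 <= i < L) \sum_(0 <= M < L - i) (c M)%:R * G (M + i)%N =
  \sum_(0 <= M < L) (\sum_(0 <= k < M.+1) c k)%N%:R * G M.
Proof.
elim: L => [|L IH]; first by rewrite !big_geq.
have E : (\sum_(0 <= k < L.+1) c k = \sum_(0 <= i < L) c (L - i) + c 0)%N.
  by rewrite big_nat_rev/= big_nat_recr//= subnn.
rewrite [RHS]big_nat_recr//= -IH [LHS]big_nat_recr//=.
rewrite subSnn big_nat1 add0n E natrD mulrDl addrA; congr (_ + _).
rewrite (eq_big_nat _ _ (F2 := fun i => (\sum_(0 <= M < L - i)
  (c M)%:R * G (M + i)%N) + (c (L - i)%N)%:R * G L)); last first.
  move=> i /andP[_ iL]; rewrite subSn ?(ltnW iL)// big_nat_recr//=.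
  by rewrite subnK ?(ltnW iL).
by rewrite big_split/= -mulr_suml natr_sum.
Qed.

(** * Iteration over the directions *)

Section iteration.
Context {n N : nat} {R : realType}.
Notation Z := {ffun 'I_n -> 'I_N.+1}.
Variables (W : Z -> R) (q K : R).
Hypotheses (W0 : forall k, 0 <= W k) (q1 : 1 <= q) (K0 : 0 <= K).
Hypothesis HW : axis_weighted W q K.

Definition iter_max (s : seq 'I_n) (h : Z -> R) := foldr axis_max h s.

Lemma iter_max_ge0 s h k : (forall k, 0 <= h k) -> 0 <= iter_max s h k.
Proof. by case: s => //= i s h0; exact: axis_max_ge0. Qed.

Lemma iter_max_le s h c k : 0 <= c -> (forall k, h k <= c) ->
  iter_max s h k <= c.
Proof. by move=> c0 hc; elim: s k => //= i s IH k; exact: axis_max_le. Qed.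

Let C := 4 * K * 2 `^ q * 2 `^ q.

(** [Theta] abstracts the bound for the level sets of [h] itself: it is instantiated once with an
    indicator function and once with a weak (1,1) bound. Every direction halves the level, whence
    [t / 2 ^+ size s]; [L] counts the layers up to the supremum of [h]. *)
Lemma iter_max_layers (h : Z -> R) (Theta : R -> R) :
  (forall k, 0 <= h k) ->
  (forall s, 0 < s -> s `^ q * \sum_(k | s < h k) W k <= Theta s) ->
  forall (s : seq 'I_n) (t : R) L, 0 < t ->
  (forall k, h k <= 2 ^+ L * (t / 2 ^+ size s)) ->
  t `^ q * \sum_(k | t < iter_max s h k) W k <=
  C ^+ size s * \sum_(0 <= M < L) (layer_weight (size s) M)%:R *
    Theta (2 ^+ M * (t / 2 ^+ size s)).
Proof.
move=> h0 HTheta; elim=> [|i s IH] t L t0 hL /=.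
  rewrite expr0 mul1r divr1; case: L hL => [|L] hL.
    rewrite big_geq// big1 ?mulr0// => k; rewrite ltNge.
    by have := hL k; rewrite expr0 divr1 mul1r => ->.
  rewrite big_nat_recl// [in leRHS]big1 => [|M _]; last by rewrite mul0r.
  by rewrite mul1r addr0 expr0 mul1r; exact: HTheta.
have t20 : 0 < t / 2 by rewrite divr_gt0.
have E : t / 2 ^+ (size s).+1 = (t / 2) / 2 ^+ size s.
  by rewrite exprS invfM mulrA.
rewrite E in hL *.
have hL' k : iter_max s h k <= 2 ^+ L * (t / 2).
  apply: iter_max_le => [|k']; first by rewrite mulr_ge0 ?exprn_ge0 ?ltW.
  apply: le_trans (hL k') _; rewrite ler_wpM2l ?exprn_ge0//.
  by rewrite ler_pdivrMr ?exprn_gt0// ler_peMr ?(ltW t20)// exprn_ege1// ler1n.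
apply: le_trans (axis_layers W0 q1 K0 HW _ _ t0 hL') _.
  by move=> k; exact: iter_max_ge0.
have C0 : 0 <= C by rewrite !mulr_ge0 ?powR_ge0.
rewrite [C ^+ _]exprS -[leRHS]mulrA ler_wpM2l//.
(* The [j]-th slice starts at a level [2 ^+ j] times higher, so only [L - j] layers remain for the
   other directions. *)
apply: le_trans (_ : \sum_(0 <= j < L) C ^+ size s *
  \sum_(0 <= M < L - j) (layer_weight (size s) M)%:R *
    Theta (2 ^+ (M + j) * ((t / 2) / 2 ^+ size s)) <= _); last first.
  rewrite -mulr_sumr (triangle_sum (layer_weight (size s))
    (fun M => Theta (2 ^+ M * ((t / 2) / 2 ^+ size s)))).
  exact: lexx.
rewrite big_nat_cond [leRHS]big_nat_cond; apply: ler_sum => j.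
rewrite andbT => /andP[_ jL].
have E' M : 2 ^+ M * (2 ^+ j * (t / 2) / 2 ^+ size s) =
    2 ^+ (M + j) * ((t / 2) / 2 ^+ size s) by rewrite exprD !mulrA.
under [X in _ <= _ * X]eq_bigr do rewrite -E'.
apply: IH; first by rewrite mulr_gt0 ?exprn_gt0.
by move=> k; rewrite E' subnK 1?ltnW.
Qed.

End iteration.

(** * Box averages and iterated maximal functions *)

Section boxes.
Context {n N : nat}.
Notation Z := {ffun 'I_n -> 'I_N.+1}.
Implicit Types (u v : 'I_n -> nat) (k : Z).

Definition cell_box u v : {set Z} := [set k : Z | [forall i, (u i <= k i < v i)%N]].

Lemma in_cell_box u v k :
  reflect (forall i, (u i <= k i < v i)%N) (k \in cell_box u v).
Proof. by rewrite inE; exact: forallP. Qed.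

Lemma upd_cell_box u v k i (s : 'I_N.+1) :
  (k \in cell_box u v) && (u i <= s < v i)%N =
  (upd k i s \in cell_box u v) && (u i <= k i < v i)%N.
Proof.
apply/andP/andP => -[/in_cell_box kuv si].
  split=> //; apply/in_cell_box => j; rewrite ffunE.
  by case: eqP => [->|].
split; last by have := kuv i; rewrite upd_id.
apply/in_cell_box => j; have := kuv j; rewrite ffunE.
by case: eqP => [->|].
Qed.

Context {R : realType}.
Implicit Type h : Z -> R.

Definition box_avg u v h : R :=
  (\sum_(k in cell_box u v) h k) / #|cell_box u v|%:R.

Lemma sum_axis_avg u v h i : (u i < v i <= N.+1)%N ->
  \sum_(k in cell_box u v) axis_avg i (u i) (v i) h k =
  \sum_(k in cell_box u v) h k.
Proof.
move=> /andP[uv vN]; rewrite -mulr_suml.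
apply: (canLR (mulfK _)); first by rewrite pnatr_eq0 subn_eq0 -ltnNge.
rewrite pair_big_dep/= (reindex_inj (inv_inj (upd_swapK i)))/=.
under eq_bigr do rewrite upd_upd upd_self.
under eq_bigl do rewrite -upd_cell_box.
rewrite -(pair_big_dep (mem (cell_box u v)) (fun k (s : 'I_N.+1) => (u i <= s < v i)%N)
   (fun k _ => h k))/=.
rewrite mulr_suml; apply: eq_bigr => k _.
by rewrite -(@card_interval N R _ _ vN) mulr_sumr; under [RHS]eq_bigr do rewrite mulr1.
Qed.

Let avgs u v := fun i => axis_avg i (u i) (v i) : (Z -> R) -> Z -> R.

Lemma avgs_const u v h (s : seq 'I_n) k k' :
  (forall i, i \notin s -> k i = k' i) ->
  foldr (avgs u v) h s k = foldr (avgs u v) h s k'.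
Proof.
elim: s k k' => [|i s IH] k k' kk' /=.
  by congr h; apply/ffunP => i; apply: kk'.
rewrite /avgs/axis_avg; congr (_ / _); apply: eq_bigr => t _.
apply: IH => j js; rewrite !ffunE; case: eqP => // /eqP ji.
by apply: kk'; rewrite inE negb_or ji.
Qed.

Lemma avgs_le_max u v h (s : seq 'I_n) k : (forall i, v i <= N.+1)%N ->
  k \in cell_box u v -> foldr (avgs u v) h s k <= iter_max s h k.
Proof.
move=> vN; elim: s k => //= i s IH k /in_cell_box kuv.
apply: le_trans (axis_avg_le_max _ (kuv i) (vN i)).
apply: le_axis_avg => t ti; apply: IH.
suff : (upd k i t \in cell_box u v) && (u i <= k i < v i)%N by case/andP.
by rewrite -upd_cell_box ti andbT; exact/in_cell_box.
Qed.

(** Averaging over the sides of the box in all directions in turn preserves the sum over the box and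
    ends with a constant on it, which is therefore the box average. Each of these averages is at
    most the corresponding one-dimensional maximal function. *)
Lemma box_avg_le_max u v h k : (forall i, v i <= N.+1)%N ->
  k \in cell_box u v -> box_avg u v h <= iter_max (enum 'I_n) h k.
Proof.
move=> vN kuv; apply: le_trans (avgs_le_max h (enum 'I_n) vN kuv).
have uv i : (u i < v i <= N.+1)%N.
  by rewrite vN andbT; move/in_cell_box: kuv => /(_ i)/andP[/leq_ltn_trans]; exact.
have avgsE s : \sum_(k in cell_box u v) foldr (avgs u v) h s k =
    \sum_(k in cell_box u v) h k.
  by elim: s => //= i s IH; rewrite -IH sum_axis_avg.
rewrite /box_avg -(avgsE (enum 'I_n)).
rewrite (eq_bigr (fun=> foldr (avgs u v) h (enum 'I_n) k)); last first.
  by move=> k' _; apply: avgs_const => i; rewrite mem_enum.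
rewrite sumr_const -[X in X / _]mulr_natr mulfK// pnatr_eq0.
by rewrite -lt0n; apply/card_gt0P; exists k.
Qed.

End boxes.
Arguments cell_box {n} N u v.

(** * Scattered selection *)

Section doubling_set.
Context {n N : nat} {R : realType}.
Notation Z := {ffun 'I_n -> 'I_N.+1}.
Variables (W : Z -> R) (q K : R).
Hypotheses (W0 : forall k, 0 <= W k) (q1 : 1 <= q) (K0 : 0 <= K).
Hypothesis HW : axis_weighted W q K.

(** The factors come from the level 1/2, from the [n] applications of [axis_layers], and from
    [sum_layer_weight] with [n.+1] layers. *)
Definition half_density_const : R :=
  2 `^ q * (4 * K * 2 `^ q * 2 `^ q) ^+ n * (n.+1 ^ n)%N%:R.

Lemma half_density_const_ge0 : 0 <= half_density_const.
Proof. by rewrite !mulr_ge0 ?exprn_ge0 ?mulr_ge0 ?powR_ge0. Qed.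

(** [X] lies where the iterated maximal function of the indicator of [V] exceeds 1/2, and every
    level set of that indicator is [V] or empty. *)
Lemma half_density_weight (V X : {set Z}) :
  (forall k, k \in X -> exists u v, [/\ (forall i, v i <= N.+1)%N,
     k \in cell_box N u v &
     (#|cell_box N u v| < 2 * #|cell_box N u v :&: V|)%N]) ->
  \sum_(k in X) W k <= half_density_const * \sum_(k in V) W k.
Proof.
move=> HX; pose h k : R := (k \in V)%:R.
have h0 k : 0 <= h k by rewrite /h.
have HTheta s : 0 < s -> s `^ q * \sum_(k | s < h k) W k <=
    \sum_(k in V) W k.
  move=> s0; have [s1|s1] := ltP s 1; last first.
    rewrite big1 ?mulr0 ?sumr_ge0// => k; rewrite /h => /(le_lt_trans s1).
    by case: (_ \in _); rewrite ?ltxx ?ltr10.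
  apply: (@le_trans _ _ (1 * \sum_(k | s < h k) W k)).
    rewrite ler_wpM2r ?sumr_ge0//.
    apply: le_trans (ler_powR2r _ _ (ltW s1)) _; rewrite ?powR1// ?ltW//.
    exact: lt_le_trans q1.
  rewrite mul1r big_mkcond [leRHS]big_mkcond; apply: ler_sum => k _.
  rewrite /h; case: (_ \in _); first by rewrite s1.
  by rewrite ltNge (ltW s0).
(* The right side equals 1: starting from the level 1/2 halved [n] times, [n.+1] doublings reach the
   maximum of an indicator. *)
have hL k : h k <= 2 ^+ n.+1 * (2^-1 / 2 ^+ size (enum 'I_n)).
  rewrite size_enum_ord exprS mulrACA !mulfV ?expf_neq0 ?pnatr_eq0// mulr1.
  by rewrite /h; case: (_ \in _).
have t0 : 0 < 2^-1 :> R by rewrite invr_gt0.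
have := iter_max_layers W0 q1 K0 HW h0 HTheta t0 hL.
rewrite size_enum_ord -mulr_suml => H.
apply: (@le_trans _ _ (\sum_(k | 2^-1 < iter_max (enum 'I_n) h k) W k)).
  rewrite big_mkcond [leRHS]big_mkcond; apply: ler_sum => k _.
  case: ifP => // [/HX[u [v [vN kuv card_lt]]]|_]; last by case: ifP.
  rewrite (lt_le_trans _ (box_avg_le_max h vN kuv))//.
  rewrite /box_avg ltr_pdivlMr; last first.
    by rewrite ltr0n; apply/card_gt0P; exists k.
  rewrite mulrC ltr_pdivrMr//.
  rewrite (_ : \sum_(_ in _) _ = #|cell_box N u v :&: V|%:R); last first.
    rewrite /h -natr_sum -sum1_card; congr _%:R.
    rewrite [RHS]big_mkcond/= [LHS]big_mkcond/=; apply: eq_bigr => i _.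
    by rewrite [in RHS]inE; case: (_ \in _) => //=; case: (_ \in _).
  by rewrite -natrM ltr_nat mulnC.
have W_sum0 : 0 <= \sum_(k in V) W k by exact: sumr_ge0.
rewrite -(@ler_pM2l _ (2^-1 `^ q)) ?powR_gt0//; apply: le_trans H _.
rewrite /half_density_const !mulrA -powRM ?invr_ge0// mulVf ?pnatr_eq0// powR1 mul1r.
rewrite -[leLHS]mulrA -[leRHS]mulrA ler_wpM2l//.
  by rewrite exprn_ge0// !mulr_ge0 ?powR_ge0.
rewrite ler_wpM2r// -natr_sum ler_nat; exact: sum_layer_weight.
Qed.

End doubling_set.

Arguments half_density_const n {R} q K.

(** * Weak type estimate with a logarithm, on cells *)

Section llog_weak_type.
Context {n N : nat} {R : realType}.
Notation Z := {ffun 'I_n -> 'I_N.+1}.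

(** [b] plays the part of [h] above [s / 2]. It is kept abstract because [h] will be a cell average
    of a function that is truncated before it is averaged. *)
Lemma axis_weak1 i (h b : Z -> R) s : 0 < s -> (forall k, 0 <= b k) ->
  (forall k, h k <= b k + s / 2) ->
  s * \sum_(k | s < axis_max i h k) 1 <= 8 * \sum_k b k.
Proof.
move=> s0 b0 hb; rewrite mulr_sumr mulr1.
rewrite (_ : 8 * _ = 4 * \sum_k 2 * b k); last by rewrite -mulr_sumr; ring.
apply: (line_cover (W := fun=> s) (i := i)) => [k|k|k].
- exact: ltW.
- by rewrite mulr_ge0.
move=> /(axis_max_gt (ltW s0))[l [r [lkr [rN sav]]]].
exists l, r; split => //; split => //.
have lr : (l < r)%N by lia.
have : s / 2 <= axis_avg i l r b k.
  have : axis_avg i l r h k <= axis_avg i l r (fun x => b x + s / 2) k.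
    by apply: le_axis_avg => t _.
  by rewrite axis_avgD_cst// => /(lt_le_trans sav); lra.
rewrite /axis_avg ler_pdivlMr ?ltr0n ?subn_gt0// -(@card_interval N R)//.
rewrite -mulr_sumr => H.
rewrite (_ : \sum_(t : 'I_N.+1 | (l <= t < r)%N) s =
  s * \sum_(t : 'I_N.+1 | (l <= t < r)%N) 1); first by lra.
by rewrite mulr_sumr mulr1.
Qed.

Lemma axis_weighted1 : axis_weighted (fun=> 1 : R) 1 1 (n := n) (N := N).
Proof.
move=> i k l r h h0 lkr rN; rewrite powRr1; last first.
  by rewrite divr_ge0// sumr_ge0.
rewrite card_interval// /axis_avg mulrC mulfVK; last first.
  by rewrite pnatr_eq0 subn_eq0 -ltnNge; lia.
rewrite mul1r; under [leRHS]eq_bigr do rewrite powRr1// mul1r.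
exact: lexx.
Qed.

(** [foldr] applies the last direction of the list first; it is split off and handled by
    [axis_weak1], so that only [n.-1] directions pay a sum over layers. The base 16 is [4 * 2 * 2],
    the constant of [axis_layers] for [q] and [K] equal to 1. *)
Lemma iter_max_llog (h : Z -> R) (b : R -> Z -> R) L : (0 < n)%N ->
  (forall k, 0 <= h k) ->
  (forall s k, 0 < s -> 0 <= b s k) ->
  (forall s k, 0 < s -> h k <= b s k + s / 2) ->
  (forall k, h k <= 2 ^+ L / 2 ^+ n.-1) ->
  \sum_(k | 1 < iter_max (enum 'I_n) h k) 1 <=
  8 * 16 ^+ n.-1 * \sum_(0 <= M < L) (layer_weight n.-1 M)%:R *
    \sum_k b (2 ^+ M / 2 ^+ n.-1) k.
Proof.
move=> n0 h0 b0 hb hL.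
have: size (enum 'I_n) = n by rewrite size_enum_ord.
case/lastP: (enum 'I_n) => [|s i].
  by move=> /= sn; exfalso; lia.
rewrite size_rcons => sn; have n1 : n.-1 = size s by lia.
rewrite n1 in hL *.
pose Theta t := 8 * \sum_k b t k.
have HTheta t : 0 < t -> t `^ 1 * \sum_(k | t < axis_max i h k) 1 <= Theta t.
  move=> t0; rewrite powRr1 ?(ltW t0)//.
  by apply: axis_weak1 => // k; [exact: b0 | exact: hb].
have hL' k : axis_max i h k <= 2 ^+ L * (1 / 2 ^+ size s).
  by apply: axis_max_le; rewrite ?mul1r// divr_ge0// exprn_ge0.
have := @iter_max_layers n N R (fun=> 1) 1 1 (fun=> ler01) (lexx _) ler01
  axis_weighted1 _ Theta (axis_max_ge0 i h) HTheta s 1 L ltr01 hL'.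
rewrite powRr1// mul1r /iter_max foldr_rcons => /le_trans; apply.
rewrite /Theta powRr1// mulr1 mul1r (_ : 4 * 2 * 2 = 16); last by ring.
rewrite [8 * _]mulrC -mulrA ler_wpM2l ?exprn_ge0// mulr_sumr.
apply: ler_sum => M _; by rewrite mulrCA.
Qed.

End llog_weak_type.

(** * Layer cake comparison *)

Section comparison.
Context {R : realDomainType} {Z : finType}.

(** The layer cake integral of the indicator of [t < y] over [t] above [t0], computed as a left
    Riemann sum on the nodes [ts]; it is exact when [y] is a node. *)
Fixpoint staircase (t0 : R) (ts : seq R) (y : R) : R :=
  if ts is t1 :: ts' then (t1 - t0) * (t0 < y)%R%:R + staircase t1 ts' y else 0.

Lemma staircaseE t0 ts y : path <%R t0 ts -> y \in t0 :: ts ->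
  staircase t0 ts y = y - t0.
Proof.
have le0 z u ss : path <%R u ss -> z <= u -> staircase u ss z = 0.
  elim: ss u => //= t1 ss IH u /andP[ut1 pss] yu.
  by rewrite ltNge yu mulr0 add0r IH// (le_trans yu)// ltW.
elim: ts t0 => [|t1 ts IH] t0 /=; first by rewrite inE => _ /eqP ->; rewrite subrr.
move=> /andP[t01 pts]; rewrite inE => /predU1P[->|yts].
  by rewrite ltxx mulr0 add0r subrr le0// ltW.
have t0y : t0 < y.
  move: yts; rewrite inE => /predU1P[->//|yts].
  have /allP/(_ _ yts) := order_path_min lt_trans pts.
  exact: lt_trans t01.
by rewrite t0y mulr1 IH//; ring.
Qed.

(* Layer cake over the finitely many values of f and g. *)
Lemma sum_le_of_superlevel (W f g : Z -> R) C : 0 <= C ->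
  (forall k, 0 <= W k) -> (forall k, 0 <= f k) -> (forall k, 0 <= g k) ->
  (forall t, 0 <= t -> \sum_(k | t < f k) W k <= C * \sum_(k | t < g k) W k) ->
  \sum_k W k * f k <= C * \sum_k W k * g k.
Proof.
move=> C0 W0 f0 g0 H.
pose ts := [seq t <- undup (sort <=%R ([seq f k | k : Z] ++ [seq g k | k : Z])) | 0 < t].
have pts : path <%R 0 ts.
  rewrite /ts path_sortedE; last exact: lt_trans.
  rewrite filter_all/= sorted_filter//; first exact: lt_trans.
  rewrite lt_sorted_uniq_le undup_uniq/= (subseq_sorted le_trans (undup_subseq _))//.
  exact: sort_le_sorted.
have tsE y : 0 <= y -> y \in [seq f k | k : Z] ++ [seq g k | k : Z] ->
    staircase 0 ts y = y.
  move=> y0 yfg; rewrite staircaseE ?subr0// inE mem_filter mem_undup mem_sort.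
  by rewrite yfg andbT eq_sym -le_eqVlt.
have fE k : f k = staircase 0 ts (f k).
  by rewrite tsE// mem_cat map_f// mem_enum.
have gE k : g k = staircase 0 ts (g k).
  by rewrite tsE// mem_cat [X in _ || X]map_f ?orbT// mem_enum.
under eq_bigr do rewrite fE; under [X in _ <= _ * X]eq_bigr do rewrite gE.
suff main ss t0 : 0 <= t0 -> path <%R t0 ss ->
    \sum_k W k * staircase t0 ss (f k) <= C * \sum_k W k * staircase t0 ss (g k).
  exact: main.
elim: ss t0 => [|t1 ss IH] t0 t00 /= pss.
  by rewrite !big1 ?mulr0// => k _; rewrite mulr0.
under eq_bigr do rewrite mulrDr; under [X in _ <= _ * X]eq_bigr do rewrite mulrDr.
have /andP[t01 {}pss] := pss.
rewrite !big_split/= mulrDr lerD ?IH//; last exact: le_trans (ltW t01).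
have sumE (e : Z -> R) : \sum_k W k * ((t1 - t0) * (t0 < e k)%R%:R) =
    (t1 - t0) * \sum_(k | t0 < e k) W k.
  rewrite mulr_sumr [RHS]big_mkcond/=; apply: eq_bigr => k _.
  by case: (t0 < e k) => /=; ring.
by rewrite !sumE mulrCA ler_wpM2l ?H// subr_ge0 ltW.
Qed.

End comparison.

Section scattered.
Context {R : realDomainType} {I Z : finType}.
Variables (B : I -> {set Z}) (b : I -> R).

Let overlap (S : {set I}) i := B i :&: \bigcup_(j in S | b i <= b j) B j.

(* Greedy selection in order of decreasing [b]: a set is kept when at most half
   of it is covered by the ones kept before. *)
Lemma scattered_selection : exists (S : {set I}) (E : I -> {set Z}),
  [/\ forall i, i \in S -> E i \subset B i /\ (#|B i| <= 2 * #|E i|)%N,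
      forall i j, i \in S -> j \in S -> i != j -> [disjoint E i & E j] &
      forall i, i \notin S -> (#|B i| < 2 * #|overlap S i|)%N].
Proof.
pose r i j := b j <= b i.
suff H (s : seq I) : sorted r s -> exists (S : {set I}) (E : I -> {set Z}),
    [/\ {subset S <= s},
      forall i, i \in S -> E i \subset B i /\ (#|B i| <= 2 * #|E i|)%N,
      forall i j, i \in S -> j \in S -> i != j -> [disjoint E i & E j] &
      forall i, i \in s -> i \notin S -> (#|B i| < 2 * #|overlap S i|)%N].
  have [|S [E [_ SE Edis Sov]]] := H (sort r (enum I)).
    by apply: sort_sorted => i j; exact: le_total.
  exists S, E; split => // i; apply: Sov.
  by rewrite mem_sort mem_enum.
have r_trans : transitive r by move=> j i k ij jk; exact: le_trans jk ij.
elim/last_ind: s => [_|s x IH].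
  exists finset.set0, (fun=> finset.set0).
  by split => // [i|i|i]; rewrite inE.
rewrite sorted_pairwise// pairwise_rcons -sorted_pairwise//.
move=> /andP[/allP bx /IH[S [E [Ss SE Edis Sov]]]].
have [xS|xS] := boolP (x \in S).
  exists S, E; split => // [i /Ss|i].
    by rewrite mem_rcons inE orbC => ->.
  by rewrite mem_rcons inE => /predU1P[->|/Sov//]; rewrite xS.
have [ov|nov] := ltnP #|B x| (2 * #|overlap S x|).
  exists S, E; split => // [i /Ss|i].
    by rewrite mem_rcons inE orbC => ->.
  by rewrite mem_rcons inE => /predU1P[->|/Sov//].
pose V := \bigcup_(j in S) B j.
(* All sets kept so far have a value at least [b x], so the restriction in [overlap] is void. *)
have ovV : overlap S x = B x :&: V.
  congr (_ :&: _); apply: eq_bigl => j.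
  by rewrite andb_idr// => /Ss/bx.
have EV i : i \in S -> E i \subset V.
  by move=> iS; have [EB _] := SE i iS; apply: fintype.subset_trans EB _; exact: finset.bigcup_sup.
have dV : [disjoint B x :\: V & V].
  by rewrite -finset.setI_eq0 finset.setIDAC finset.setDIl finset.setDv finset.setI0.
pose E' i := if i == x then B x :\: V else E i.
exists (x |: S), E'; split => [i|i|i j|i].
- by rewrite !inE mem_rcons inE => /predU1P[->|/Ss ->]; rewrite ?eqxx ?orbT.
- rewrite !inE /E'; case: eqP => /= [-> _|_ /SE//].
  rewrite finset.subsetDl; split => //; have := cardsID V (B x).
  by move: nov; rewrite ovV; lia.
- rewrite !inE /E'; case: eqP => /= [->|_]; case: eqP => //= [->|_].
  + by rewrite eqxx.
  + by move=> _ jS _; exact: disjointWr (EV j jS) dV.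
  + by move=> iS _ _; rewrite disjoint_sym; exact: disjointWr (EV i iS) dV.
  + exact: Edis.
- rewrite mem_rcons !inE negb_or => /predU1P[->|si]; first by rewrite eqxx.
  (* Enlarging the selection only enlarges overlaps, so sets discarded earlier stay well covered. *)
  move=> /andP[_ iS]; apply: leq_trans (Sov i si iS) _.
  rewrite leq_mul2l/=; apply: subset_leq_card; apply: finset.setIS.
  apply/finset.bigcupsP => j /andP[jS bij]; apply: (finset.bigcup_max j) => //.
  by rewrite inE jS orbT.
Qed.

End scattered.

Section scattered_maximal.
Context {n N : nat} {R : realType} {I : finType}.
Notation Z := {ffun 'I_n -> 'I_N.+1}.
Variables (W : Z -> R) (q K : R).
Hypotheses (W0 : forall k, 0 <= W k) (q1 : 1 <= q) (K0 : 0 <= K).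
Hypothesis HW : axis_weighted W q K.
Variables (u v : I -> 'I_n -> nat) (b : I -> R).
Hypotheses (vN : forall i j, (v i j <= N.+1)%N) (b0 : forall i, 0 <= b i).

Let B i := cell_box N (u i) (v i).

(** At a level [t], let [V] be the union of the chosen boxes of value above [t]. A discarded box of
    value above [t] is more than half covered by chosen boxes of no smaller value, hence by [V], so
    [half_density_weight] compares the level sets of the two maxima. The maximum over chosen boxes
    is then bounded by their sum. *)
Lemma sum_maximal_scattered : exists (S : {set I}) (E : I -> {set Z}),
  [/\ forall i, i \in S -> E i \subset B i /\ (#|B i| <= 2 * #|E i|)%N,
      forall i j, i \in S -> j \in S -> i != j -> [disjoint E i & E j] &
      \sum_k W k * \big[Num.max/0]_(i | k \in B i) b i <=
      half_density_const n q K * \sum_(i in S) b i * \sum_(k in B i) W k].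
Proof.
have [S [E [SE Edis Sov]]] := scattered_selection B b.
exists S, E; split => //.
pose g k := \big[Num.max/0]_(i in S | k \in B i) b i.
apply: le_trans (_ : half_density_const n q K * \sum_k W k * g k <= _); last first.
  rewrite ler_wpM2l ?half_density_const_ge0//.
  under [leRHS]eq_bigr do rewrite mulr_sumr big_mkcond/=.
  rewrite exchange_big/=; apply: ler_sum => k _.
  apply: (@le_trans _ _ (W k * \sum_(i in S | k \in B i) b i)).
    rewrite ler_wpM2l//; apply: bigmax_le => [|i /andP[iS ki]].
      by apply: sumr_ge0 => i _.
    rewrite (bigD1 i)/= ?iS// lerDl; exact: sumr_ge0.
  rewrite mulr_sumr big_mkcondr/=; apply: ler_sum => i _.
  by case: ifP => // _; rewrite mulrC.
apply: sum_le_of_superlevel => // [|k|k|t t0].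
- exact: half_density_const_ge0.
- exact: bigmax_ge_id.
- exact: bigmax_ge_id.
pose V := \bigcup_(i in S | t < b i) B i.
have VE : \sum_(k in V) W k <= \sum_(k | t < g k) W k.
  rewrite big_mkcond [leRHS]big_mkcond/=; apply: ler_sum => k _.
  case: ifP => [/finset.bigcupP[i /andP[iS bi] ki]|]; last by case: ifP.
  by rewrite (lt_le_trans bi)// (le_bigmax_cond 0 b)// iS.
pose X := [set k : Z | t < \big[Num.max/0]_(i | k \in B i) b i].
rewrite (eq_bigl (mem X)); last by move=> k; rewrite /X !inE.
apply: le_trans (ler_wpM2l (half_density_const_ge0 q K0) VE).
apply: half_density_weight => // k; rewrite inE => tk.
have [i ki bi] : exists2 i, k \in B i & t < b i.
  apply: contrapT => H; move: tk; rewrite ltNge => /negP; apply.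
  apply: bigmax_le => // i ki; rewrite leNgt; apply/negP => bi.
  by apply: H; exists i.
exists (u i), (v i); split => //.
have [iS|/Sov/leq_trans] := boolP (i \in S).
  rewrite (finset.setIidPl _); last by apply: finset.bigcup_sup; rewrite iS.
  by rewrite mul2n -addnn -{1}[#|_|]addn0 ltn_add2l; apply/card_gt0P; exists k.
apply; rewrite leq_mul2l/=; apply: subset_leq_card; apply: finset.setIS.
apply/finset.bigcupsP => j /andP[jS bij]; apply: finset.bigcup_sup.
by rewrite jS (lt_le_trans bi).
Qed.

End scattered_maximal.

(** * Hoelder's inequality with several factors *)

Section hoelder.
Context {R : realType}.

(** With [S] the weighted mean, the logarithm of [x j / S] is at most [x j / S - 1], and the
    weighted sum of these bounds is 0. *)
Lemma powR_amgm m (x theta : 'I_m -> R) : (forall j, 0 <= x j) ->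
  (forall j, 0 < theta j) -> \sum_j theta j = 1 ->
  \prod_j x j `^ theta j <= \sum_j theta j * x j.
Proof.
move=> x0 t0 t1.
have S0 : 0 <= \sum_j theta j * x j.
  by apply: sumr_ge0 => j _; rewrite mulr_ge0// ltW.
have [[j xj]|/forallNP xN0] := pselect (exists j, x j = 0).
  by rewrite (bigD1 j)//= xj powR0 ?gt_eqF// mul0r.
have xp j : 0 < x j by rewrite lt_neqAle x0 andbT eq_sym; exact/eqP.
have Sp : 0 < \sum_j theta j * x j.
  rewrite lt_neqAle S0 andbT eq_sym psumr_neq0; last first.
    by move=> j _; rewrite mulr_ge0// ltW.
  case: m x theta x0 t0 t1 {S0 xN0} xp => [|m] x theta _ t0 t1 xp.
    by move: t1; rewrite big_ord0 => /esym/eqP; rewrite oner_eq0.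
  by apply/hasP; exists ord0; rewrite ?mem_index_enum//= mulr_gt0.
set S := \sum_j _ in S0 Sp *.
have lnx j : ln (x j) <= ln S + (x j / S - 1).
  rewrite -lerBlDl -ln_div ?posrE//.
  rewrite -ler_expR lnK ?posrE ?divr_gt0//.
  by apply: le_trans (expR_ge1Dx _); lra.
rewrite -[leRHS]lnK ?posrE//.
rewrite (eq_bigr (fun j => expR (theta j * ln (x j)))); last first.
  by move=> j _; rewrite /powR gt_eqF.
rewrite -expR_sum ler_expR.
apply: (@le_trans _ _ (\sum_j theta j * (ln S + (x j / S - 1)))).
  by apply: ler_sum => j _; rewrite ler_wpM2l// ltW.
under eq_bigr do rewrite mulrDr mulrBr mulr1 mulrA.
rewrite big_split/= sumrB -!mulr_suml t1 mul1r -/S divff ?gt_eqF//.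
by rewrite subrr addr0.
Qed.

(** Hoelder's inequality before summation: with [s j] the total of the [j]-th factor, the right side
    is linear in [x] and sums to the desired product. It serves for sums and for integrals. *)
Lemma prod_powR_normalized m (x s theta : 'I_m -> R) :
  (forall j, 0 <= x j) -> (forall j, 0 < s j) ->
  (forall j, 0 < theta j) -> \sum_j theta j = 1 ->
  \prod_j x j `^ theta j <=
  (\prod_j s j `^ theta j) * \sum_j theta j / s j * x j.
Proof.
move=> x0 s0 t0 t1.
have -> : \prod_j x j `^ theta j =
    (\prod_j s j `^ theta j) * \prod_j (x j / s j) `^ theta j.
  rewrite -big_split/=; apply: eq_bigr => j _.
  by rewrite -powRM ?divr_ge0 ?(ltW (s0 j))// mulrC divfK ?gt_eqF.
rewrite ler_wpM2l//; first by apply: prodr_ge0 => j _; exact: powR_ge0.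
under [leRHS]eq_bigr do rewrite mulrAC -mulrA.
by apply: powR_amgm => // j; rewrite divr_ge0// ltW.
Qed.

Lemma hoelder_sum (I : finType) (S : {set I}) m (e : I -> R)
    (x : I -> 'I_m -> R) (theta : 'I_m -> R) :
  (forall i, 0 <= e i) -> (forall i j, 0 <= x i j) ->
  (forall j, 0 < theta j) -> \sum_j theta j = 1 ->
  \sum_(i in S) e i * \prod_j x i j `^ theta j <=
  \prod_j (\sum_(i in S) e i * x i j) `^ theta j.
Proof.
move=> e0 x0 t0 t1; pose s j := \sum_(i in S) e i * x i j.
have s0 j : 0 <= s j by apply: sumr_ge0 => i _; rewrite mulr_ge0.
have prod0 : 0 <= \prod_j s j `^ theta j.
  by apply: prodr_ge0 => j _; exact: powR_ge0.
have [[j sj]|/forallNP sN0] := pselect (exists j, s j = 0).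
  rewrite big1// => i iS.
  have /eqP := psumr_eq0P (fun i _ => mulr_ge0 (e0 i) (x0 i j)) sj iS.
  rewrite mulf_eq0 => /orP[/eqP ->|/eqP xij]; first by rewrite mul0r.
  by rewrite (bigD1 j)//= xij powR0 ?gt_eqF// mul0r mulr0.
have sp j : 0 < s j by rewrite lt_neqAle s0 andbT eq_sym; exact/eqP.
apply: (@le_trans _ _ (\sum_(i in S) e i *
    ((\prod_j s j `^ theta j) * \sum_j theta j / s j * x i j))).
  by apply: ler_sum => i _; rewrite ler_wpM2l// prod_powR_normalized.
under [leLHS]eq_bigr do rewrite mulrCA mulr_sumr.
rewrite -mulr_sumr -[leRHS]mulr1 ler_wpM2l// exchange_big/= -t1.
apply: ler_sum => j _; under [leLHS]eq_bigr do rewrite mulrCA.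
by rewrite -mulr_sumr -/(s j) divfK ?gt_eqF.
Qed.

End hoelder.

Local Open Scope classical_set_scope.
Local Open Scope ring_scope.

(** * Lebesgue measure of rectangles *)

Section volume_subadditive.
Context {R : realType}.

(* Induction on the dimension: fixing the last coordinate and integrating over
   it avoids any compactness argument. *)
Lemma prod_length_le_nneseries n (a b : nat -> R) (A B : nat -> nat -> R)
    (c : nat -> R) :
  (forall i, a i <= b i) -> (forall k i, A k i <= B k i) ->
  (forall k, 0 <= c k) ->
  (forall x : nat -> R, (forall i, (i < n)%N -> a i <= x i <= b i) ->
    (1 <= \sum_(k <oo) (c k * \prod_(i < n) (x i \in `[A k i, B k i])%:R)%:E)%E) ->
  ((\prod_(i < n) (b i - a i))%:E <=
    \sum_(k <oo) (c k * \prod_(i < n) (B k i - A k i))%:E)%E.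
Proof.
move=> ab AB; elim: n c => [|n IH] c c0 H.
  have := H a; rewrite !big_ord0 => /(_ (fun i => ltac:(by [])))/le_trans; apply.
  by apply: lee_nneseries => [k _ _|k _]; rewrite ?big_ord0// lee_fin mulr1.
pose d k := c k * \prod_(i < n) (B k i - A k i).
have d0 k : 0 <= d k.
  by rewrite mulr_ge0// prodr_ge0// => i _; rewrite subr_ge0.
have step y : a n <= y <= b n -> ((\prod_(i < n) (b i - a i))%:E <=
    \sum_(k <oo) ((d k)%:E * (\1_(`[A k n, B k n]%classic) y)%:E))%E.
  move=> yab.
  (* The indicator in the last coordinate is absorbed into the coefficient; general coefficients [c]
     are carried for this purpose. *)
  have := IH (fun k => c k * (y \in `[A k n, B k n])%:R).
  have cy0 k : 0 <= c k * (y \in `[A k n, B k n])%:R by rewrite mulr_ge0.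
  move=> /(_ cy0) H1.
  apply: (le_trans (H1 _)) => [x xab|].
    have := H (fun i => if i == n then y else x i).
    have xab' i : (i < n.+1)%N -> a i <= (if i == n then y else x i) <= b i.
      by case: eqP => [->//|/eqP ni]; rewrite ltnS leq_eqVlt (negbTE ni)/=; exact: xab.
    move=> /(_ xab')/le_trans; apply; apply: lee_nneseries => [k _ _|k _].
      by rewrite lee_fin mulr_ge0// prodr_ge0.
    rewrite big_ord_recr/= eqxx lee_fin mulrA mulrAC -!mulrA.
    rewrite (eq_bigr (fun i : 'I_n => (x i \in `[A k i, B k i])%:R))//.
    by move=> i _; rewrite ltn_eqF.
  apply: lee_nneseries => [k _ _|k _].
    by rewrite lee_fin mulr_ge0// prodr_ge0// => i _; rewrite subr_ge0.
  rewrite -EFinM lee_fin mulrAC; apply: ler_wpM2l; first exact: d0.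
  by rewrite indicE mem_setE.
pose mu := @lebesgue_measure R.
pose D : set R := `[a n, b n]%classic.
have mD : measurable (D : set (measurableTypeR R)) by exact: measurable_itv.
have muI (x y : R) : x <= y -> mu `[x, y]%classic = (y - x)%:E.
  move=> xy; rewrite /mu lebesgue_measure_itv/= lte_fin.
  by case: ltgtP xy => // -> _; rewrite subrr.
rewrite big_ord_recr/= EFinM -(muI _ _ (ab n)) -(integral_cst _ mD)/=.
apply: (@le_trans _ _ (\int[mu]_(x in D)
    \sum_(k <oo) ((d k)%:E * (\1_(`[A k n, B k n]%classic) x)%:E))%E).
  apply: ge0_le_integral => //.
  - by move=> x _; rewrite lee_fin prodr_ge0// => i _; rewrite subr_ge0.
  - apply: ge0_emeasurable_sum => [k x _ _|k _].
      by rewrite -EFinM lee_fin mulr_ge0.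
    apply: emeasurable_funM => //.
    by apply/measurable_EFinP; exact: measurable_indic.
rewrite integral_nneseries//; last 2 first.
- move=> k; apply: emeasurable_funM => //.
  by apply/measurable_EFinP; exact: measurable_indic.
- by move=> k x _; rewrite -EFinM lee_fin mulr_ge0.
apply: lee_nneseries => [k _ _|k _].
  by apply: integral_ge0 => x _; rewrite -EFinM lee_fin mulr_ge0.
rewrite ge0_integralZl//; last 2 first.
- by apply/measurable_EFinP; exact: measurable_indic.
- by rewrite lee_fin.
rewrite integral_indic// big_ord_recr/= mulrA -/(d k) [leRHS]EFinM.
apply: lee_pmul; rewrite ?lee_fin//.
by rewrite -(muI _ _ (AB k n)); apply: le_measure; rewrite ?inE//; exact: measurableI.
Qed.

End volume_subadditive.

Section lebesgue_boxes.
Context {R : realType} {n : nat}.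
Local Notation T := (euclidean R n).
Implicit Types a b : 'rV[R]_n.

(** [prod_length_le_nneseries] changes the dimension in its induction and so works with sequences;
    row vectors are extended by 0. *)
Let ext a (i : nat) : R := if insub i is Some j then a ord0 j else 0.

Let extE a (i : 'I_n) : ext a i = a ord0 i.
Proof. by rewrite /ext valK. Qed.

Lemma volume_le_outer_rectangle a b : Defs.nondegenerate a b ->
  ((volume a b)%:E <= lebesgue_outer (rectangle a b))%E.
Proof.
move=> ab; apply: le_ereal_inf_tmp => _ [D [A [B [[AB cov] ->]]]].
pose A' k i := if k \in D then ext (A k) i else 0.
pose B' k i := if k \in D then ext (B k) i else 0.
pose c k : R := (k \in D)%:R.
have le_ext u v i : Defs.nondegenerate u v -> ext u i <= ext v i.
  by move=> uv; rewrite /ext; case: insubP => // j _ _; rewrite ltW.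
have AB' k i : A' k i <= B' k i.
  rewrite /A' /B'; case: ifPn => //; rewrite inE => Dk.
  by apply: le_ext; exact: AB.
have c0 k : 0 <= c k by rewrite /c.
have := @prod_length_le_nneseries R n (ext a) (ext b) A' B' c
  (fun i => le_ext _ _ i ab) AB' c0.
have -> : \prod_(i < n) (ext b i - ext a i) = volume a b.
  by apply: eq_bigr => i _; rewrite !extE.
have prodE k : k \in D ->
    \prod_(i < n) (B' k i - A' k i) = volume (A k) (B k).
  by move=> kD; apply: eq_bigr => i _; rewrite /A' /B' kD !extE.
move=> H; apply: le_trans (H _) _.
  move=> x xab; pose y : 'rV[R]_n := \row_i x i.
  have [k Dk yk] : (\bigcup_(k in D) rectangle (A k) (B k)) y.
    apply: cov => i; rewrite mxE in_itv/=.
    by have := xab i (ltn_ord i); rewrite !extE.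
  rewrite (@nneseriesD1 _ _ k)//=; last first.
    by move=> i _; rewrite lee_fin mulr_ge0// prodr_ge0.
  have -> : c k * \prod_(i < n) (x i \in `[A' k i, B' k i])%:R = 1.
    rewrite /c /A' /B' mem_set// mul1r big1// => i _.
    by have := yk i; rewrite mxE !extE => ->.
  by rewrite leeDl// nneseries_ge0// => i _ _; rewrite lee_fin mulr_ge0// prodr_ge0.
rewrite nneseries_esumT; last first.
  move=> k; rewrite lee_fin mulr_ge0// prodr_ge0// => i _.
  by rewrite subr_ge0.
rewrite [leRHS]esum_mkcond; apply: le_esum => k _; rewrite /c; case: ifPn => kD.
  by rewrite mul1r prodE.
by rewrite mul0r.
Qed.

Lemma outer_rectangle a b : Defs.nondegenerate a b ->
  lebesgue_outer (rectangle a b) = (volume a b)%:E.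
Proof.
move=> ab; apply/eqP; rewrite eq_le volume_le_outer_rectangle// andbT.
apply: ereal_inf_lbound; exists [set 0%N], (fun=> a), (fun=> b).
split; last by rewrite esum_set1// lee_fin volume_ge0.
by split => // x xab; exists 0%N.
Qed.

(** Covers consist of nondegenerate rectangles, so the flat set is put into a slab of width [2 * d].
    Its other sides have product [M]; [d] is chosen with [M + 1] in place of [M], which keeps the
    divisor positive. *)
Lemma outer_rectangle0 a b i : b ord0 i <= a ord0 i ->
  lebesgue_outer (rectangle a b) = 0%E.
Proof.
move=> ba; apply/eqP; rewrite eq_le outer_measure_ge0 andbT.
pose lo : 'rV[R]_n := \row_j (a ord0 j - 1).
pose hi : 'rV[R]_n := \row_j (a ord0 j + `|b ord0 j - a ord0 j| + 1).
pose M := \prod_(j < n | j != i) (hi ord0 j - lo ord0 j).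
have lohi j : lo ord0 j < hi ord0 j.
  by rewrite !mxE; have := normr_ge0 (b ord0 j - a ord0 j); lra.
have M0 : 0 <= M by apply: prodr_ge0 => j _; rewrite subr_ge0 ltW.
apply/lee_addgt0Pr => e e0; rewrite add0e.
have [d d0 dE] : exists2 d, 0 < d & d * (2 * (M + 1)) = e.
  exists (e / (2 * (M + 1))); first by rewrite divr_gt0// mulr_gt0//; lra.
  by rewrite divfK// gt_eqF// mulr_gt0//; lra.
pose a' : 'rV[R]_n := \row_j (if j == i then a ord0 i - d else lo ord0 j).
pose b' : 'rV[R]_n := \row_j (if j == i then a ord0 i + d else hi ord0 j).
have ab' : Defs.nondegenerate a' b'.
  move=> j; rewrite !mxE; case: eqP => _; first lra.
  by have := lohi j; rewrite !mxE.
apply: (@le_trans _ _ (lebesgue_outer (rectangle a' b'))).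
  apply: le_outer_measure => x xab j; have := xab j.
  have := xab i; rewrite !in_itv/= => /andP[xi1 xi2] /andP[xj1 xj2].
  rewrite !mxE; case: eqP => [->|_]; first by apply/andP; split; lra.
  have := ler_norm (b ord0 j - a ord0 j).
  by move=> ?; apply/andP; split; lra.
rewrite outer_rectangle// lee_fin /volume (bigD1 i)//=.
rewrite (eq_bigr (fun j => hi ord0 j - lo ord0 j)); last first.
  by move=> j ji; rewrite [a' _ _]mxE [b' _ _]mxE (negbTE ji).
rewrite -/M !mxE eqxx.
rewrite -dE; nra.
Qed.


Let setcoord a i (c : R) : 'rV[R]_n := \row_j (if j == i then c else a ord0 j).

Let setcoordE a i c j :
  setcoord a i c ord0 j = if j == i then c else a ord0 j.
Proof. by rewrite mxE. Qed.

Let volume_split a b i c :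
  volume a b = volume a (setcoord b i c) + volume (setcoord a i c) b.
Proof.
rewrite /volume (bigD1 i)//= [X in _ = X + _](bigD1 i)//=.
rewrite [X in _ = _ + X](bigD1 i)//= !setcoordE eqxx.
rewrite [X in _ = _ * X + _](eq_bigr (fun j => b ord0 j - a ord0 j)); last first.
  by move=> j ji; rewrite setcoordE (negbTE ji).
rewrite [X in _ = _ + _ * X](eq_bigr (fun j => b ord0 j - a ord0 j)); last first.
  by move=> j ji; rewrite setcoordE (negbTE ji).
ring.
Qed.

Let halfspace i c := [set x : 'rV[R]_n | x ord0 i < c].

Let outer_split a b i c : Defs.nondegenerate a b ->
  (lebesgue_outer (rectangle a b `&` halfspace i c) +
   lebesgue_outer (rectangle a b `&` ~` halfspace i c) <= (volume a b)%:E)%E.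
Proof.
move=> ab; have [ca|ac] := leP c (a ord0 i).
  rewrite (_ : _ `&` halfspace i c = set0) ?outer_measure0 ?add0e.
    by rewrite -outer_rectangle//; apply: le_outer_measure => x [].
  apply/seteqP; split => // x [/(_ i)]; rewrite in_itv/= => /andP[ax _].
  by rewrite /halfspace/= ltNge (le_trans ca ax).
have right_part : rectangle a b `&` ~` halfspace i c `<=` rectangle (setcoord a i c) b.
  move=> x [abx /negP]; rewrite -leNgt => cx j; have := abx j.
  by rewrite !in_itv/= setcoordE; case: eqP => [->|//]; rewrite cx => /andP[].
have [bc|cb] := leP (b ord0 i) c.
  apply: (@le_trans _ _ (lebesgue_outer (rectangle a b) + 0)%E).
    apply: leeD; first by apply: le_outer_measure => x [].
    rewrite -(@outer_rectangle0 (setcoord a i c) b i) ?setcoordE ?eqxx//.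
    exact: le_outer_measure.
  by rewrite adde0 outer_rectangle.
have left_part : rectangle a b `&` halfspace i c `<=` rectangle a (setcoord b i c).
  move=> x [abx]; rewrite /halfspace/= => /ltW xc j; have := abx j.
  by rewrite !in_itv/= setcoordE; case: eqP => [->|//]; rewrite xc => /andP[->].
rewrite (volume_split a b i c) EFinD -!outer_rectangle; last 2 first.
- by move=> j; rewrite setcoordE; case: eqP => [->//|_]; exact: ab.
- by move=> j; rewrite setcoordE; case: eqP => [->//|_]; exact: ab.
by apply: leeD; exact: le_outer_measure.
Qed.

(** Caratheodory's criterion against a set [X] reduces to cutting each rectangle of a cover of [X]
    by the hyperplane, where both pieces lie in rectangles whose volumes add up. *)
Lemma measurable_halfspace (i : 'I_n) (c : R) :
  measurable ([set x | x ord0 i < c] : set T).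
Proof.
apply: le_caratheodory_measurable => X /=; rewrite -/(halfspace i c).
apply: le_ereal_inf_tmp => _ [D [a [b [[ab cov] ->]]]].
pose F (H : set 'rV[R]_n) k := if k \in D then rectangle (a k) (b k) `&` H else set0.
have XF H : (lebesgue_outer (X `&` H) <=
    \sum_(k <oo) lebesgue_outer (F H k))%E.
  apply: le_trans (outer_measure_sigma_subadditive _ _).
  apply: le_outer_measure => x [/cov[k Dk xk] Hx].
  by exists k => //; rewrite /F mem_set.
apply: le_trans (leeD (XF _) (XF _)) _.
rewrite -nneseriesD; last 2 first.
- by move=> k _ _; exact: outer_measure_ge0.
- by move=> k _ _; exact: outer_measure_ge0.
rewrite nneseries_esumT; last by move=> k; rewrite adde_ge0// outer_measure_ge0.
rewrite [leRHS]esum_mkcond; apply: le_esum => k _; rewrite /F; case: ifPn.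
  by rewrite inE => /ab; exact: outer_split.
by rewrite outer_measure0 adde0.
Qed.

Definition half_open_box a b : set 'rV[R]_n :=
  [set x | forall i, a ord0 i <= x ord0 i < b ord0 i].

Lemma measurable_half_open_box a b : measurable (half_open_box a b : set T).
Proof.
pose H (i : 'I_n) : set T :=
  ~` [set x | x ord0 i < a ord0 i] `&` [set x | x ord0 i < b ord0 i].
rewrite (_ : half_open_box a b = \bigcap_(i in [set: 'I_n]) H i).
  apply: fin_bigcap_measurable => // i _; apply: measurableI.
    by apply: measurableC; exact: measurable_halfspace.
  exact: measurable_halfspace.
apply/seteqP; split => [x abx i _|x abx i].
  by have /andP[ax xb] := abx i; split => //=; apply/negP; rewrite -leNgt.
by have [/negP] := abx i I; rewrite -leNgt => -> ->.
Qed.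

Lemma half_open_box_subset a b : half_open_box a b `<=` rectangle a b.
Proof. by move=> x abx i; rewrite in_itv/=; have /andP[-> /ltW] := abx i. Qed.

(** The closed rectangle exceeds the half-open one by its upper faces, which are flat rectangles and
    hence null. *)
Lemma lebesgue_half_open_box a b : Defs.nondegenerate a b ->
  lebesgue (half_open_box a b) = (volume a b)%:E.
Proof.
move=> ab; apply/eqP; rewrite eq_le; apply/andP; split.
  rewrite -outer_rectangle//; apply: le_outer_measure.
  exact: half_open_box_subset.
pose F (i : 'I_n) := rectangle (setcoord a i (b ord0 i)) b.
pose F' k := if insub k is Some i then F i else set0.
rewrite -outer_rectangle//.
apply: (@le_trans _ _ (lebesgue_outer (half_open_box a b `|`
    \big[setU/set0]_(k < n) F' k))).
  apply: le_outer_measure => x abx.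
  have [|/existsNP[i nabx]] := pselect (half_open_box a b x); first by left.
  right; rewrite -bigcup_mkord; exists i; first exact: ltn_ord.
  rewrite /F' valK => j; rewrite in_itv/= setcoordE.
  have := abx j; rewrite in_itv/=; case: eqP => [->|//] /andP[ax xb].
  rewrite xb andbT leNgt; apply/negP => xb'.
  by apply: nabx; have := abx i; rewrite in_itv/= => /andP[->].
apply: le_trans (outer_measureU2 _ _ _) _.
rewrite -[leRHS]adde0; apply: leeD => //.
apply: le_trans (outer_measure_subadditive _ _ _) _.
rewrite big1// => k _; rewrite /F' valK; apply: (@outer_rectangle0 _ _ k).
by rewrite setcoordE eqxx.
Qed.

Lemma lebesgue_rectangle a b : Defs.nondegenerate a b ->
  lebesgue (rectangle a b) = (volume a b)%:E.
Proof. exact: outer_rectangle. Qed.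

End lebesgue_boxes.

(** * Integral inequalities *)

(* No measurability is assumed: the integral of a nonnegative function is a
   supremum over the simple functions below it. *)
Lemma le_integral_ge0 d (T : measurableType d) (R : realType)
    (mu : {measure set T -> \bar R}) (D E : set T) (f g : T -> \bar R) :
  D `<=` E -> (forall x, D x -> (0 <= f x)%E) ->
  (forall x, E x -> (0 <= g x)%E) -> (forall x, D x -> (f x <= g x)%E) ->
  (\int[mu]_(x in D) f x <= \int[mu]_(x in E) g x)%E.
Proof.
move=> DE f0 g0 fg; rewrite !ge0_integralE//.
apply: ge_ereal_sup => _ [h hf <-]; apply: ereal_sup_ubound; exists h => // x.
apply: le_trans (hf x) _; rewrite !patchE; case: ifPn => xD.
  have Dx : D x by rewrite inE in xD.
  by rewrite mem_set; [exact: fg|exact: DE].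
by case: ifPn => // /set_mem; exact: g0.
Qed.

Lemma le_poweR2r {R : realType} (x y : \bar R) (r : R) :
  0 <= r -> (0 <= x)%E -> (x <= y)%E -> (x `^ r <= y `^ r)%E.
Proof.
move=> r0 x0 xy; apply: gt0_ler_poweR => //; rewrite in_itv/= ?leey ?andbT//.
exact: le_trans xy.
Qed.

Section hoelder_integral.
Context d (T : measurableType d) (R : realType).
Variables (mu : {measure set T -> \bar R}) (D : set T).
Hypothesis mD : measurable D.

(** [prod_powR_normalized] is integrated with [s j] the integral of [F j]; if one of these is 0,
    that factor, and with it the product, vanishes almost everywhere. *)
Lemma hoelder_integral m (F : 'I_m -> T -> R) (theta : 'I_m -> R) :
  (forall j, measurable_fun D (F j)) ->
  (forall j x, D x -> 0 <= F j x) -> (forall j, 0 < theta j) ->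
  \sum_j theta j = 1 ->
  (forall j, (\int[mu]_(x in D) (F j x)%:E < +oo)%E) ->
  (\int[mu]_(x in D) (\prod_j F j x `^ theta j)%:E <=
   (\prod_j fine (\int[mu]_(x in D) (F j x)%:E) `^ theta j)%:E)%E.
Proof.
move=> mF F0 t0 t1 Foo.
pose s j := fine (\int[mu]_(x in D) (F j x)%:E).
have F0' j x : D x -> (0 <= (F j x)%:E)%E by move=> Dx; rewrite lee_fin F0.
have sE j : (\int[mu]_(x in D) (F j x)%:E = (s j)%:E)%E.
  by rewrite /s fineK// ge0_fin_numE// integral_ge0// => x; exact: F0'.
have s0 j : 0 <= s j by rewrite fine_ge0// integral_ge0// => x; exact: F0'.
have mprod : measurable_fun D (fun x => (\prod_j F j x `^ theta j)%:E).
  apply/measurable_EFinP; apply: measurable_prod => j _.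
  by apply: (measurableT_comp (measurable_powR (theta j))); exact: mF.
have [[j sj]|/forallNP sN0] := pselect (exists j, s j = 0).
  rewrite (@ae_eq_integral _ _ _ mu D (cst 0%E))//.
    rewrite integral0 lee_fin; apply: prodr_ge0 => i _; exact: powR_ge0.
  have : (\int[mu]_(x in D) `|(F j x)%:E| = 0)%E.
    rewrite -[RHS]/(0%:E) -sj -sE; apply: eq_integral => x /set_mem Dx.
    by rewrite gee0_abs// F0'.
  move/(ae_eq_integral_abs mu mD (proj2 (measurable_EFinP _ _) (mF j))).
  apply: filterS => x /= H Dx; have := H Dx => -[Fx].
  by rewrite (bigD1 j)//= Fx powR0 ?gt_eqF// mul0r.
have sp j : 0 < s j by rewrite lt_neqAle s0 andbT eq_sym; exact/eqP.
pose P := \prod_j s j `^ theta j.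
have P0 : 0 <= P by apply: prodr_ge0 => i _; exact: powR_ge0.
have term_ge0 j x : D x -> (0 <= (theta j / s j)%:E * (F j x)%:E)%E.
  by move=> Dx; apply: mule_ge0; rewrite lee_fin ?F0// divr_ge0// ltW.
apply: (@le_trans _ _ (\int[mu]_(x in D)
    (P%:E * \sum_(j < m) ((theta j / s j)%:E * (F j x)%:E)))%E).
  apply: le_integral_ge0 => //.
  - by move=> x Dx; rewrite lee_fin; apply: prodr_ge0 => i _; exact: powR_ge0.
  - move=> x Dx; apply: mule_ge0; first by rewrite lee_fin.
    by apply: sume_ge0 => j _; exact: term_ge0.
  - move=> x Dx; under [in leRHS]eq_bigr do rewrite -EFinM.
    rewrite sumEFin -EFinM lee_fin.
    by apply: prod_powR_normalized => // j; exact: F0.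
rewrite ge0_integralZl//; last 2 first.
- apply: emeasurable_sum => j; apply: emeasurable_funM => //.
  exact/measurable_EFinP.
- by move=> x Dx; apply: sume_ge0 => j _; exact: term_ge0.
rewrite ge0_integral_sum//; last first.
  by move=> j; apply: emeasurable_funM => //; exact/measurable_EFinP.
rewrite (eq_bigr (fun j => (theta j)%:E)); last first.
  move=> j _; rewrite ge0_integralZl_EFin//; last 3 first.
  - by move=> x; exact: F0'.
  - exact/measurable_EFinP.
  - by rewrite divr_ge0// ltW.
  by rewrite sE -EFinM divfK// gt_eqF.
by rewrite sumEFin t1 mule1.
Qed.

End hoelder_integral.

(** * Grids *)

Section grid.
Context {R : realType} {n : nat}.
Local Notation T := (euclidean R n).
Variables (o delta : R).
Hypothesis delta0 : 0 < delta.
Implicit Types u v : 'I_n -> nat.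

Definition grid_point u : 'rV[R]_n := \row_i (o + (u i)%:R * delta).

Definition grid_box u v : set T := half_open_box (grid_point u) (grid_point v).

Lemma grid_boxP u v (x : T) :
  grid_box u v x <->
  forall i, o + (u i)%:R * delta <= x ord0 i < o + (v i)%:R * delta.
Proof. by split => H i; have := H i; rewrite !mxE. Qed.

Lemma measurable_grid_box u v : measurable (grid_box u v).
Proof. exact: measurable_half_open_box. Qed.

Lemma grid_point_lt u v : (forall i, (u i < v i)%N) ->
  Defs.nondegenerate (grid_point u) (grid_point v).
Proof.
by move=> uv i; rewrite !mxE ltrD2l ltr_pM2r// ltr_nat.
Qed.

Context {N : nat}.
Notation Z := {ffun 'I_n -> 'I_N.+1}.
Implicit Types k : Z.

Definition cell k : set T := grid_box (fun i => k i) (fun i => (k i).+1).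

Lemma measurable_cell k : measurable (cell k).
Proof. exact: measurable_grid_box. Qed.

Lemma lebesgue_cell k : lebesgue (cell k) = (delta ^+ n)%:E.
Proof.
rewrite /cell lebesgue_half_open_box; last exact: grid_point_lt.
congr EFin; rewrite /volume (eq_bigr (fun=> delta)).
  by rewrite prodr_const card_ord.
by move=> i _; rewrite !mxE -natr1; ring.
Qed.

Lemma cell_subset k u v : k \in cell_box N u v -> cell k `<=` grid_box u v.
Proof.
move=> /in_cell_box kuv x /grid_boxP kx; apply/grid_boxP => i.
have /andP[uk kv] := kuv i; have /andP[kx1 kx2] := kx i; apply/andP; split.
  by apply: le_trans kx1; rewrite lerD2l ler_pM2r// ler_nat.
by apply: lt_le_trans kx2 _; rewrite lerD2l ler_pM2r// ler_nat.
Qed.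

Lemma mem_cell_box k u v x : cell k x -> grid_box u v x -> k \in cell_box N u v.
Proof.
move=> /grid_boxP kx /grid_boxP ux; apply/in_cell_box => i.
have /andP[kx1 kx2] := kx i; have /andP[ux1 ux2] := ux i.
apply/andP; split.
  by have := le_lt_trans ux1 kx2; rewrite ltrD2l ltr_pM2r// ltr_nat.
by have := le_lt_trans kx1 ux2; rewrite ltrD2l ltr_pM2r// ltr_nat.
Qed.

Lemma cell_inj k k' x : cell k x -> cell k' x -> k = k'.
Proof.
move=> kx /(mem_cell_box kx)/in_cell_box kk'.
apply/ffunP => i; apply/val_inj/eqP => /=.
by have := kk' i; rewrite ltnS -eqn_leq => /eqP ->.
Qed.

Lemma grid_box_cell u v x : (forall i, v i <= N.+1)%N -> grid_box u v x ->
  exists2 k, k \in cell_box N u v & cell k x.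
Proof.
move=> vN /grid_boxP uvx.
pose t i : nat := Num.truncn ((x ord0 i - o) / delta).
have t0 i : 0 <= (x ord0 i - o) / delta.
  rewrite divr_ge0 ?(ltW delta0)// subr_ge0; have /andP[ux _] := uvx i.
  by apply: le_trans ux; rewrite lerDl mulr_ge0// ltW.
have tN i : (t i < N.+1)%N.
  rewrite (leq_trans _ (vN i))// truncn_lt_nat// ltr_pdivrMr//.
  by rewrite ltrBlDl; have /andP[] := uvx i.
have cx : cell [ffun i => Ordinal (tN i)] x.
  apply/grid_boxP => i; rewrite ffunE/=.
  have /andP[tx1 tx2] := truncn_itv (t0 i).
  by rewrite -lerBrDl -ltrBlDl -ler_pdivlMr// -ltr_pdivrMr// tx1.
exists [ffun i => Ordinal (tN i)] => //.
by apply: mem_cell_box cx _; exact/grid_boxP.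
Qed.

Lemma integral_grid_box u v (f : T -> \bar R) : (forall i, v i <= N.+1)%N ->
  measurable_fun [set: T] f -> (forall x, 0 <= f x)%E ->
  (\int[lebesgue]_(x in grid_box u v) f x =
   \sum_(k in cell_box N u v) \int[lebesgue]_(x in cell k) f x)%E.
Proof.
move=> vN mf f0.
rewrite (_ : grid_box u v = \big[setU/set0]_(k <- enum (cell_box N u v)) cell k).
  rewrite ge0_integral_bigsetU//.
  - by rewrite big_enum.
  - by move=> k; exact: measurable_cell.
  - exact: enum_uniq.
  - by move=> k k' _ _ [x [kx k'x]]; exact: cell_inj kx k'x.
  - by apply: measurable_funTS.
rewrite -bigcup_seq; apply/seteqP; split => x.
  by move=> /(grid_box_cell vN)[k kuv kx]; exists k => //=; rewrite mem_enum.
by move=> [k /=]; rewrite mem_enum => /cell_subset; exact.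
Qed.

Lemma lebesgue_grid_box u v : (forall i, v i <= N.+1)%N ->
  lebesgue (grid_box u v) = (#|cell_box N u v|%:R * delta ^+ n)%:E.
Proof.
move=> vN; rewrite -[LHS]mul1e -integral_cst; last exact: measurable_grid_box.
rewrite (@integral_grid_box u v _ vN)//.
rewrite (eq_bigr (fun=> (delta ^+ n)%:E)); last first.
  move=> k _; rewrite integral_cst; last exact: measurable_cell.
  by rewrite mul1e lebesgue_cell.
by rewrite sumEFin sumr_const mulr_natl.
Qed.

End grid.

(** * The L log^(n-1) L weak type estimate for functions *)

Section llog.
Context {R : realType}.

Lemma ln_e_ge1 (y : R) : 0 <= y -> 1 <= ln (expR 1 + y).
Proof.
move=> y0; rewrite -[leLHS]expRK ler_ln ?posrE ?expR_gt0//; first by rewrite lerDl.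
by rewrite ltr_wpDr// expR_gt0.
Qed.

(* The part of h below 2^-n cannot make an average exceed 1 by itself; dropping
   it makes the dyadic sums of the weak type estimate finite. *)
Definition llog_trunc (n : nat) (y : R) : R :=
  y * ln (expR 1 + y) ^+ n.-1 * (2 ^- n < y)%R%:R.

Lemma llog_trunc_ge0 n y : 0 <= y -> 0 <= llog_trunc n y.
Proof.
move=> y0; rewrite /llog_trunc mulr_ge0// mulr_ge0// exprn_ge0//.
exact: le_trans (ln_e_ge1 y0).
Qed.

Lemma le_llog_trunc n y : 0 <= y -> y <= 2 ^- n + llog_trunc n y.
Proof.
move=> y0; rewrite /llog_trunc; case: ltP => [_|yn]; last by rewrite mulr0 addr0.
rewrite mulr1 ler_wpDl//.
by rewrite ler_peMr// exprn_ege1// ln_e_ge1.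
Qed.

(** If [K] is minimal with [y * 2 ^+ n <= 2 ^+ K], then [K] is at most [n + 1] plus the base 2
    logarithm of [y], hence at most the base of this power times [ln (expR 1 + y)]. *)
Definition llog_const (n : nat) : R := (n.+1%:R + (ln 2)^-1) ^+ n.-1.

(** Only the layers with [2 ^+ M] below [y * 2 ^+ n] contribute, that is [M < K], and
    [sum_layer_weight] bounds their multiplicities by [K ^ n.-1]. *)
Lemma sum_layers_le_llog n L (y : R) : 0 <= y ->
  y * \sum_(0 <= M < L) (layer_weight n.-1 M)%:R * (2 ^+ M / 2 ^+ n < y)%R%:R <=
  llog_const n * llog_trunc n y.
Proof.
move=> y0; rewrite /llog_trunc.
have n2 : 0 < 2 ^+ n :> R by rewrite exprn_gt0.
have [ny|yn] := ltP (2 ^- n) y; last first.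
  rewrite !mulr0 big1 ?mulr0// => M _; rewrite ltNge (le_trans yn) ?mulr0//.
  by rewrite ler_peMl ?invr_ge0 ?(ltW n2)// exprn_ege1// ler1n.
rewrite mulr1 mulrCA ler_wpM2l//.
have y_gt0 : 0 < y by apply: lt_trans ny; rewrite invr_gt0.
have exK : exists K, y * 2 ^+ n <= 2 ^+ K.
  have /andP[_ /ltW] := truncn_itv (ltW (mulr_gt0 y_gt0 n2)).
  set t := Num.truncn _ => yt; exists t.+1; apply: le_trans yt _.
  by rewrite -natrX ler_nat; exact: ltnW (ltn_expl _ _).
case: (ex_minnP exK) => K yK minK.
have lnle : ln y <= ln (expR 1 + y).
  by rewrite ler_ln ?posrE// ?lerDr ?expR_ge0// ltr_wpDr ?expR_gt0 ?ltW.
have ln1 := ln_e_ge1 y0.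
have ln20 : 0 < ln 2 :> R by rewrite ln_gt0// ltr1n.
have KE : K%:R <= (n.+1%:R + (ln 2)^-1) * ln (expR 1 + y).
  case: K yK minK => [|K] yK minK.
    by rewrite mulr_ge0// ?addr_ge0// ?invr_ge0 ?ltW// (lt_le_trans _ ln1).
  have : 2 ^+ K < y * 2 ^+ n.
    by rewrite ltNge; apply/negP => /minK; rewrite ltnn.
  move=> H; have : K%:R * ln 2 < ln y + n%:R * ln 2.
    have : ln (2 ^+ K) < ln (y * 2 ^+ n).
      by rewrite ltr_ln// posrE ?exprn_gt0// mulr_gt0.
    have -> : ln (y * 2 ^+ n) = ln y + ln (2 ^+ n) by rewrite lnM// posrE.
    by rewrite !lnXn// !mulr_natl.
  rewrite -ltrBlDr -mulrBl -ltr_pdivlMr// => {}H.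
  have {H} : K%:R - n%:R <= (ln 2)^-1 * ln (expR 1 + y).
    apply: le_trans (ltW H) _; rewrite mulrC.
    by rewrite ler_wpM2l// invr_ge0 ltW.
  rewrite -!natr1 => H.
  have : (n%:R + 1) * 1 <= (n%:R + 1) * ln (expR 1 + y).
    by rewrite ler_wpM2l.
  lra.
apply: (@le_trans _ _ (K%:R ^+ n.-1)); last first.
  by rewrite -exprMn lerXn2r ?nnegrE// (le_trans _ KE).
rewrite -[leRHS]natrX; apply: (@le_trans _ _ (\sum_(0 <= M < K) layer_weight n.-1 M)%N%:R); last first.
  by rewrite ler_nat sum_layer_weight.
rewrite natr_sum.
have tail M : (K <= M)%N -> (2 ^+ M / 2 ^+ n < y) = false.
  move=> KM; apply/negbTE; rewrite -leNgt ler_pdivlMr//.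
  by rewrite (le_trans yK)// ler_weXn2l// ler1n.
apply: (@le_trans _ _ (\sum_(0 <= M < maxn L K) (layer_weight n.-1 M)%:R *
    (2 ^+ M / 2 ^+ n < y)%R%:R)).
  rewrite (@big_cat_nat _ _ _ L 0 (maxn L K))//= ?leq_maxl// lerDl.
  by apply: sumr_ge0 => M _; rewrite mulr_ge0.
rewrite (@big_cat_nat _ _ _ K 0 (maxn L K))//= ?leq_maxr//.
rewrite [X in _ + X]big_nat_cond [X in _ + X]big1 ?addr0.
  by apply: ler_sum => M _; rewrite ler_piMr//; case: (_ < _).
by move=> M /andP[/andP[KM _] _]; rewrite tail// mulr0.
Qed.

End llog.

Section llog_weak_type.
Context {R : realType} {n : nat}.
Local Notation T := (euclidean R n).

Lemma measurable_gt_indicator (c : R) :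
  measurable_fun [set: R] (fun y : R => (c < y)%R%:R : R).
Proof.
rewrite (_ : (fun y => _) = \1_(`]c, +oo[%classic) :> (R -> R)).
  by apply: measurable_indic; exact: measurable_itv.
by apply/funext => y; rewrite indicE mem_setE/= in_itv/= andbT.
Qed.

Lemma measurable_llog_trunc : measurable_fun [set: R] (@llog_trunc R n).
Proof.
apply: measurable_funM; last exact: measurable_gt_indicator.
apply: measurable_funM => //; apply: measurable_funX.
apply: (measurableT_comp (@measurable_ln R)).
exact: measurable_funD.
Qed.

Variables (o delta : R).
Hypothesis delta0 : 0 < delta.
Context {N : nat}.
Notation Z := {ffun 'I_n -> 'I_N.+1}.

Let d0 : 0 < delta ^+ n. Proof. by rewrite exprn_gt0. Qed.

Lemma llog_const_gt0 : 0 < llog_const n :> R.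
Proof.
have ln20 : 0 < ln 2 :> R by rewrite ln_gt0// ltr1n.
by rewrite exprn_gt0// ltr_wpDr ?ltr0n// invr_ge0 ltW.
Qed.

Lemma llog_weak_type (h : T -> R) (X : {set Z}) : (0 < n)%N ->
  measurable_fun [set: T] h -> (forall x, 0 <= h x) ->
  (forall k, k \in X -> exists u v, [/\ (forall i, v i <= N.+1)%N,
    k \in cell_box N u v &
    (1 < average (EFin \o h) (grid_box o delta u v))%E]) ->
  ((#|X|%:R * delta ^+ n)%:E <= (8 * 16 ^+ n.-1 * llog_const n)%:E *
    \int[lebesgue]_x (llog_trunc n (h x))%:E)%E.
Proof.
move=> n0 mh h0 HX; pose C : R := 8 * 16 ^+ n.-1.
have C0 : 0 < C by rewrite mulr_gt0// exprn_gt0.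
have Cl0 : 0 < C * llog_const n by rewrite mulr_gt0// llog_const_gt0.
have mll : measurable_fun [set: T] (fun x => (llog_trunc n (h x))%:E).
  by apply/measurable_EFinP; exact: (measurableT_comp measurable_llog_trunc).
have ll0 x : (0 <= (llog_trunc n (h x))%:E)%E by rewrite lee_fin llog_trunc_ge0.
set J := (\int[lebesgue]_x _)%E.
have J0 : (0 <= J)%E by exact: integral_ge0.
have [Joo|Joo] := eqVneq J +oo%E; first by rewrite Joo gt0_muley ?leey// lte_fin.
have mhE : measurable_fun [set: T] (EFin \o h) by exact/measurable_EFinP.
pose hs s x := h x * (s < h x)%R%:R.
have hs0 s x : 0 <= hs s x by rewrite mulr_ge0.
have mhs s : measurable_fun [set: T] (hs s).
  apply: measurable_funM; first exact: mh.
  exact: (measurableT_comp (measurable_gt_indicator s) mh).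
have mhsE s : measurable_fun [set: T] (EFin \o hs s) by exact/measurable_EFinP.
have hs_le s x : hs s x <= h x by rewrite ler_piMr//; case: (_ < _).
have le_cell (f g : T -> R) (k : Z) : (forall x, 0 <= f x) -> (forall x, f x <= g x) ->
    (\int[lebesgue]_(x in cell o delta k) (f x)%:E <=
     \int[lebesgue]_(x in cell o delta (N := N) k) (g x)%:E)%E.
  move=> f0 fg; apply: le_integral_ge0 => // x _; rewrite lee_fin//.
  exact: le_trans (fg x).
have cst_cell (c : R) (k : Z) : 0 <= c ->
    (\int[lebesgue]_(x in cell o delta (N := N) k) c%:E = (c * delta ^+ n)%:E)%E.
  move=> c0; rewrite integral_cst; last exact: measurable_cell.
  by rewrite (lebesgue_cell _ delta0).
have cellD (c : R) (f : T -> R) (k : Z) : 0 <= c -> (forall x, 0 <= f x) -> measurable_fun [set: T] f ->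
    (\int[lebesgue]_(x in cell o delta (N := N) k) (f x + c)%:E =
     \int[lebesgue]_(x in cell o delta k) (f x)%:E + (c * delta ^+ n)%:E)%E.
  move=> c0 f0 mf; under eq_integral do rewrite EFinD.
  rewrite ge0_integralD.
  - by rewrite cst_cell.
  - exact: measurable_cell.
  - by move=> x _; rewrite lee_fin.
  - by apply: measurable_funTS; exact/measurable_EFinP.
  - by move=> x _; rewrite lee_fin.
  - exact: measurable_cst.
pose m (k : Z) := (\int[lebesgue]_(x in cell o delta (N := N) k) (h x)%:E)%E.
have moo k : (m k < +oo)%E.
  (* Finiteness of the right side makes [h] integrable on cells: the discarded part is at most
     [2 ^- n], and cells have finite measure. *)
  have h_le x : h x <= llog_trunc n (h x) + 2 ^- n.
    by rewrite addrC; exact: le_llog_trunc.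
  apply: le_lt_trans (le_cell _ _ k h0 h_le) _; rewrite cellD; last 3 first.
  - by rewrite invr_ge0 exprn_ge0.
  - by move=> x; exact: llog_trunc_ge0.
  - exact: (measurableT_comp measurable_llog_trunc mh).
  rewrite lte_add_pinfty ?ltry//; apply: le_lt_trans (_ : J < +oo)%E.
    by apply: le_integral_ge0.
  by rewrite ltey.
have m0 k : (0 <= m k)%E by apply: integral_ge0 => x _; rewrite lee_fin.
pose ms s (k : Z) := (\int[lebesgue]_(x in cell o delta (N := N) k) (hs s x)%:E)%E.
have ms0 s k : (0 <= ms s k)%E by apply: integral_ge0 => x _; rewrite lee_fin.
have msoo s k : ms s k \is a fin_num.
  by rewrite ge0_fin_numE//; apply: le_lt_trans (moo k); exact: le_cell.
have mfin k : m k \is a fin_num by rewrite ge0_fin_numE.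
pose ht k := fine (m k) / delta ^+ n.
(* Truncation precedes averaging: truncating the cell means instead would lose the high values of
   [h] inside a cell. *)
pose b s k := fine (ms (s / 2) k) / delta ^+ n.
have ht0 k : 0 <= ht k by rewrite divr_ge0 ?fine_ge0// ltW.
have b0 s k : 0 < s -> 0 <= b s k by move=> _; rewrite divr_ge0 ?fine_ge0// ltW.
have hb s k : 0 < s -> ht k <= b s k + s / 2.
  move=> s0; rewrite /ht /b ler_pdivrMr// mulrDl divfK ?gt_eqF//.
  rewrite -lee_fin EFinD !fineK// -cellD//; last by rewrite divr_ge0// ltW.
  apply: le_cell => // x; rewrite /hs; case: ltP => [_|hx].
    by rewrite mulr1 lerDl divr_ge0// ltW.
  by rewrite mulr0 add0r.
have [L hL] : exists L, forall k, ht k <= 2 ^+ L / 2 ^+ n.-1.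
  pose t := \sum_k ht k * 2 ^+ n.-1.
  have t0 : 0 <= t by apply: sumr_ge0 => k _; rewrite mulr_ge0// exprn_ge0.
  exists (Num.truncn t).+1 => k; rewrite ler_pdivlMr ?exprn_gt0//.
  apply: (@le_trans _ _ t).
    by rewrite /t (bigD1 k)//= lerDl sumr_ge0// => i _; rewrite mulr_ge0// exprn_ge0.
  have /andP[_ /ltW/le_trans] := truncn_itv t0; apply.
  by rewrite -natrX ler_nat; exact: ltnW (ltn_expl _ _).
have weak := iter_max_llog n0 ht0 b0 hb hL.
have card_le : #|X|%:R <= \sum_(k | 1 < iter_max (enum 'I_n) ht k) (1 : R).
  rewrite -sum1_card natr_sum big_mkcond [leRHS]big_mkcond/=.
  apply: ler_sum => k _; case: ifPn => [kX|_]; last by case: ifP.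
  have [u [v [vN kuv avg1]]] := HX k kX.
  rewrite (lt_le_trans _ (box_avg_le_max ht vN kuv))//.
  have box0 : 0 < #|cell_box N u v|%:R :> R.
    by rewrite ltr0n; apply/card_gt0P; exists k.
  rewrite /box_avg ltr_pdivlMr// mul1r.
  move: avg1; rewrite /average (@lebesgue_grid_box R n o delta delta0 N u v vN).
  rewrite (@integral_grid_box R n o delta delta0 N u v _ vN mhE); last first.
    by move=> x; rewrite /= lee_fin.
  rewrite (eq_bigr (fun k => (ht k * delta ^+ n)%:E)); last first.
    by move=> i _; rewrite /ht divfK ?gt_eqF// fineK.
  rewrite sumEFin inver gt_eqF ?mulr_gt0// -EFinM lte_fin -mulr_suml.
  by rewrite mulrC ltr_pdivlMr ?mulr_gt0// mul1r ltr_pM2r.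
apply: (@le_trans _ _ ((C * \sum_(0 <= M < L) (layer_weight n.-1 M)%:R *
    \sum_k b (2 ^+ M / 2 ^+ n.-1) k) * delta ^+ n)%:E).
  by rewrite lee_fin ler_wpM2r ?(ltW d0)// (le_trans card_le).
rewrite -mulrA EFinM [in leRHS]EFinM -muleA lee_pmul2l ?lte_fin//.
rewrite mulr_suml -sumEFin.
pose G := grid_box o delta (fun=> 0%N) (fun=> N.+1) : set T.
have mG : measurable G by exact: measurable_grid_box.
have bE M : ((layer_weight n.-1 M)%:R * (\sum_k b (2 ^+ M / 2 ^+ n.-1) k) *
      delta ^+ n)%:E =
    (\int[lebesgue]_(x in G) ((layer_weight n.-1 M)%:R *
      hs (2 ^+ M / 2 ^+ n) x)%:E)%E.
  under eq_integral do rewrite EFinM.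
  rewrite ge0_integralZl_EFin; last 4 first.
  - exact: mG.
  - by move=> x _; rewrite lee_fin.
  - by apply: measurable_funTS; exact: mhsE.
  - by [].
  rewrite -mulrA EFinM; congr (_ * _)%E.
  rewrite /G (@integral_grid_box R n o delta delta0 N _ _ _ _ (mhsE _))//; last first.
    by move=> x; rewrite /= lee_fin.
  rewrite mulr_suml -sumEFin; apply: eq_big => [k|k _].
    by apply/esym/in_cell_box => i; rewrite ltn_ord.
  rewrite /b divfK ?gt_eqF// fineK//.
  rewrite /ms; congr (\int[lebesgue]_(x in _) (hs _ x)%:E)%E.
  (* The levels [2 ^+ M / 2 ^+ n.-1] are cut at half their size. The lowest threshold is [2 ^- n],
     that of [llog_trunc]. *)
  by rewrite -mulrA -invfM -exprSr prednK.
rewrite (eq_bigr _ (fun M _ => bE M)) -ge0_integral_sum; last 3 first.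
- exact: mG.
- move=> M; apply: measurable_funTS; apply/measurable_EFinP.
  by apply: measurable_funM; [exact: measurable_cst|exact: mhs].
- by move=> M x _; rewrite lee_fin mulr_ge0.
rewrite -ge0_integralZl_EFin//; last exact: ltW llog_const_gt0.
apply: le_integral_ge0 => // [x _|x _|x _].
- by apply: sume_ge0 => M _; rewrite lee_fin mulr_ge0.
- by rewrite mule_ge0// lee_fin ltW// llog_const_gt0.
rewrite sumEFin -EFinM lee_fin.
apply: le_trans (sum_layers_le_llog n L (h0 x)); rewrite mulr_sumr.
by apply: ler_sum => M _; rewrite /hs mulrCA.
Qed.

End llog_weak_type.

(** * Young functions *)

Section young_real.
Context {R : realType} (n : nat) (p : R) (Phi : \bar R -> \bar R).
Hypotheses (p1 : 1 < p) (yPhi : young Phi) (bPhi : strong_Bp n p Phi).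

Let Phi_ge0 t : (0 <= t)%E -> (0 <= Phi t)%E.
Proof. by case: yPhi => H _ _ _ _; exact: H. Qed.

Let Phi_mono s t : (0 <= s)%E -> (s <= t)%E -> (Phi s <= Phi t)%E.
Proof. by case: yPhi => _ _ _ + _; apply. Qed.

Lemma Llog_EFin (y : R) : 0 <= y ->
  Llog n y%:E = (y * ln (expR 1 + y) ^+ n.-1)%:E.
Proof.
move=> y0; rewrite /Llog -EFinD /lne leNgt ltr_wpDr ?expR_gt0//=.
by rewrite -EFin_expe -EFinM.
Qed.

Lemma Llog_pinfty : Llog n (+oo : \bar R)%E = +oo%E.
Proof.
rewrite /Llog addey//= gt0_mulye//.
by elim: n.-1 => [|k IH]; rewrite ?expe0 ?lte01// expeS gt0_mulye.
Qed.

Lemma Llog_ge0 (t : \bar R) : (0 <= t)%E -> (0 <= Llog n t)%E.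
Proof.
case: t => [r|_|//]; last by rewrite Llog_pinfty.
rewrite lee_fin => r0; rewrite Llog_EFin// lee_fin mulr_ge0// exprn_ge0//.
exact: le_trans (ln_e_ge1 r0).
Qed.

(** An infinite value would persist to the right of [t] and make the integrand infinite on an
    interval of length 1 beyond [c]. *)
Lemma strong_Bp_finite t : 0 <= t -> (Phi t%:E < +oo)%E.
Proof.
move=> t0; rewrite ltNge leye_eq; apply/negP => /eqP Phioo.
have [c [c0]] := bPhi; rewrite ltNge => /negP; apply.
pose s := Num.max t c.
have s0 : 0 < s by rewrite lt_max c0 orbT.
rewrite leye_eq -leye_eq -(@gt0_mulye R 1%E)// muleC.
have <- : lebesgue_measure (`[s, s + 1]%classic : set R) = 1%E.
  by rewrite lebesgue_measure_itv/= lte_fin ltrDl ltr01 -EFinB addrAC subrr add0r.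
rewrite muleC -integral_cst//=.
apply: le_integral_ge0 => [x|x _|x|x].
- rewrite /= !in_itv/= => /andP[sx _]; rewrite andbT.
  by apply: le_trans sx; rewrite le_max lexx orbT.
- by [].
- rewrite /= in_itv/= andbT => cx; have x0 : 0 <= x by rewrite (le_trans (ltW c0)).
  apply: mule_ge0; first by rewrite Llog_ge0// Phi_ge0.
  by rewrite lee_fin mulr_ge0 ?invr_ge0 ?powR_ge0.
- rewrite /= in_itv/= => /andP[sx _].
  have -> : Phi x%:E = +oo%E.
    apply/eqP; rewrite -leye_eq -Phioo Phi_mono// lee_fin.
    by apply: le_trans sx; rewrite le_max lexx.
  rewrite Llog_pinfty gt0_mulye// lte_fin mulr_gt0// invr_gt0.
    by rewrite powR_gt0// (lt_le_trans s0).
  exact: lt_le_trans sx.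
Qed.

(** Cutting off negative arguments makes the function monotone on the whole line, so that its
    measurability follows from monotonicity. *)
Definition young_fine (y : R) : R := fine (Phi (Num.max y 0)%:E).
Local Notation phi := young_fine.

Let max0 (y : R) : (0 <= (Num.max y 0)%:E)%E.
Proof. by rewrite lee_fin le_max lexx orbT. Qed.

Lemma young_fineE y : 0 <= y -> Phi y%:E = (phi y)%:E.
Proof.
move=> y0; rewrite /phi max_l// fineK// ge0_fin_numE; last exact: Phi_ge0.
exact: strong_Bp_finite.
Qed.

Lemma young_fine_ge0 y : 0 <= phi y.
Proof. by rewrite fine_ge0// Phi_ge0. Qed.

Lemma young_fine_mono : {homo phi : x y / x <= y}.
Proof.
move=> x y xy; rewrite /phi fine_le//; do ?
  by rewrite ge0_fin_numE ?Phi_ge0// strong_Bp_finite// le_max lexx orbT.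
by rewrite Phi_mono// lee_fin ge_max !le_max xy lexx !orbT.
Qed.

Lemma young_fine_scale (l y : R) : 0 <= l <= 1 -> 0 <= y ->
  phi (l * y) <= l * phi y.
Proof.
move=> l01 y0; have /andP[l0 l1] := l01.
case: yPhi => _ _ conv _ [Phi0 _].
have := conv y%:E 0%E l; rewrite lee_fin => /(_ y0 (lexx _) l01).
rewrite Phi0 !mule0 !adde0 -EFinM young_fineE ?mulr_ge0//.
by rewrite young_fineE// -EFinM lee_fin.
Qed.

Definition young_llog (y : R) : R := llog_trunc n (phi y).
Local Notation Gam := young_llog.

Lemma young_llog_ge0 y : 0 <= Gam y.
Proof. by rewrite llog_trunc_ge0// young_fine_ge0. Qed.

Lemma llog_trunc_mono (x y : R) : 0 <= x -> x <= y ->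
  llog_trunc n x <= llog_trunc n y.
Proof.
move=> x0 xy; rewrite /llog_trunc; have y0 := le_trans x0 xy.
have lnx := le_trans ler01 (ln_e_ge1 x0).
apply: ler_pM => //.
- by rewrite mulr_ge0// exprn_ge0.
- apply: ler_pM => //; first by rewrite exprn_ge0.
  rewrite lerXn2r ?nnegrE//; first exact: le_trans (ln_e_ge1 y0).
  by rewrite ler_ln ?posrE ?lerD2l// ltr_wpDr// expR_gt0.
- rewrite ler_nat; case: ltP => // nx.
  by rewrite (lt_le_trans nx).
Qed.

Lemma young_llog_mono : {homo Gam : x y / x <= y}.
Proof.
move=> x y xy; apply: llog_trunc_mono; first exact: young_fine_ge0.
exact: young_fine_mono.
Qed.

(** B*_p controls the integral only at infinity; at 0 convergence is due to the threshold [2 ^- n].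
    By convexity [phi l] is at most [l * (phi 1 + 1)], and [l] is chosen to put this below the
    threshold. *)
Lemma young_llog_eq0 : exists2 u0, 0 < u0 & forall u, u <= u0 -> Gam u = 0.
Proof.
pose l := Num.min 1 (2 ^- n / (phi 1 + 1)).
have phi1 : 0 < phi 1 + 1 by rewrite ltr_wpDl// young_fine_ge0.
have l0 : 0 < l by rewrite lt_min ltr01/= divr_gt0// invr_gt0 exprn_gt0.
exists l => // u ul; apply/eqP; rewrite /Gam /llog_trunc mulf_eq0.
apply/orP; right; rewrite pnatr_eq0 eqb0 -leNgt.
apply: le_trans (young_fine_mono ul) _.
rewrite -[X in phi X](mulr1 l); apply: le_trans (young_fine_scale _ ler01) _.
  by rewrite (ltW l0) ge_min lexx.
apply: (@le_trans _ _ (l * (phi 1 + 1))); first by rewrite ler_pM2l// lerDl.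
by rewrite -ler_pdivlMr// ge_min lexx orbT.
Qed.

Let F (u : R) : \bar R := (Gam u * (u `^ (- p) * u `^ (- 1)))%:E.

Let F_ge0 u : (0 <= F u)%E.
Proof.
rewrite /F lee_fin; apply: mulr_ge0; first exact: young_llog_ge0.
by rewrite mulr_ge0 ?powR_ge0.
Qed.

Let mF (D : set R) : measurable_fun (D : set (measurableTypeR R)) F.
Proof.
apply: measurable_funTS; apply/measurable_EFinP; apply: measurable_funM.
  by apply: nondecreasing_measurable => //; exact: young_llog_mono.
by apply: measurable_funM; exact: measurable_powR.
Qed.

Let I0 : \bar R := (\int[lebesgue_measure]_(u in `]0%R, +oo[) F u)%E.

Lemma young_llog_integral_fin : (I0 < +oo)%E.
Proof.
have [c [c0 cfin]] := bPhi.
have [u0 u00 G0] := young_llog_eq0.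
(* On []0, c[] the integrand vanishes up to [u0]; beyond it, [Gam] is largest at [c] and the
   negative powers at [u0]. *)
pose M := Gam c * (u0 `^ (- p) * u0 `^ (- 1)).
have M0 : 0 <= M.
  apply: mulr_ge0; first exact: young_llog_ge0.
  by rewrite mulr_ge0 ?powR_ge0.
rewrite /I0 (_ : `]0, +oo[%classic = `]0, c[%classic `|` `[c, +oo[%classic); last first.
  apply/seteqP; split => u /=; rewrite !in_itv/= ?andbT.
    by move=> u0'; have [|] := ltP u c; [left|right]; rewrite ?u0'.
  by case=> [/andP[]//|]; exact: lt_le_trans.
rewrite ge0_integral_setU//=; last first.
  apply/disj_setPS => u [/=]; rewrite !in_itv/= andbT => /andP[_ uc].
  by rewrite leNgt uc.
rewrite lte_add_pinfty//.
  apply: (@le_lt_trans _ _ (\int[lebesgue_measure]_(u in `]0%R, c[) cst M%:E u)%E).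
    apply: le_integral_ge0 => [//|u _|u _|u]; do ?[exact: F_ge0|by rewrite /= lee_fin].
    rewrite /= in_itv/= => /andP[u1 u2].
    have [/G0 Gu|u0u] := leP u u0; first by rewrite /F Gu mul0r lee_fin.
    rewrite /F /M lee_fin; apply: ler_pM.
    - exact: young_llog_ge0.
    - by rewrite mulr_ge0 ?powR_ge0.
    - by apply: young_llog_mono; exact: ltW.
    have powRN_mono q : 0 <= q -> u `^ (- q) <= u0 `^ (- q).
      by move=> q0; rewrite !powRN lef_pV2 ?posrE ?powR_gt0// ler_powR2r// ltW.
    by apply: ler_pM; rewrite ?powR_ge0// powRN_mono// ltW// (lt_trans ltr01).
  rewrite integral_cst//= lebesgue_measure_itv/= lte_fin c0 -EFinB -EFinM.
  exact: ltry.
have term_ge0 u : c <= u -> (0 <= Llog n (Phi u%:E) * ((u `^ p)^-1 * u^-1)%:E)%E.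
  move=> cu; have u0' : 0 <= u := le_trans (ltW c0) cu.
  rewrite young_fineE// Llog_EFin ?young_fine_ge0// -EFinM lee_fin.
  rewrite !mulr_ge0 ?invr_ge0 ?powR_ge0 ?young_fine_ge0// exprn_ge0//.
  exact: le_trans (ln_e_ge1 (young_fine_ge0 u)).
apply: le_lt_trans cfin; apply: le_integral_ge0 => [//|//|u|u]; rewrite /= in_itv/= andbT.
  exact: term_ge0.
move=> cu; have u0' : 0 <= u := le_trans (ltW c0) cu.
rewrite young_fineE// Llog_EFin ?young_fine_ge0// -EFinM lee_fin powRN powR_inv1//.
rewrite ler_wpM2r ?mulr_ge0 ?invr_ge0 ?powR_ge0//.
rewrite /young_llog /llog_trunc ler_piMr//; last by case: (_ < _).
rewrite mulr_ge0 ?young_fine_ge0// exprn_ge0//.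
exact: le_trans (ln_e_ge1 (young_fine_ge0 u)).
Qed.

(* Each dyadic term is bounded by the integral over one of the disjoint
   intervals [y / a, 2 y / a). *)
Lemma young_llog_dyadic_sum : exists2 S : R, 0 <= S & forall (y : R) J, 0 <= y ->
  \sum_(k < J.*2) (2 ^+ k / 2 ^+ J) `^ p * Gam (y / (2 ^+ k / 2 ^+ J)) <=
  S * y `^ p.
Proof.
have I0_ge0 : (0 <= I0)%E by exact: integral_ge0.
have I0_fin : I0 \is a fin_num by rewrite ge0_fin_numE// young_llog_integral_fin.
have p0 : 0 < p := lt_trans ltr01 p1.
(* On [[c, 2 * c[], of length [c], the integrand is at least [Gam c] times the power [- p - 1] of
   [2 * c], which loses [2 * 2 ^ p]. *)
exists (2 * 2 `^ p * fine I0).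
  by rewrite !mulr_ge0 ?powR_ge0// fine_ge0.
move=> y J; rewrite le_eqVlt => /predU1P[<-|y0].
  rewrite powR0 ?gt_eqF// mulr0 big1// => k _; rewrite mul0r.
  have [u0 u00 ->] := young_llog_eq0; rewrite ?mulr0//; exact: ltW.
pose a k : R := 2 ^+ k / 2 ^+ J.
have a0 k : 0 < a k by rewrite divr_gt0 ?exprn_gt0.
pose D k : set (measurableTypeR R) := `[y / a k, 2 * (y / a k)[%classic.
have ya0 k : 0 < y / a k by rewrite divr_gt0.
have DF k : (((2 * 2 `^ p)^-1 * (y `^ p)^-1 * (a k `^ p * Gam (y / a k)))%:E <=
    \int[lebesgue_measure]_(u in D k) F u)%E.
  set c := y / a k.
  apply: (@le_trans _ _ (\int[lebesgue_measure]_(u in D k)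
     cst (Gam c * ((2 * c) `^ (- p) * (2 * c) `^ (- 1)))%:E u)%E); last first.
    apply: le_integral_ge0 => [//|u _|//|u]; rewrite /= ?lee_fin.
      by apply: mulr_ge0; [exact: young_llog_ge0|rewrite mulr_ge0 ?powR_ge0].
    rewrite /D /= in_itv/= => /andP[cu uc]; have u0 : 0 < u := lt_le_trans (ya0 k) cu.
    apply: ler_pM.
    - exact: young_llog_ge0.
    - by rewrite mulr_ge0 ?powR_ge0.
    - exact: young_llog_mono.
    have c2 : 0 < 2 * c by rewrite mulr_gt0// ya0.
    have powRN_mono q : 0 <= q -> (2 * c) `^ (- q) <= u `^ (- q).
      by move=> q0; rewrite !powRN lef_pV2 ?posrE ?powR_gt0// ler_powR2r// ltW.
    by apply: ler_pM; rewrite ?powR_ge0// powRN_mono// ltW.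
  have c0 : 0 < c := ya0 k.
  have lD : lebesgue_measure (D k) = c%:E.
    rewrite /D lebesgue_measure_itv/= lte_fin -/c ltr_pMl// ltr1n -EFinB.
    by congr EFin; ring.
  apply: (@le_trans _ _ ((Gam c * ((2 * c) `^ (- p) * (2 * c) `^ (- 1)))%:E * c%:E)%E).
    rewrite -EFinM lee_fin.
    have c2 : 0 <= 2 * c by rewrite mulr_ge0// ltW.
    rewrite (powR_inv1 c2) powRN (@powRM _ 2 c p)// ?(ltW c0)//.
    have -> : c `^ p = y `^ p / a k `^ p.
      rewrite /c powRM ?(ltW y0) ?invr_ge0 ?(ltW (a0 _))//.
      by rewrite -powRN -powR_inv1 ?(ltW (a0 _))// -powRrM mulN1r.
    have h1 : 0 < y `^ p by rewrite powR_gt0.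
    have h2 : 0 < a k `^ p by rewrite powR_gt0.
    have h3 : 0 < 2 `^ p :> R by rewrite powR_gt0.
    rewrite le_eqVlt; apply/orP; left; apply/eqP.
    field; rewrite !gt_eqF//.
  rewrite -lD integral_cst; last exact: measurable_itv.
  exact: lexx.
have D_disj i j : (i < j)%N -> D i `&` D j = set0.
  move=> ij; apply/seteqP; split => // u [].
  rewrite /D/= !in_itv/= => /andP[iu _] /andP[_]; rewrite ltNge => /negP; apply.
  apply: le_trans iu; rewrite mulrCA ler_pM2l//.
  rewrite ler_pdivrMr// ler_pdivlMl// /a mulrAC ler_pM2r ?invr_gt0 ?exprn_gt0//.
  by rewrite -exprSr ler_weXn2l// ler1n.
have trivD : trivIset [set: 'I_J.*2] (fun k => D k).
  apply/trivIsetP => i j _ _; rewrite -val_eqE neq_ltn => /orP[|] /D_disj//.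
  by rewrite setIC.
have mD (k : 'I_J.*2) : measurable (D k) by exact: measurable_itv.
have sumDF : (\sum_(k < J.*2)
    ((2 * 2 `^ p)^-1 * (y `^ p)^-1 * (a k `^ p * Gam (y / a k)))%:E <= I0)%E.
  apply: (@le_trans _ _ (\sum_(k < J.*2) \int[lebesgue_measure]_(u in D k) F u)%E).
    by apply: lee_sum => k _; exact: DF.
  rewrite -ge0_integral_bigsetU//; last 2 first.
  - exact: index_enum_uniq.
  - exact: sub_trivIset trivD.
  apply: le_integral_ge0 => //; rewrite -bigcup_seq => u [k _]; rewrite /D/= !in_itv/=.
  by move=> /andP[yu _]; rewrite andbT (lt_le_trans _ yu).
move: sumDF; rewrite sumEFin -mulr_sumr -(fineK I0_fin) lee_fin.
rewrite -invfM -/(a _) ler_pdivrMl; last by rewrite !mulr_gt0 ?powR_gt0.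
by move=> H; rewrite mulrAC.
Qed.

End young_real.

Section luxemburg.
Context {R : realType} {n : nat}.
Local Notation T := (euclidean R n).
Implicit Types (Phi : \bar R -> \bar R) (g : T -> R) (A : set T).

Lemma luxemburg_ge0 Phi g A : (0 <= luxemburg Phi g A)%E.
Proof.
by apply: le_ereal_inf_tmp => _ [l [l0 _] <-]; rewrite lee_fin ltW.
Qed.

Lemma luxemburg_gt Phi g A t : 0 < t -> (t%:E < luxemburg Phi g A)%E ->
  (1 < average (fun x => Phi (`|g x| / t)%:E) A)%E.
Proof.
move=> t0; rewrite !ltNge; apply: contraNN => avg1.
by apply: ereal_inf_lbound; exists t.
Qed.

End luxemburg.

Lemma sum_card_disjoint (I Z : finType) (P : pred I) (E : I -> {set Z})
    (X : {set Z}) : (forall i, P i -> E i \subset X) ->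
  (forall i j, P i -> P j -> i != j -> [disjoint E i & E j]%bool) ->
  (\sum_(i | P i) #|E i| <= #|X|)%N.
Proof.
move=> EX Edis; under eq_bigr do rewrite -sum1_card big_mkcond/=.
rewrite exchange_big/= -sum1_card [leqRHS]big_mkcond/=; apply: leq_sum => k _.
have [[i Pi ki]|nk] := pselect (exists2 i, P i & k \in E i); last first.
  by rewrite big1// => i Pi; case: ifP => // ki; case: nk; exists i.
rewrite (bigD1 i)//= ki (fintype.subsetP (EX i Pi) _ ki).
rewrite big1// => j /andP[Pj ji]; case: ifP => // kj.
by have /disjointFr/(_ kj) := Edis _ _ Pj Pi ji; rewrite ki.
Qed.

(** * Scattered sums of Luxemburg norms *)

Section orlicz_strong_type.
Context {R : realType} (n : nat) (p : R) (Phi : \bar R -> \bar R).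
Hypotheses (n0 : (0 < n)%N) (p1 : 1 < p).
Hypotheses (yPhi : young Phi) (bPhi : strong_Bp n p Phi).
Local Notation T := (euclidean R n).
Local Notation phi := (young_fine Phi).
Local Notation Gam := (young_llog n Phi).

Definition weak_const : R := 8 * 16 ^+ n.-1 * llog_const n.

Lemma weak_const_gt0 : 0 < weak_const.
Proof. by rewrite mulr_gt0 ?llog_const_gt0// mulr_gt0// exprn_gt0. Qed.

Let measurable_phi : measurable_fun [set: R] phi.
Proof.
apply: nondecreasing_measurable => //; exact: (young_fine_mono yPhi bPhi).
Qed.

Let measurable_Gam : measurable_fun [set: R] Gam.
Proof.
apply: nondecreasing_measurable => //; exact: (young_llog_mono yPhi bPhi).
Qed.

(** A Luxemburg norm above [t] means that the average of [phi (g / t)] exceeds 1, so the weak type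
    estimate applies to that function. *)
Lemma luxemburg_level (o delta : R) (delta0 : 0 < delta) (N : nat)
    (g : T -> R) (t : R) (X : {set {ffun 'I_n -> 'I_N.+1}}) :
  measurable_fun [set: T] g -> (forall x, 0 <= g x) -> 0 < t ->
  (forall k, k \in X -> exists u v, [/\ (forall i, v i <= N.+1)%N,
    k \in cell_box N u v &
    (t%:E < luxemburg Phi g (grid_box o delta u v))%E]) ->
  ((#|X|%:R * delta ^+ n)%:E <=
    weak_const%:E * \int[lebesgue]_x (Gam (g x / t))%:E)%E.
Proof.
move=> mg g0 t0 HX.
have gt0 x : 0 <= g x / t by rewrite divr_ge0// ltW.
have mgt : measurable_fun [set: T] (fun x => phi (g x / t)).
  by apply: (measurableT_comp measurable_phi); exact: measurable_funM.
apply: (llog_weak_type delta0 n0 mgt) => [x|k kX].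
  exact: (young_fine_ge0 yPhi).
have [u [v [vN kuv tlux]]] := HX k kX; exists u, v; split => //.
have := luxemburg_gt t0 tlux.
congr (_ < average _ _)%E; apply/funext => x /=.
by rewrite ger0_norm// (young_fineE yPhi bPhi).
Qed.

Lemma luxemburg_scattered : exists2 C : R, 0 <= C &
  forall (o delta : R) (N : nat) (g : T -> R) (I : finType) (S : {set I})
    (u v : I -> 'I_n -> nat) (E : I -> {set {ffun 'I_n -> 'I_N.+1}}),
  0 < delta -> measurable_fun [set: T] g -> (forall x, 0 <= g x) ->
  (forall i j, v i j <= N.+1)%N ->
  (forall i, i \in S -> E i \subset cell_box N (u i) (v i)) ->
  (forall i j, i \in S -> j \in S -> i != j -> [disjoint E i & E j]%bool) ->
  (\sum_(i in S) (#|E i|%:R * delta ^+ n)%:E *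
     luxemburg Phi g (grid_box o delta (u i) (v i)) `^ p <=
   C%:E * \int[lebesgue]_x (g x `^ p)%:E)%E.
Proof.
have [S0 S00 dyadic] := young_llog_dyadic_sum p1 yPhi bPhi.
have p0 : 0 <= p := ltW (lt_trans ltr01 p1).
have Cw0 := weak_const_gt0.
have C0 : 0 <= weak_const * 2 `^ p * S0.
  by apply: mulr_ge0 => //; apply: mulr_ge0; rewrite ?powR_ge0// ltW.
(* The summand 1 makes the constant positive, so that the right side is infinite when the integral
   is. *)
exists (weak_const * 2 `^ p * S0 + 1); first by rewrite addr_ge0.
move=> o delta N g I S u v E delta0 mg g0 vN Euv Edis.
have dn0 : 0 < delta ^+ n by rewrite exprn_gt0.
pose lux i := luxemburg Phi g (grid_box o delta (u i) (v i)).
have lux0 i : (0 <= lux i)%E by exact: luxemburg_ge0.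
set J := (\int[lebesgue]_x _)%E.
have J0 : (0 <= J)%E by apply: integral_ge0 => x _; rewrite lee_fin powR_ge0.
have [Joo|Joo] := eqVneq J +oo%E.
  by rewrite Joo gt0_muley ?leey// lte_fin ltr_wpDl.
have Jfin : J \is a fin_num by rewrite ge0_fin_numE// ltey.
have mG t : measurable_fun [set: T] (fun x => (Gam (g x / t))%:E).
  apply/measurable_EFinP; apply: (measurableT_comp measurable_Gam).
  exact: measurable_funM.
have G0 t x : (0 <= (Gam (g x / t))%:E)%E.
  by rewrite lee_fin (young_llog_ge0 n yPhi).
have Gint0 t : (0 <= \int[lebesgue]_x (Gam (g x / t))%:E)%E by exact: integral_ge0.
pose a L k : R := 2 ^+ k / 2 ^+ L.
have a0 L k : 0 < a L k by rewrite divr_gt0 ?exprn_gt0.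
have dyadicI L : (\sum_(k < L.*2) (a L k `^ p)%:E *
    \int[lebesgue]_x (Gam (g x / a L k))%:E <= S0%:E * J)%E.
  under eq_bigr => k _ do rewrite -ge0_integralZl_EFin// ?powR_ge0//.
  rewrite -ge0_integral_sum; last 3 first.
  - exact: measurableT.
  - by move=> k; apply: emeasurable_funM => //; exact: mG.
  - by move=> k x _; apply: mule_ge0 => //; rewrite lee_fin powR_ge0.
  rewrite -ge0_integralZl_EFin; last 4 first.
  - exact: measurableT.
  - by move=> x _; rewrite lee_fin powR_ge0.
  - by apply/measurable_EFinP; exact: (measurableT_comp (measurable_powR p)).
  - exact: S00.
  apply: le_integral_ge0 => // [x _|x _|x _].
  - by apply: sume_ge0 => k _; apply: mule_ge0 => //; rewrite lee_fin powR_ge0.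
  - by rewrite mule_ge0// lee_fin powR_ge0.
  under eq_bigr do rewrite -EFinM.
  by rewrite sumEFin -EFinM lee_fin; exact: dyadic.
pose X t : {set {ffun 'I_n -> 'I_N.+1}} :=
  \bigcup_(i in S | (t%:E < lux i)%E) E i.
have Xlevel t : 0 < t -> ((#|X t|%:R * delta ^+ n)%:E <=
    weak_const%:E * \int[lebesgue]_x (Gam (g x / t))%:E)%E.
  move=> t0; apply: (@luxemburg_level o) => // k.
  move=> /finset.bigcupP[i /andP[iS ti] ki].
  exists (u i), (v i); split => //; exact: (fintype.subsetP (Euv i iS)).
(* If the norm were infinite, [X t] would be nonempty for every [t]. The single dyadic term at the
   level [2 ^+ L] then bounds the [p]-th power of [2 ^+ L] independently of [L], which fails for the
   [L] chosen here. *)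
have luxfin i : i \in S -> E i != finset.set0 -> lux i \is a fin_num.
  move=> iS Ei0; rewrite ge0_fin_numE// ltNge leye_eq; apply/negP => /eqP ioo.
  pose L := (Num.truncn (weak_const * S0 * fine J / delta ^+ n)).+1.
  pose k := L.*2.+1; have aE : a L.+1 k = 2 ^+ L.
    rewrite /a /k (_ : L.*2.+1 = (L + L.+1)%N); last by rewrite addnS addnn.
    by rewrite exprD mulfK// gt_eqF// exprn_gt0.
  have X1 t : (1 <= #|X t|)%N.
    have [x Ex] := finset.set0Pn _ Ei0; apply/card_gt0P; exists x.
    by apply/finset.bigcupP; exists i => //; rewrite iS ioo ltry.
  have kL : (k < L.+1.*2)%N by rewrite /k doubleS.
  have := dyadicI L.+1; rewrite (bigD1 (Ordinal kL))//= => H.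
  have {}H : ((a L.+1 k `^ p)%:E * \int[lebesgue]_x (Gam (g x / a L.+1 k))%:E <=
      S0%:E * J)%E.
    apply: le_trans H; rewrite leeDl// sume_ge0// => j _.
    apply: mule_ge0; last exact: Gint0.
    by rewrite lee_fin powR_ge0.
  rewrite aE in H; have t1 : 1 <= 2 ^+ L :> R by rewrite exprn_ege1// ler1n.
  have t0 : 0 < 2 ^+ L :> R by rewrite exprn_gt0.
  have H2 : ((delta ^+ n)%:E <=
      weak_const%:E * \int[lebesgue]_x (Gam (g x / 2 ^+ L))%:E)%E.
    apply: le_trans (Xlevel _ t0); rewrite lee_fin ler_peMl ?(ltW dn0)//.
    by rewrite ler1n.
  have : (((2 ^+ L) `^ p * delta ^+ n)%:E <= (weak_const * S0 * fine J)%:E)%E.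
    rewrite [leRHS]EFinM fineK// [(weak_const * S0)%:E]EFinM -muleA.
    apply: le_trans (lee_wpmul2l _ H); last by rewrite lee_fin ltW.
    rewrite muleCA [leLHS]EFinM; apply: lee_wpmul2l H2.
    by rewrite lee_fin powR_ge0.
  rewrite lee_fin leNgt => /negP; apply.
  have : weak_const * S0 * fine J / delta ^+ n < 2 ^+ L.
    have c0 : 0 <= weak_const * S0 * fine J / delta ^+ n.
      apply: divr_ge0; last exact: ltW.
      by apply: mulr_ge0; [rewrite mulr_ge0// ltW|exact: fine_ge0].
    have /andP[_ /lt_le_trans] := truncn_itv c0; apply.
    by rewrite -natrX ler_nat; exact: ltnW (ltn_expl _ _).
  rewrite ltr_pdivrMr// => /lt_le_trans; apply.
  rewrite ler_pM2r// -[leLHS]powRr1 ?(ltW t0)//.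
  by apply: ler_powR => //; exact: ltW.
pose x i := fine (lux i).
have x0 i : 0 <= x i by rewrite fine_ge0.
pose e i : R := #|E i|%:R * delta ^+ n.
have e0 i : 0 <= e i by rewrite mulr_ge0// ltW.
(* The norm may be infinite where [E i] is empty, but there its coefficient is 0. *)
pose P i := (i \in S) && (E i != finset.set0).
rewrite (_ : (\sum_(i in S) _ = (\sum_(i | P i) e i * x i `^ p)%:E)%E); last first.
  rewrite -sumEFin /P big_mkcondr/=; apply: eq_bigr => i iS.
  case: ifPn => [Ei|/negPn/eqP ->]; last by rewrite cards0 mul0r mul0e.
  by rewrite -/(lux i) -(fineK (luxfin i iS Ei)) poweR_EFin.
(* [y] dominates all [x i] and all their inverses, so every nonzero [x i] lies between [2 ^- L] and
   [2 ^+ L]. *)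
pose y := \sum_i x i + \sum_i (x i)^-1.
have sx (Q : pred I) : 0 <= \sum_(i | Q i) x i.
  by apply: sumr_ge0 => i _; exact: x0.
have sxV (Q : pred I) : 0 <= \sum_(i | Q i) (x i)^-1.
  by apply: sumr_ge0 => i _; rewrite invr_ge0.
have y0 : 0 <= y by exact: addr_ge0.
pose L := (Num.truncn y).+1.
have yL : y < 2 ^+ L.
  have /andP[_ /lt_le_trans] := truncn_itv y0; apply.
  by rewrite -natrX ler_nat; exact: ltnW (ltn_expl _ _).
have xL i : x i <= 2 ^+ L.
  apply: le_trans (ltW yL); rewrite /y (bigD1 i)//= -addrA lerDl.
  exact: addr_ge0.
have xL' i : 0 < x i -> 2 ^- L < x i.
  move=> xi; rewrite invf_plt ?posrE ?exprn_gt0//; apply: le_lt_trans yL.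
  rewrite /y addrC (bigD1 i)//= -addrA lerDl.
  exact: addr_ge0.
have layer i : x i `^ p <= \sum_(k < L.*2 | a L k < x i) (2 * a L k) `^ p.
  have [xi|xi] := ltP 0 (x i); last first.
    have -> : x i = 0 by apply/eqP; rewrite eq_le xi x0.
    rewrite powR0 ?gt_eqF ?(lt_trans ltr01)// sumr_ge0// => k _; exact: powR_ge0.
  have xL2 : x i <= 2 ^+ L.*2 * 2 ^- L.
    by rewrite -addnn exprD mulfK// gt_eqF// exprn_gt0.
  have := dyadic_layer (ltW p1) _ (xL' i xi) xL2.
  rewrite big_mkord invr_gt0 exprn_gt0//; exact.
apply: (@le_trans _ _ (\sum_(k < L.*2)
   ((2 * a L k) `^ p)%:E * (#|X (a L k)|%:R * delta ^+ n)%:E)%E).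
  under [leRHS]eq_bigr do rewrite -EFinM.
  rewrite sumEFin lee_fin.
  apply: (@le_trans _ _ (\sum_(i | P i) \sum_(k < L.*2 | a L k < x i)
      e i * (2 * a L k) `^ p)).
    by apply: ler_sum => i _; rewrite -mulr_sumr ler_wpM2l.
  under eq_bigr do rewrite big_mkcond/=.
  rewrite exchange_big/=; apply: ler_sum => k _.
  rewrite -big_mkcondr/= -mulr_suml mulrC ler_wpM2l ?powR_ge0//.
  rewrite /e -mulr_suml ler_wpM2r ?(ltW dn0)// -natr_sum ler_nat.
  apply: sum_card_disjoint => [i|i j].
    move=> /andP[/andP[iS Ei] axi]; apply: finset.bigcup_sup; rewrite iS/=.
    by rewrite -(fineK (luxfin i iS Ei)) lte_fin.
  by move=> /andP[/andP[iS _] _] /andP[/andP[jS _] _]; exact: Edis.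
apply: (@le_trans _ _ (\sum_(k < L.*2) (weak_const * 2 `^ p)%:E *
   ((a L k `^ p)%:E * \int[lebesgue]_x (Gam (g x / a L k))%:E))%E).
  apply: lee_sum => k _.
  rewrite powRM// ?(ltW (a0 _ _))//.
  apply: (@le_trans _ _ ((2 `^ p * a L k `^ p)%:E *
    (weak_const%:E * \int[lebesgue]_x (Gam (g x / a L k))%:E))%E).
    by rewrite lee_wpmul2l// ?Xlevel// lee_fin mulr_ge0 ?powR_ge0.
  by rewrite !EFinM muleCA -!muleA.
rewrite -ge0_sume_distrr; last first.
  move=> k _; apply: mule_ge0; last exact: Gint0.
  by rewrite lee_fin powR_ge0.
apply: (@le_trans _ _ ((weak_const * 2 `^ p)%:E * (S0%:E * J))%E).
  by apply: lee_wpmul2l => //; rewrite lee_fin mulr_ge0 ?powR_ge0 ?ltW.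
rewrite muleA -EFinM; apply: lee_wpmul2r => //.
by rewrite lee_fin lerDl.
Qed.

End orlicz_strong_type.

(** * Muckenhoupt weights on grids *)

Section muckenhoupt.
Context {R : realType} {n : nat}.
Local Notation T := (euclidean R n).
Variables (q : R) (nu : T -> R).
Hypotheses (q1 : 1 < q) (Aq : muckenhoupt q nu).

Let nu0 x : 0 <= nu x. Proof. by case: Aq => -[]. Qed.

Let mnu : measurable_fun [set: T] nu. Proof. by case: Aq => -[_ []]. Qed.

Let q' := q / (q - 1).

Let q10 : 0 < q - 1. Proof. by rewrite subr_gt0. Qed.
Let q0 : 0 < q. Proof. exact: lt_trans q1. Qed.
Let q'E : q / q' = q - 1.
Proof. by rewrite /q' invf_div mulrCA divff ?mulr1// gt_eqF. Qed.
Let q'1 : q' - 1 = (q - 1)^-1.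
Proof. by rewrite /q'; field; rewrite gt_eqF. Qed.

(** The dual weight in two versions: [sigma] is infinite where [nu] vanishes, as A_q requires,
    whereas the real-valued [s] is 0 there. *)
Let sigma x : \bar R := (((nu x)%:E `^ (q' - 1))^-1)%E.
Let s x : R := (nu x `^ (q' - 1))^-1.

Let sigma_s x : 0 < nu x -> sigma x = (s x)%:E.
Proof.
by move=> x0; rewrite /sigma poweR_EFin inver gt_eqF// powR_gt0.
Qed.

Let sigma_oo x : nu x = 0 -> sigma x = +oo%E.
Proof.
move=> x0; rewrite /sigma x0 poweR_EFin powR0 ?inver ?eqxx//.
by rewrite q'1 gt_eqF// invr_gt0.
Qed.

Let s_le_sigma x : ((s x)%:E <= sigma x)%E.
Proof.
have := nu0 x; rewrite le_eqVlt => /predU1P[/esym/sigma_oo ->|/sigma_s -> //].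
by rewrite leey.
Qed.

Let s0 x : 0 <= s x. Proof. by rewrite invr_ge0 powR_ge0. Qed.

Let sigma0 x : (0 <= sigma x)%E.
Proof. by apply: le_trans (s_le_sigma x); rewrite lee_fin. Qed.

Let ms : measurable_fun [set: T] s.
Proof.
rewrite (_ : s = (fun x => nu x `^ (- (q' - 1)))).
  exact: (measurableT_comp (measurable_powR _)).
by apply/funext => x; rewrite /s powRN.
Qed.

(** Hoelder's inequality for [H] written as the [1 / q] power of [H ^ q * nu] times the [1 / q']
    power of [s]; the A_q condition bounds the mass of [s]. *)
Lemma muckenhoupt_average : exists2 K : R, 0 <= K &
  forall (a b : 'rV[R]_n) (H : T -> R) (B := half_open_box a b : set T),
  Defs.nondegenerate a b -> measurable_fun [set: T] H -> (forall x, 0 <= H x) ->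
  (\int[lebesgue]_(x in B) (H x `^ q * nu x)%:E < +oo)%E ->
  fine (\int[lebesgue]_(x in B) (nu x)%:E) *
    (fine (\int[lebesgue]_(x in B) (H x)%:E) / volume a b) `^ q <=
  K * fine (\int[lebesgue]_(x in B) (H x `^ q * nu x)%:E).
Proof.
have [_ Asup] := Aq; set S := ereal_sup _ in Asup.
exists `|fine S| => // a b H B ab mH H0 HB.
have mB : measurable B by exact: measurable_half_open_box.
set w := (\int[lebesgue]_(x in B) (nu x)%:E)%E.
have w_ge0 : (0 <= w)%E by apply: integral_ge0 => x _; rewrite lee_fin.
set I := (\int[lebesgue]_(x in B) (H x `^ q * nu x)%:E)%E in HB *.
have Hnu0 x : 0 <= H x `^ q * nu x by rewrite mulr_ge0 ?powR_ge0.
have I_ge0 : (0 <= I)%E by apply: integral_ge0 => x _; rewrite lee_fin.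
have Ifin : I \is a fin_num by rewrite ge0_fin_numE.
have fI0 : 0 <= fine I by rewrite fine_ge0.
have [w0|w0] := eqVneq (fine w) 0; first by rewrite w0 mul0r mulr_ge0.
have fw0 : 0 < fine w by rewrite lt_neqAle eq_sym w0 fine_ge0.
have V0 : 0 < volume a b by apply: prodr_gt0 => i _; rewrite subr_gt0.
have wV0 : 0 < fine w / volume a b by rewrite divr_gt0.
have wfin : w \is a fin_num.
  by move: w0; case: (w) => // /eqP.
pose A : set T := rectangle a b.
have BA : B `<=` A by exact: half_open_box_subset.
have avg_le (f : T -> \bar R) : (forall x, 0 <= f x)%E ->
    (((volume a b)^-1)%:E * \int[lebesgue]_(x in B) f x <= average f A)%E.
  move=> f0; rewrite /average lebesgue_rectangle// inver gt_eqF//.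
  apply: lee_wpmul2l; first by rewrite lee_fin invr_ge0 ltW.
  exact: le_integral_ge0.
have AS : (average (EFin \o nu) A * average sigma A `^ (q / q') <= S)%E.
  by apply: ereal_sup_ubound; exists A => //; exists a, b.
have avgnu : ((fine w / volume a b)%:E <= average (EFin \o nu) A)%E.
  apply: le_trans (avg_le (EFin \o nu) _); last by move=> x; rewrite /= lee_fin.
  by rewrite mulrC EFinM fineK.
have sigB0 : (0 <= \int[lebesgue]_(x in B) sigma x)%E by exact: integral_ge0.
have SigS : (((fine w / volume a b))%:E *
    (((volume a b)^-1)%:E * \int[lebesgue]_(x in B) sigma x) `^ (q - 1) <= S)%E.
  apply: le_trans AS; rewrite q'E; apply: lee_pmul => //.
  - by rewrite lee_fin ltW.
  - exact: poweR_ge0.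
  - apply: le_poweR2r; [exact: ltW| |exact: avg_le].
    by apply: mule_ge0 => //; rewrite lee_fin invr_ge0 ltW.
(* As [nu] has positive mass on [B], an infinite mass of [sigma] would make the A_q supremum
   infinite. *)
have sigfin : (\int[lebesgue]_(x in B) sigma x < +oo)%E.
  rewrite ltNge leye_eq; apply/negP => /eqP Soo; move: Asup; rewrite ltNge => /negP; apply.
  apply: le_trans SigS; rewrite Soo gt0_muley ?lte_fin ?invr_gt0//.
  by rewrite poweRyr ?gt_eqF// gt0_muley// lte_fin.
have Sfin : S \is a fin_num.
  rewrite ge0_fin_numE//; apply: le_trans SigS.
  by rewrite mule_ge0 ?poweR_ge0// lee_fin ltW.
pose sB := (\int[lebesgue]_(x in B) (s x)%:E)%E.
have sB0 : (0 <= sB)%E by apply: integral_ge0 => x _; rewrite lee_fin.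
have sBsig : (sB <= \int[lebesgue]_(x in B) sigma x)%E.
  by apply: le_integral_ge0 => // x _; rewrite lee_fin.
have sBfin : sB \is a fin_num by rewrite ge0_fin_numE// (le_lt_trans sBsig).
have main_bound : fine w / volume a b * (fine sB / volume a b) `^ (q - 1) <= `|fine S|.
  apply: le_trans (ler_norm _); rewrite -lee_fin (fineK Sfin).
  apply: le_trans SigS; rewrite [leLHS]EFinM; apply: lee_wpmul2l.
    by rewrite lee_fin ltW.
  rewrite -poweR_EFin; apply: le_poweR2r; first exact: ltW.
    by rewrite lee_fin divr_ge0 ?fine_ge0// ltW.
  rewrite mulrC EFinM fineK//; apply: lee_wpmul2l => //.
  by rewrite lee_fin invr_ge0 ltW.
(* [sigma] is infinite on [N0] and integrable over [B], so [N0] is null and the factorization of [H]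
   holds almost everywhere. *)
pose N0 : set T := B `&` [set x | nu x = 0].
have mN0 : measurable N0.
  apply: measurableI => //; rewrite -[X in measurable X]setTI.
  exact: (mnu measurableT (measurable_set1 0)).
have N0_0 : lebesgue N0 = 0%E.
  apply/eqP; rewrite -measure_le0 leNgt; apply/negP => N0pos.
  move: sigfin; rewrite ltNge => /negP; apply.
  apply: (@le_trans _ _ (\int[lebesgue]_(x in N0) cst +oo x)%E).
    by rewrite integral_cst// gt0_mulye.
  apply: le_integral_ge0 => [x []//|x _|x _|x [_ /sigma_oo ->]].
  - exact: leey.
  - exact: sigma0.
  - exact: lexx.
pose F (j : 'I_2) x := if j == ord0 then H x `^ q * nu x else s x.
pose theta (j : 'I_2) := if j == ord0 then q^-1 else q'^-1.
have sum_theta : \sum_j theta j = 1.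
  rewrite big_ord_recl big_ord1 /theta/= /q' invf_div.
  by field; rewrite gt_eqF.
have theta0 j : 0 < theta j.
  by rewrite /theta; case: ifP => _; rewrite invr_gt0// divr_gt0.
have mHnu : measurable_fun [set: T] (fun x => H x `^ q * nu x).
  apply: measurable_funM; last exact: mnu.
  exact: (measurableT_comp (measurable_powR q)).
have F_prod x : 0 < nu x -> \prod_j F j x `^ theta j = H x.
  move=> nux; rewrite big_ord_recl big_ord1 /F /theta/= powRM ?powR_ge0//.
  rewrite -powRrM mulfV ?gt_eqF// powRr1// /s -powRN -powRrM -mulrA -powRD.
    rewrite (_ : _ + _ = 0) ?powRr0 ?mulr1// /q' invf_div; field.
    by rewrite !gt_eqF.
  by rewrite (gt_eqF nux) implybT.
have mF j : measurable_fun B (F j).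
  by apply: measurable_funTS; rewrite /F; case: (j == ord0).
have hold : (\int[lebesgue]_(x in B) (H x)%:E <=
    (fine I `^ q^-1 * fine sB `^ q'^-1)%:E)%E.
  rewrite (@ge0_ae_eq_integral _ _ _ lebesgue B _
    (fun x => (\prod_j F j x `^ theta j)%:E)).
  - apply: le_trans (hoelder_integral (F := F) mB mF _ theta0 sum_theta _) _.
    + by move=> j x _; rewrite /F; case: ifP.
    + by move=> j; rewrite /F; case: (j == ord0) => //; rewrite -ge0_fin_numE.
    + by rewrite big_ord_recl big_ord1.
  - exact: mB.
  - by apply: measurable_funTS; exact/measurable_EFinP.
  - apply/measurable_EFinP; apply: measurable_prod => j _.
    by apply: (measurableT_comp (measurable_powR _)); exact: mF.
  - by move=> x _; rewrite lee_fin.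
  - by move=> x _; rewrite lee_fin; apply: prodr_ge0 => j _; exact: powR_ge0.
  exists N0; split => // x /= /not_implyP[Bx Hx]; split => //=.
  have := nu0 x; rewrite le_eqVlt => /predU1P[<-//|nux].
  by case: Hx; rewrite F_prod.
have intH0 : (0 <= \int[lebesgue]_(x in B) (H x)%:E)%E.
  by apply: integral_ge0 => x _; rewrite lee_fin.
set IH := (\int[lebesgue]_(x in B) (H x)%:E)%E in hold intH0 *.
have IHfin : IH \is a fin_num by rewrite ge0_fin_numE// (le_lt_trans hold)// ltry.
have {}hold : fine IH `^ q <= fine I * fine sB `^ (q - 1).
  move: hold; rewrite -(fineK IHfin) lee_fin => hold.
  have := ler_powR2r (ltW q0) (fine_ge0 intH0) hold.
  rewrite powRM ?powR_ge0// -!powRrM mulVf ?gt_eqF// powRr1//.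
  by rewrite (mulrC _ q) q'E.
rewrite powRM; last 2 first.
- exact: fine_ge0.
- by rewrite invr_ge0 ltW.
apply: le_trans (ler_wpM2r fI0 main_bound).
rewrite [(_ / _) `^ (q - 1)]powRM ?fine_ge0 ?invr_ge0 ?(ltW V0)//.
have -> : (volume a b)^-1 `^ q = (volume a b)^-1 * (volume a b)^-1 `^ (q - 1).
  rewrite -{2}[(volume a b)^-1]powRr1 ?invr_ge0 ?(ltW V0)// -powRD.
    by congr (_ `^ _); ring.
  by rewrite invr_eq0 (gt_eqF V0) implybT.
set Vq := _ `^ (q - 1); have Vq0 : 0 <= Vq by exact: powR_ge0.
rewrite (_ : fine w / volume a b * (fine sB `^ (q - 1) * Vq) * fine I =
  fine w * ((fine I * fine sB `^ (q - 1)) * ((volume a b)^-1 * Vq))); last by ring.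
rewrite ler_wpM2l ?(ltW fw0)// ler_wpM2r//.
by rewrite mulr_ge0// invr_ge0 ltW.
Qed.

End muckenhoupt.

Lemma sum_thin_box {n N : nat} (V : nmodType) (k : {ffun 'I_n -> 'I_N.+1}) i (l r : nat)
    (F : {ffun 'I_n -> 'I_N.+1} -> V) :
  \sum_(k' in cell_box N (fun j => if j == i then l else k j : nat)
                         (fun j => if j == i then r else (k j).+1 : nat)) F k' =
  \sum_(s : 'I_N.+1 | (l <= s < r)%N) F (upd k i s).
Proof.
rewrite (reindex_onto (upd k i) (fun k' => k' i)) /=.
  apply: eq_bigl => s; rewrite upd_id eqxx andbT.
  apply/in_cell_box/idP => [/(_ i)|ls j]; first by rewrite eqxx upd_id.
  by rewrite ffunE; case: eqP => // _; rewrite leqnn ltnSn.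
move=> k' /in_cell_box kk'; apply/ffunP => j; rewrite ffunE.
case: eqP => [->//|/eqP ji]; apply/val_inj/eqP => /=.
by have := kk' j; rewrite (negbTE ji) ltnS -eqn_leq.
Qed.

(** * Functions constant on cells *)

Section cell_functions.
Context {R : realType} {n : nat}.
Local Notation T := (euclidean R n).
Variables (o delta : R).
Hypothesis delta0 : 0 < delta.
Context {N : nat}.
Notation Z := {ffun 'I_n -> 'I_N.+1}.
Implicit Types (h : Z -> R) (k : Z).

Definition cell_fun h (x : T) : R := \sum_k h k * \1_(cell o delta k) x.

Lemma cell_funE h k x : cell o delta k x -> cell_fun h x = h k.
Proof.
move=> kx; rewrite /cell_fun (bigD1 k)//= indicE mem_set// mulr1 big1 ?addr0//.
move=> j jk; rewrite indicE memNset ?mulr0// => jx.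
by move: jk; rewrite (cell_inj delta0 jx kx) eqxx.
Qed.

Lemma cell_fun_out h x : (forall k, ~ cell o delta k x) -> cell_fun h x = 0.
Proof.
by move=> nx; rewrite /cell_fun big1// => k _; rewrite indicE memNset ?mulr0.
Qed.

Lemma cell_fun_ge0 h x : (forall k, 0 <= h k) -> 0 <= cell_fun h x.
Proof. by move=> h0; apply: sumr_ge0 => k _; rewrite mulr_ge0. Qed.

Lemma measurable_cell_fun h : measurable_fun [set: T] (cell_fun h).
Proof.
apply: measurable_sum => k; apply: measurable_funM; first exact: measurable_cst.
by apply: measurable_indic; exact: measurable_cell.
Qed.

Definition cell_mass (w : T -> R) k : R :=
  fine (\int[lebesgue]_(x in cell o delta k) (w x)%:E).

Section mass.
Variable w : T -> R.
Hypotheses (mw : measurable_fun [set: T] w) (w0 : forall x, 0 <= w x).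
Hypothesis wfin : forall k, (\int[lebesgue]_(x in cell o delta k) (w x)%:E < +oo)%E.

Lemma cell_mass_ge0 k : 0 <= cell_mass w k.
Proof. by rewrite fine_ge0// integral_ge0// => x _; rewrite lee_fin. Qed.

Lemma cell_massE k :
  (\int[lebesgue]_(x in cell o delta k) (w x)%:E = (cell_mass w k)%:E)%E.
Proof.
rewrite fineK// ge0_fin_numE//.
by apply: integral_ge0 => x _; rewrite lee_fin.
Qed.

Lemma integral_cell_fun h u v : (forall k, 0 <= h k) ->
  (forall i, v i <= N.+1)%N ->
  (\int[lebesgue]_(x in grid_box o delta u v) (cell_fun h x * w x)%:E =
   (\sum_(k in cell_box N u v) h k * cell_mass w k)%:E)%E.
Proof.
move=> h0 vN; have mf : measurable_fun [set: T] (fun x => (cell_fun h x * w x)%:E).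
  apply/measurable_EFinP; apply: measurable_funM => //; exact: measurable_cell_fun.
rewrite (integral_grid_box o delta0 u vN mf); last first.
  by move=> x; rewrite lee_fin mulr_ge0// cell_fun_ge0.
rewrite -sumEFin; apply: eq_bigr => k _.
rewrite EFinM -cell_massE -ge0_integralZl_EFin; last 4 first.
- exact: measurable_cell.
- by move=> x _; rewrite lee_fin.
- by apply: measurable_funTS; exact/measurable_EFinP.
- exact: h0.
by apply: eq_integral => x /set_mem kx; rewrite (cell_funE h kx) EFinM.
Qed.

End mass.

Lemma integral_cell_fun1 h u v : (forall k, 0 <= h k) ->
  (forall i, v i <= N.+1)%N ->
  (\int[lebesgue]_(x in grid_box o delta u v) (cell_fun h x)%:E =
   (\sum_(k in cell_box N u v) h k * delta ^+ n)%:E)%E.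
Proof.
move=> h0 vN; have one k :
    (\int[lebesgue]_(x in cell o delta k) (1 : R)%:E = (delta ^+ n)%:E)%E.
  rewrite integral_cst; last exact: measurable_cell.
  by rewrite mul1e lebesgue_cell.
have := @integral_cell_fun (fun=> 1) _ (fun=> ler01) _ h u v h0 vN.
under eq_integral do rewrite mulr1.
move=> ->; first 1 last.
- exact: measurable_cst.
- by move=> k; rewrite one ltry.
by congr EFin; apply: eq_bigr => k _; rewrite /cell_mass one.
Qed.

End cell_functions.

(* A_q is tested on the boxes one cell wide in all directions but one. *)
Lemma muckenhoupt_axis_weighted {R : realType} {n : nat} (q : R)
    (nu : euclidean R n -> R) : 1 < q -> muckenhoupt q nu ->
  exists2 K : R, 0 <= K & forall (o delta : R) (N : nat), 0 < delta ->
    (forall k : {ffun 'I_n -> 'I_N.+1},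
      (\int[lebesgue]_(x in cell o delta k) (nu x)%:E < +oo)%E) ->
    axis_weighted (cell_mass o delta nu (N := N)) q K.
Proof.
move=> q1 Aq; have [K K0 HK] := muckenhoupt_average q1 Aq.
exists K => // o delta N delta0 nufin i k l r h h0 lkr rN.
have [[nu0 [mnu _]] _] := Aq.
pose u j := if j == i then l else k j.
pose v j := if j == i then r else (k j).+1.
have uv j : (u j < v j)%N by rewrite /u /v; case: eqP => // _; lia.
have vN j : (v j <= N.+1)%N by rewrite /v; case: eqP.
have hq0 k' : 0 <= h k' `^ q by exact: powR_ge0.
have powE x : cell_fun o delta h x `^ q = cell_fun o delta (fun k => h k `^ q) x.
  have [[k' k'x]|/forallNP nx] := pselect (exists k', cell o delta (N := N) k' x).
    by rewrite !(cell_funE delta0 _ k'x).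
  rewrite !cell_fun_out// powR0// gt_eqF//; exact: lt_trans q1.
have := HK (grid_point o delta u) (grid_point o delta v) (cell_fun o delta h)
  (grid_point_lt o delta0 uv) (measurable_cell_fun o delta h)
  (fun x => cell_fun_ge0 o delta x h0).
under eq_integral do rewrite powE.
rewrite -/(grid_box o delta u v).
rewrite (integral_cell_fun delta0 mnu nu0 nufin u hq0 vN) ltry => /(_ isT)/=.
rewrite (integral_cell_fun1 o delta0 u h0 vN)/=.
have -> : fine (\int[lebesgue]_(x in grid_box o delta u v) (nu x)%:E) =
    \sum_(k' in cell_box N u v) cell_mass o delta nu k'.
  have mnuE : measurable_fun [set: euclidean R n] (fun x => (nu x)%:E).
    exact/measurable_EFinP.
  rewrite (integral_grid_box o delta0 u vN mnuE).
    under eq_bigr do rewrite cell_massE//.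
    by rewrite sumEFin.
  by move=> x; rewrite lee_fin.
have volE : volume (grid_point o delta u) (grid_point o delta v) =
    (r - l)%:R * delta ^+ n.
  have := lebesgue_grid_box o delta0 u vN.
  rewrite [X in X = _](lebesgue_half_open_box (grid_point_lt o delta0 uv)).
  move=> -[->]; congr (_ * _); rewrite -(card_interval _ rN) -sum1_card natr_sum.
  exact: (@sum_thin_box n N R k i l r (fun=> 1)).
rewrite volE !sum_thin_box -mulr_suml => H.
under [X in _ <= _ * X]eq_bigr do rewrite mulrC.
apply: le_trans H; rewrite le_eqVlt /axis_avg; apply/orP; left; apply/eqP.
congr (_ * _ `^ q); rewrite invfM mulrACA divff ?mulr1//.
by rewrite gt_eqF// exprn_gt0.
Qed.

(** * The estimate on one grid *)

Lemma weight_rectangle_lty {R : realType} {n : nat} (w : euclidean R n -> R)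
    (a b : 'rV[R]_n) : weight w ->
  (\int[lebesgue]_(x in rectangle a b) (w x)%:E < +oo)%E.
Proof.
move=> [w0 [mw locw]].
have cpt : compact (rectangle a b).
  have := @rV_compact R n (fun i => `[a ord0 i, b ord0 i]%classic).
  by move=> /(_ (fun i => @segment_compact R (a ord0 i) (b ord0 i))); exact.
have := locw _ cpt; under eq_integral do rewrite ger0_norm//.
exact.
Qed.

Section luxemburg_scale.
Context {R : realType} {n : nat}.
Local Notation T := (euclidean R n).

Lemma luxemburg_scale (Phi : \bar R -> \bar R) (f g : T -> R) (A : set T) (c : R) :
  young Phi -> (forall x, 0 <= f x) -> (forall x, 0 <= g x) -> 0 <= c ->
  (forall x, A x -> c * f x <= g x) ->
  (c%:E * luxemburg Phi f A <= luxemburg Phi g A)%E.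
Proof.
move=> [Phi0 _ _ Phi_mono _] f0 g0; rewrite le_eqVlt => /predU1P[<- _|c0 cfg].
  by rewrite mul0e luxemburg_ge0.
apply: le_ereal_inf_tmp => _ [l [l0 avg1] <-].
rewrite muleC -lee_pdivlMr//.
rewrite -EFinM; apply: ereal_inf_lbound; exists (l / c) => //.
split; first exact: divr_gt0.
apply: le_trans avg1; apply: lee_wpmul2l.
  by rewrite inve_ge0; exact: measure_ge0.
have arg0 (h : T -> R) x t : 0 < t -> (0 <= (`|h x| / t)%:E)%E.
  by move=> t0; rewrite lee_fin divr_ge0// ltW.
apply: le_integral_ge0 => // x Ax.
- by apply/Phi0/arg0; exact: divr_gt0.
- exact/Phi0/arg0.
apply: Phi_mono; first by apply: arg0; exact: divr_gt0.
rewrite lee_fin !ger0_norm// invf_div mulrA ler_pM2r ?invr_gt0//.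
by rewrite mulrC cfg.
Qed.

Lemma average_ge0 (g : T -> \bar R) A : (forall x, 0 <= g x)%E ->
  (0 <= average g A)%E.
Proof.
move=> g0; apply: mule_ge0; last by apply: integral_ge0 => x _; exact: g0.
by rewrite inve_ge0; exact: measure_ge0.
Qed.

Lemma rectangles_cover (x : T) : exists2 A : set T, rectangles R n A & A x.
Proof.
pose a : 'rV[R]_n := \row_i (x ord0 i - 1); pose b : 'rV[R]_n := \row_i (x ord0 i + 1).
exists (rectangle a b); first by exists a, b; split => // i; rewrite !mxE; lra.
by move=> i; rewrite in_itv/= !mxE; apply/andP; split; lra.
Qed.

Lemma strong_maximal_ge0 (w : T -> R) x : (0 <= strong_maximal w x)%E.
Proof.
have [A rA Ax] := rectangles_cover x.
apply: (@le_trans _ _ (average (fun y => `|w y|%:E) A)).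
  by apply: average_ge0 => y; rewrite lee_fin.
by apply: ereal_sup_ubound; exists A.
Qed.

End luxemburg_scale.

(** * Boxes of a grid and their averages *)

Section grid_boxes.
Context {R : realType} {n : nat}.
Local Notation T := (euclidean R n).
Variables (o delta : R).
Hypothesis delta0 : 0 < delta.
Variable N : nat.
Notation Z := {ffun 'I_n -> 'I_N.+1}.

(** Upper corners range up to [N.+1], hence [N.+2] values. Pairs of corners in the wrong order give
    boxes without cells, which never enter a maximum taken at a cell. *)
Definition box_index : finType :=
  ({ffun 'I_n -> 'I_N.+2} * {ffun 'I_n -> 'I_N.+2})%type.
Implicit Types (i : box_index) (k : Z).

Definition box_lo i (j : 'I_n) : nat := i.1 j.
Definition box_hi i (j : 'I_n) : nat := i.2 j.
Definition box_set i : set T := grid_box o delta (box_lo i) (box_hi i).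
Definition box_cells i : {set Z} := cell_box N (box_lo i) (box_hi i).
Definition box_volume i : R := #|box_cells i|%:R * delta ^+ n.

Lemma box_hiN i j : (box_hi i j <= N.+1)%N.
Proof. by rewrite -ltnS; exact: ltn_ord. Qed.

Lemma box_volume_ge0 i : 0 <= box_volume i.
Proof. by rewrite mulr_ge0// exprn_ge0// ltW. Qed.

Lemma box_volume_gt0 i k : k \in box_cells i -> 0 < box_volume i.
Proof.
by move=> ki; rewrite mulr_gt0 ?exprn_gt0// ltr0n; apply/card_gt0P; exists k.
Qed.

Lemma lebesgue_box_set i : lebesgue (box_set i) = (box_volume i)%:E.
Proof. exact: (lebesgue_grid_box o delta0 _ (box_hiN i)). Qed.

Lemma measurable_box_set i : measurable (box_set i).
Proof. exact: measurable_grid_box. Qed.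

Lemma box_lo_lt_hi i k : k \in box_cells i -> forall j, (box_lo i j < box_hi i j)%N.
Proof. by move=> /in_cell_box ki j; have /andP[/leq_ltn_trans] := ki j; exact. Qed.

Section one_weight.
Variable w : T -> R.
Hypothesis ww : weight w.

Let w0 x : 0 <= w x. Proof. by case: ww. Qed.
Let mw : measurable_fun [set: T] w. Proof. by case: ww => _ []. Qed.

Lemma weight_grid_box_lty u v :
  (\int[lebesgue]_(x in grid_box o delta u v) (w x)%:E < +oo)%E.
Proof.
apply: le_lt_trans (weight_rectangle_lty (grid_point o delta u)
  (grid_point o delta v) ww).
apply: le_integral_ge0 => [|x _|x _|//]; rewrite ?lee_fin//.
exact: half_open_box_subset.
Qed.

Lemma weight_cell_lty k : (\int[lebesgue]_(x in cell o delta k) (w x)%:E < +oo)%E.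
Proof. exact: weight_grid_box_lty. Qed.

Definition box_mass i : R := \sum_(k in box_cells i) cell_mass o delta w k.

Lemma box_mass_ge0 i : 0 <= box_mass i.
Proof. by apply: sumr_ge0 => k _; exact: cell_mass_ge0. Qed.

Lemma integral_box_set i :
  (\int[lebesgue]_(x in box_set i) (w x)%:E = (box_mass i)%:E)%E.
Proof.
have mwE : measurable_fun [set: T] (fun x => (w x)%:E) by exact/measurable_EFinP.
rewrite /box_set (integral_grid_box o delta0 _ (box_hiN i) mwE); last first.
  by move=> x; rewrite lee_fin.
rewrite -sumEFin; apply: eq_bigr => k _; apply: cell_massE => //.
exact: weight_cell_lty.
Qed.

Definition box_average i : R := box_mass i / box_volume i.

Lemma box_average_ge0 i : 0 <= box_average i.
Proof. by rewrite divr_ge0 ?box_mass_ge0 ?box_volume_ge0. Qed.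

Definition cell_maximal k : R := \big[Num.max/0]_(i | k \in box_cells i) box_average i.

Lemma cell_maximal_ge0 k : 0 <= cell_maximal k.
Proof. exact: bigmax_ge_id. Qed.

Lemma box_average_le_maximal i k : k \in box_cells i ->
  box_average i <= cell_maximal k.
Proof. by move=> ki; exact: (le_bigmax_cond 0 box_average ki). Qed.

Lemma box_average_le_strong_maximal i k x : k \in box_cells i ->
  cell o delta k x -> ((box_average i)%:E <= strong_maximal w x)%E.
Proof.
move=> ki kx; have ndi := grid_point_lt o delta0 (box_lo_lt_hi ki).
pose A : set T := rectangle (grid_point o delta (box_lo i)) (grid_point o delta (box_hi i)).
apply: (@le_trans _ _ (average (fun y => `|w y|%:E) A)); last first.
  apply: ereal_sup_ubound; exists A => //; split.
    by exists (grid_point o delta (box_lo i)), (grid_point o delta (box_hi i)).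
  exact: half_open_box_subset (cell_subset delta0 ki kx).
have volE : volume (grid_point o delta (box_lo i)) (grid_point o delta (box_hi i)) =
    box_volume i.
  by have := lebesgue_box_set i; rewrite /box_set [X in X = _](lebesgue_half_open_box ndi) => -[].
rewrite /average [X in X^-1%E](lebesgue_rectangle ndi) volE.
rewrite inver gt_eqF ?(box_volume_gt0 ki)// /box_average mulrC EFinM.
apply: lee_wpmul2l; first by rewrite lee_fin invr_ge0 box_volume_ge0.
rewrite -integral_box_set; apply: le_integral_ge0 => [|x' _|x' _|x' _].
- exact: half_open_box_subset.
- by rewrite lee_fin.
- by rewrite lee_fin.
- by rewrite ger0_norm.
Qed.

(* f (M w)^(1/q) for the maximal function M over the boxes of the grid *)
Definition weighted_fun (q : R) (f : T -> R) (x : T) : R :=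
  f x * cell_fun o delta (fun k => cell_maximal k `^ q^-1) x.

Lemma weighted_fun_ge0 q f x : (forall x, 0 <= f x) -> 0 <= weighted_fun q f x.
Proof.
by move=> f0; rewrite mulr_ge0// cell_fun_ge0// => k; exact: powR_ge0.
Qed.

Lemma measurable_weighted_fun q f : measurable_fun [set: T] f ->
  measurable_fun [set: T] (weighted_fun q f).
Proof.
move=> mf; apply: measurable_funM; first exact: mf.
exact: measurable_cell_fun.
Qed.

Lemma weighted_fun_ge q f i x : 0 < q -> (forall x, 0 <= f x) -> box_set i x ->
  box_average i `^ q^-1 * f x <= weighted_fun q f x.
Proof.
move=> q0 f0 ix; have [k ki kx] := grid_box_cell delta0 (box_hiN i) ix.
rewrite /weighted_fun (cell_funE delta0 _ kx) mulrC ler_wpM2l//.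
apply: ler_powR2r; first by rewrite invr_ge0 ltW.
  exact: box_average_ge0.
exact: box_average_le_maximal.
Qed.

(** The grid maximal function is replaced by the strong one only here, pointwise: a half-open box
    has the measure of its closure, and the closure is an admissible rectangle. *)
Lemma integral_weighted_fun_le q f : 0 < q -> (forall x, 0 <= f x) ->
  (\int[lebesgue]_x (weighted_fun q f x `^ q)%:E <=
   \int[lebesgue]_x ((`|f x| `^ q)%:E * strong_maximal w x))%E.
Proof.
move=> q0 f0; have SM0 := @strong_maximal_ge0 R n w.
apply: le_integral_ge0 => [//|x _|x _|x _].
- by rewrite lee_fin powR_ge0.
- by apply: mule_ge0 => //; rewrite lee_fin powR_ge0.
have [[k kx]|/forallNP nx] := pselect (exists k : Z, cell o delta k x).
  rewrite /weighted_fun (cell_funE delta0 _ kx) powRM ?powR_ge0//.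
  rewrite -powRrM mulVf ?gt_eqF// powRr1 ?cell_maximal_ge0// ger0_norm// EFinM.
  apply: lee_wpmul2l; first by rewrite lee_fin powR_ge0.
  apply: (big_ind (fun r : R => (r%:E <= strong_maximal w x)%E)) => //.
    by move=> r s rx sx; rewrite /Num.max; case: ifP.
  by move=> i ki; exact: box_average_le_strong_maximal ki kx.
rewrite /weighted_fun cell_fun_out// mulr0 powR0 ?gt_eqF//.
by apply: mule_ge0 => //; rewrite lee_fin powR_ge0.
Qed.

End one_weight.
End grid_boxes.

Lemma prode_eq0 {R : realDomainType} m (x : 'I_m -> \bar R) j :
  x j = 0%E -> (\prod_j x j = 0)%E.
Proof. by move=> xj; rewrite (bigD1 j)//= xj mul0e. Qed.

Lemma prode_gt0 {R : realDomainType} (I : Type) (s : seq I) (P : pred I)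
    (x : I -> \bar R) :
  (forall j, 0 < x j)%E -> (0 < \prod_(j <- s | P j) x j)%E.
Proof.
move=> x0; apply: (big_ind (fun y : \bar R => (0 < y)%E)) => //.
by move=> a b a0 b0; rewrite mule_gt0.
Qed.

Lemma prode_pinfty {R : realDomainType} m (x : 'I_m -> \bar R) j :
  (forall j, 0 < x j)%E -> x j = +oo%E -> (\prod_j x j = +oo)%E.
Proof.
move=> x0 xj; rewrite (bigD1 j)//= xj gt0_mulye//.
exact: (@prode_gt0 _ _ _ (fun i => i != j)).
Qed.

Lemma powR_sumr {R : realType} m (x : R) (t : 'I_m -> R) : 0 < x ->
  x `^ (\sum_j t j) = \prod_j x `^ t j.
Proof.
move=> x0; apply: (big_morph (fun r => x `^ r)) => [r s|]; last exact: powRr0.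
by rewrite powRD// (gt_eqF x0) implybT.
Qed.

Lemma powR_prod {R : realType} m (x : 'I_m -> R) (p : R) : (forall j, 0 <= x j) ->
  (\prod_j x j) `^ p = \prod_j x j `^ p.
Proof.
move=> x0.
suff [] : 0 <= \prod_j x j /\ (\prod_j x j) `^ p = \prod_j x j `^ p by [].
apply: (big_ind2 (fun a b => 0 <= a /\ a `^ p = b)) => //.
  by rewrite powR1.
by move=> a b c d [a0 <-] [c0 <-]; rewrite mulr_ge0// powRM.
Qed.

Section grid_inequality.
Context (R : realType) (m n : nat) (hn : (0 < n)%N).
Local Notation T := (euclidean R n).
Context (p : R) (ps : 'I_m -> R) (p0 : 0 < p) (hps : forall j, 1 < ps j).
Context (hp : p^-1 = \sum_(j < m) (ps j)^-1).
Context (Psi : 'I_m -> \bar R -> \bar R).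
Context (hyoung : forall j, young (Psi j)).
Context (hPsi : forall j, strong_Bp n (ps j) (Psi j)).
Context (w : 'I_m -> T -> R) (hw : forall j, weight (w j)).
Let nu := fun x => \prod_(j < m) w j x `^ (p / ps j).
Context (wnu : weight nu).

Let theta j := p / ps j.
Let ps0 j : 0 < ps j. Proof. exact: lt_trans (hps j). Qed.
Let theta0 j : 0 < theta j. Proof. exact: divr_gt0. Qed.
Let sum_theta : \sum_j theta j = 1.
Proof. by rewrite -mulr_sumr -hp mulfV// gt_eqF. Qed.

Let w0 j x : 0 <= w j x. Proof. by case: (hw j). Qed.
Let mw j : measurable_fun [set: T] (w j). Proof. by case: (hw j) => _ []. Qed.
Let nu0 x : 0 <= nu x. Proof. by case: wnu. Qed.

Section one_grid.
Variables (o delta : R).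
Hypothesis delta0 : 0 < delta.
Variable N : nat.
Notation Z := {ffun 'I_n -> 'I_N.+1}.
Local Notation box := (@box_index n N).
Local Notation mass := (box_mass o delta).
Local Notation avg := (box_average o delta).
Local Notation vol := (box_volume delta).
Local Notation cells := (@box_cells n N).

Lemma box_mass_prod_le (i : box) k : k \in cells i ->
  mass nu i <= vol i * \prod_j avg (w j) i `^ theta j.
Proof.
move=> ki; have vi := box_volume_gt0 delta0 ki.
have mi := measurable_box_set o delta i.
have := @hoelder_integral _ _ R lebesgue _ mi m w theta
  (fun j => measurable_funTS (mw j)) (fun j x _ => w0 j x) theta0 sum_theta.
move=> /(_ (fun j => weight_grid_box_lty o delta (hw j) _ _)).
rewrite (integral_box_set o delta0 wnu) lee_fin => /le_trans; apply.
under eq_bigr do rewrite (integral_box_set o delta0 (hw _))/=.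
have -> : vol i * \prod_j avg (w j) i `^ theta j =
    (\prod_j vol i `^ theta j) * \prod_j avg (w j) i `^ theta j.
  by rewrite -powR_sumr// sum_theta powRr1// ltW.
rewrite -big_split/=; apply: ler_prod => j _.
rewrite powR_ge0/= -powRM ?(ltW vi)//; last exact: box_average_ge0.
by rewrite /box_average mulrC divfK// gt_eqF.
Qed.

Variable f : 'I_m -> T -> R.
Hypotheses (f0 : forall j x, 0 <= f j x).
Hypotheses (mf : forall j, measurable_fun [set: T] (f j)).

Let g j := weighted_fun o delta N (w j) (ps j) (f j).
Let lux j (h : T -> R) (i : box) := luxemburg (Psi j) h (box_set o delta i).
Let a (i : box) : \bar R := (\prod_j lux j (f j) i)%E.
Let normp j : \bar R :=
  (\int[lebesgue]_x ((`|f j x| `^ ps j)%:E * strong_maximal (w j) x))%E.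

Let normp0 j : (0 <= normp j)%E.
Proof.
apply: integral_ge0 => x _; apply: mule_ge0; last exact: strong_maximal_ge0.
by rewrite lee_fin powR_ge0.
Qed.

Let lux0 j h i : (0 <= lux j h i)%E. Proof. exact: luxemburg_ge0. Qed.

Let lux_scale j i :
  ((avg (w j) i `^ (ps j)^-1)%:E * lux j (f j) i <= lux j (g j) i)%E.
Proof.
apply: luxemburg_scale => //; first by move=> x; exact: weighted_fun_ge0.
  exact: powR_ge0.
by move=> x ix; apply: (weighted_fun_ge delta0) => //.
Qed.

(** Constants for [luxemburg_scattered] applied to [g j], combined with [integral_weighted_fun_le].
    They are supplied from outside so as not to depend on the grid. *)
Variable C : 'I_m -> R.
Hypothesis C0 : forall j, 0 <= C j.
Hypothesis HC : forall j (S : {set box}) (E : box -> {set Z}),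
  (forall i, i \in S -> E i \subset cells i) ->
  (forall i i', i \in S -> i' \in S -> i != i' -> [disjoint E i & E i']%bool) ->
  (\sum_(i in S) (#|E i|%:R * delta ^+ n)%:E * lux j (g j) i `^ ps j <=
   (C j)%:E * normp j)%E.

(** The scattered estimate for one box, all of whose cells are its own part; it decides when a
    single norm vanishes or is finite. *)
Let lux_box_le j i : ((vol i)%:E * lux j (g j) i `^ ps j <= (C j)%:E * normp j)%E.
Proof.
have := @HC j [set i]%SET cells; rewrite big_set1; apply => //.
by move=> i1 i2 /set1P -> /set1P ->; rewrite eqxx.
Qed.

Let avg_gt0 i k : k \in cells i -> 0 < mass nu i -> forall j, 0 < avg (w j) i.
Proof.
move=> ki mi j; rewrite lt_neqAle box_average_ge0// andbT.
apply/eqP => /esym avg0; move: mi; rewrite ltNge => /negP; apply.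
apply: le_trans (box_mass_prod_le ki) _.
by rewrite (bigD1 j)//= avg0 powR0 ?mul0r ?mulr0// gt_eqF.
Qed.

Let mx (k : Z) : \bar R := \big[maxe/0%E]_(i | k \in cells i) a i.
Let W (k : Z) := cell_mass o delta nu k.

Let W0 k : 0 <= W k. Proof. exact: cell_mass_ge0. Qed.

Let mass_gt0 i k : k \in cells i -> 0 < W k -> 0 < mass nu i.
Proof.
move=> ki Wk; rewrite /box_mass (bigD1 k)//= ltr_wpDr//.
by apply: sumr_ge0 => k' _; exact: W0.
Qed.

(** Needed because [0 * +oo] is [0]: one vanishing norm kills the right side even if another is
    infinite. Where [W k] is positive every box average of [w j] is positive, so the norm of [f j]
    vanishes together with that of [g j]. *)
Lemma sum_cells_eq0 j : normp j = 0%E ->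
  (\sum_k mx k `^ p * (W k)%:E = 0)%E.
Proof.
move=> nj; apply: big1 => k _.
have := W0 k; rewrite le_eqVlt => /predU1P[<-|Wk]; first by rewrite mule0.
suff -> : mx k = 0%E by rewrite poweR0r ?mul0e// gt_eqF.
apply/eqP; rewrite eq_le; apply/andP; split; last exact: bigmax_ge_id.
apply: bigmax_le => // i ki; rewrite /a (prode_eq0 (j := j))//.
have vi := box_volume_gt0 delta0 ki.
have lg0 : lux j (g j) i = 0%E.
  have := lux_box_le j i; rewrite nj mule0 => lg.
  have /eqP : ((vol i)%:E * lux j (g j) i `^ ps j = 0)%E.
    by apply/eqP; rewrite eq_le lg mule_ge0 ?poweR_ge0// lee_fin ltW.
  rewrite mule_eq0 eqe gt_eqF//= => /eqP; exact: poweR_eq0_eq0.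
have ci := avg_gt0 ki (mass_gt0 ki Wk) j.
apply/eqP; have := lux_scale j i; rewrite lg0 => lf.
have : ((avg (w j) i `^ (ps j)^-1)%:E * lux j (f j) i == 0)%E.
  by rewrite eq_le lf mule_ge0// lee_fin powR_ge0.
by rewrite mule_eq0 eqe gt_eqF ?powR_gt0.
Qed.

Variables (q K : R).
Hypotheses (q1 : 1 <= q) (K0 : 0 <= K).
Hypothesis HK : axis_weighted W q K.

(** A box without [nu]-mass gets the value 0: an average of some [w j] may vanish on it, and then
    [lux_scale] says nothing about the norm of [f j]. Such boxes contain no cell with [W k]
    positive. *)
Let b i : R := if 0 < mass nu i then fine (a i) `^ p else 0.
Let x j i : R := fine (lux j (g j) i).

Let luxg_fin j i k : (normp j < +oo)%E -> k \in cells i -> lux j (g j) i \is a fin_num.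
Proof.
move=> nj ki; rewrite ge0_fin_numE// ltNge leye_eq; apply/negP => /eqP loo.
have := lux_box_le j i; rewrite loo poweRyr ?gt_eqF//.
rewrite gt0_muley ?lte_fin ?(box_volume_gt0 delta0 ki)//.
rewrite leNgt lte_mul_pinfty// lee_fin; exact: C0.
Qed.

Let luxf_fin j i k : (normp j < +oo)%E -> k \in cells i -> 0 < mass nu i ->
  lux j (f j) i \is a fin_num.
Proof.
move=> nj ki mi; rewrite ge0_fin_numE// ltNge leye_eq; apply/negP => /eqP loo.
have := lux_scale j i; rewrite loo gt0_muley; last first.
  by rewrite lte_fin powR_gt0// (avg_gt0 ki).
by rewrite leye_eq => /eqP goo; have := luxg_fin nj ki; rewrite goo.
Qed.

Let luxE j i k : (normp j < +oo)%E -> k \in cells i -> 0 < mass nu i ->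
  avg (w j) i `^ (ps j)^-1 * fine (lux j (f j) i) <= x j i.
Proof.
move=> nj ki mi; have := lux_scale j i.
rewrite -{1}(fineK (luxf_fin nj ki mi)) -{1}(fineK (luxg_fin nj ki)).
by rewrite -EFinM lee_fin.
Qed.

Let fine_a i k : (forall j, normp j < +oo)%E -> k \in cells i -> 0 < mass nu i ->
  a i = (\prod_j fine (lux j (f j) i))%:E.
Proof.
move=> nj ki mi; rewrite /a -prodEFin; apply: eq_bigr => j _.
by rewrite (fineK (luxf_fin (nj j) ki mi)).
Qed.

Lemma sum_cells_le : (forall j, normp j < +oo)%E ->
  (\sum_k mx k `^ p * (W k)%:E <=
   (half_density_const n q K * 2 *
     \prod_j (C j * fine (normp j)) `^ theta j)%:E)%E.
Proof.
move=> nj.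
have b0 i : 0 <= b i by rewrite /b; case: ifP => // _; exact: powR_ge0.
have [S [E [SE Edis HS]]] :=
  @sum_maximal_scattered n N R box W q K W0 q1 K0 HK (@box_lo n N) (@box_hi n N) b
    (@box_hiN n N) b0.
pose M k := \big[Num.max/0]_(i | k \in cells i) b i.
have M0 k : 0 <= M k by exact: bigmax_ge_id.
apply: (@le_trans _ _ (\sum_k W k * M k)%:E).
  rewrite -sumEFin; apply: lee_sum => k _.
  have := W0 k; rewrite le_eqVlt => /predU1P[<-|Wk]; first by rewrite mule0 mul0r.
  rewrite muleC EFinM; apply: lee_wpmul2l; first by rewrite lee_fin W0.
  (* Taking p-th roots allows the maximum of the [a i] to be bounded box by box. *)
  have -> : M k = (M k `^ p^-1) `^ p by rewrite -powRrM mulVf ?gt_eqF// powRr1.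
  rewrite -poweR_EFin; apply: le_poweR2r; [exact: ltW|exact: bigmax_ge_id|].
  apply: bigmax_le => [|i ki]; first by rewrite lee_fin powR_ge0.
  have mi := mass_gt0 ki Wk.
  rewrite (fine_a nj ki mi) lee_fin.
  set A := \prod_j _; have A0 : 0 <= A by apply: prodr_ge0 => j _; rewrite fine_ge0.
  have -> : A = (A `^ p) `^ p^-1 by rewrite -powRrM mulfV ?gt_eqF// powRr1.
  apply: ler_powR2r; [by rewrite invr_ge0 ltW|exact: powR_ge0|].
  have -> : A `^ p = b i by rewrite /b mi (fine_a nj ki mi).
  exact: (le_bigmax_cond 0 b ki).
rewrite lee_fin; apply: le_trans HS _.
rewrite -mulrA ler_wpM2l ?half_density_const_ge0//.
pose e i : R := #|E i|%:R * delta ^+ n.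
have dn0 : 0 <= delta ^+ n by rewrite exprn_ge0// ltW.
have e0 i : 0 <= e i by rewrite mulr_ge0.
have x0 j i : 0 <= x j i by rewrite fine_ge0.
(* The factor 2 comes from the selection, a chosen box being at most twice its own part. The
   averages of [w j] from [box_mass_prod_le] are absorbed by [luxE], as [ps j * theta j] is [p]. *)
apply: (@le_trans _ _ (2 * \sum_(i in S) e i * \prod_j (x j i `^ ps j) `^ theta j)).
  rewrite mulr_sumr; apply: ler_sum => i iS; rewrite -/(mass nu i).
  have [_ cardE] := SE i iS.
  have rhs0 : 0 <= e i * \prod_j (x j i `^ ps j) `^ theta j.
    by rewrite mulr_ge0// prodr_ge0// => j _; exact: powR_ge0.
  rewrite /b; case: ifPn => [mi|_]; last by rewrite mul0r mulr_ge0.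
  have [k ki] : exists k, k \in cells i.
    apply: contrapT => /forallNP nk; move: mi; rewrite /box_mass big1 ?ltxx//.
    by move=> k /nk.
  have ve : vol i <= 2 * e i.
    by rewrite /box_volume /e mulrA ler_wpM2r// -natrM ler_nat.
  rewrite (fine_a nj ki mi)/= mulrA.
  apply: (@le_trans _ _ (vol i * \prod_j (x j i `^ ps j) `^ theta j)); last first.
    by rewrite ler_wpM2r// prodr_ge0// => j _; exact: powR_ge0.
  set A := \prod_j fine (lux j (f j) i).
  have A0 : 0 <= A by apply: prodr_ge0 => j _; rewrite fine_ge0.
  apply: (@le_trans _ _ (A `^ p * (vol i * \prod_j avg (w j) i `^ theta j))).
    by rewrite ler_wpM2l ?powR_ge0//; exact: box_mass_prod_le ki.
  rewrite mulrCA ler_wpM2l ?box_volume_ge0//.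
  rewrite /A powR_prod; last by move=> j; rewrite fine_ge0.
  rewrite -big_split/=; apply: ler_prod => j _; rewrite mulr_ge0 ?powR_ge0//=.
  rewrite -powRrM /theta mulrCA mulfV ?mulr1 ?gt_eqF//.
  apply: le_trans (ler_powR2r (ltW p0) _ (luxE (nj j) ki mi)); last first.
    by rewrite mulr_ge0 ?powR_ge0 ?fine_ge0.
  rewrite powRM ?powR_ge0 ?fine_ge0// -powRrM mulrC.
  by rewrite (mulrC _ p).
rewrite ler_wpM2l//.
apply: le_trans (hoelder_sum S e0 (fun i j => powR_ge0 _ _) theta0 sum_theta) _.
apply: ler_prod => j _; rewrite powR_ge0/=; apply: ler_powR2r.
- exact: ltW.
- by apply: sumr_ge0 => i _; rewrite mulr_ge0 ?powR_ge0.
rewrite -lee_fin [leRHS]EFinM fineK ?ge0_fin_numE// -sumEFin.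
apply: le_trans (@HC j S E (fun i iS => (SE i iS).1) Edis).
apply: lee_sum => i iS; rewrite EFinM; apply: lee_wpmul2l; first by rewrite lee_fin e0.
rewrite -poweR_EFin; apply: le_poweR2r; [exact: ltW|by rewrite lee_fin|].
rewrite /x; have := lux0 j (g j) i; by case: (lux j (g j) i).
Qed.

End one_grid.
End grid_inequality.

Section grid_bound.
Context (R : realType) (m n : nat) (hn : (0 < n)%N).
Local Notation T := (euclidean R n).
Context (p : R) (ps : 'I_m -> R) (p0 : 0 < p) (hps : forall j, 1 < ps j).
Context (hp : p^-1 = \sum_(j < m) (ps j)^-1).
Context (Psi : 'I_m -> \bar R -> \bar R).
Context (hyoung : forall j, young (Psi j)).
Context (hPsi : forall j, strong_Bp n (ps j) (Psi j)).
Context (w : 'I_m -> T -> R) (hw : forall j, weight (w j)).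
Let nu := fun x => \prod_(j < m) w j x `^ (p / ps j).
Context (hnu : muckenhoupt_oo nu).

Definition orlicz_cell_maximal (o delta : R) (N : nat) (f : 'I_m -> T -> R)
    (k : {ffun 'I_n -> 'I_N.+1}) : \bar R :=
  \big[maxe/0%E]_(i : @box_index n N | k \in box_cells i)
    (\prod_j luxemburg (Psi j) (f j) (box_set o delta i))%E.

Lemma sum_cells_bound : exists2 C : R, 0 < C &
  forall (o delta : R) (N : nat) (f : 'I_m -> T -> R), 0 < delta ->
  (forall j x, 0 <= f j x) -> (forall j, measurable_fun [set: T] (f j)) ->
  (\sum_(k : {ffun 'I_n -> 'I_N.+1})
     orlicz_cell_maximal o delta f k `^ p * (cell_mass o delta nu k)%:E <=
   C%:E * \prod_j weighted_norm (ps j) (strong_maximal (w j)) (f j) `^ p)%E.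
Proof.
have [q [q1 Aq]] := hnu.
have wnu : weight nu by case: Aq.
have [K K0 HK] := muckenhoupt_axis_weighted q1 Aq.
have ps0 j : 0 < ps j by exact: lt_trans (hps j).
have /choice[C HC] : forall j, exists C : R, 0 <= C /\
    forall (o delta : R) (N : nat) (g : T -> R) (I : finType) (S : {set I})
      (u v : I -> 'I_n -> nat) (E : I -> {set {ffun 'I_n -> 'I_N.+1}}),
    0 < delta -> measurable_fun [set: T] g -> (forall x, 0 <= g x) ->
    (forall i j, v i j <= N.+1)%N ->
    (forall i, i \in S -> E i \subset cell_box N (u i) (v i)) ->
    (forall i j, i \in S -> j \in S -> i != j -> [disjoint E i & E j]%bool) ->
    (\sum_(i in S) (#|E i|%:R * delta ^+ n)%:E *
       luxemburg (Psi j) g (grid_box o delta (u i) (v i)) `^ ps j <=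
     C%:E * \int[lebesgue]_x (g x `^ ps j)%:E)%E.
  move=> j; have [C C0 HC] := luxemburg_scattered hn (hps j) (hyoung j) (hPsi j).
  by exists C.
have C0 j : 0 <= C j := (HC j).1.
pose P := \prod_j C j `^ (p / ps j).
have P0 : 0 <= P by apply: prodr_ge0 => j _; exact: powR_ge0.
pose H : R := half_density_const n q K * 2.
have H0 : 0 <= H by rewrite mulr_ge0// half_density_const_ge0.
have Ctot : 0 < H * P + 1 by rewrite ltr_wpDl// mulr_ge0.
exists (H * P + 1) => // o delta N f delta0 f0 mf.
pose normp j : \bar R :=
  (\int[lebesgue]_x ((`|f j x| `^ ps j)%:E * strong_maximal (w j) x))%E.
have normp0 j : (0 <= normp j)%E.
  apply: integral_ge0 => x _; apply: mule_ge0; last exact: strong_maximal_ge0.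
  by rewrite lee_fin powR_ge0.
have normE j : (weighted_norm (ps j) (strong_maximal (w j)) (f j) `^ p =
    normp j `^ (p / ps j))%E.
  by rewrite /weighted_norm -poweRrM mulrC.
under [in leRHS]eq_bigr do rewrite normE.
have theta0 j : 0 < p / ps j by exact: divr_gt0.
have HC' j (S : {set @box_index n N}) (E : @box_index n N -> {set {ffun 'I_n -> 'I_N.+1}}) :
  (forall i, i \in S -> E i \subset box_cells i) ->
  (forall i i', i \in S -> i' \in S -> i != i' -> [disjoint E i & E i']%bool) ->
  (\sum_(i in S) (#|E i|%:R * delta ^+ n)%:E *
     luxemburg (Psi j) (weighted_fun o delta N (w j) (ps j) (f j)) (box_set o delta i) `^ ps j <=
   (C j)%:E * normp j)%E.
  move=> Ecells Edis.
  apply: le_trans ((HC j).2 o delta N _ _ S _ _ E delta0 _ _ (@box_hiN n N) Ecells Edis) _.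
  - exact: measurable_weighted_fun.
  - by move=> x; exact: weighted_fun_ge0.
  apply: lee_wpmul2l; first by rewrite lee_fin.
  exact: integral_weighted_fun_le.
(* A vanishing norm is treated before an infinite one, since their product counts as 0. *)
have [[j nj]|/forallNP nj] := pselect (exists j, normp j = 0%E).
  rewrite (sum_cells_eq0 p0 hps hp hyoung hw wnu delta0 f0 HC' nj).
  apply: mule_ge0; first by rewrite lee_fin ltW.
  by apply: prode_ge0 => i _; exact: poweR_ge0.
have njp j : (0 < normp j)%E by rewrite lt0e normp0 andbT; exact/eqP.
have [[j njoo]|/forallNP njfin] := pselect (exists j, normp j = +oo%E).
  rewrite (prode_pinfty (j := j)).
  - by rewrite gt0_muley ?leey// lte_fin.
  - by move=> i; exact: poweR_gt0.
  - by rewrite njoo poweRyr// gt_eqF.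
have njlt j : (normp j < +oo)%E by rewrite ltey; exact/eqP.
have W0 (k : {ffun 'I_n -> 'I_N.+1}) : 0 <= cell_mass o delta nu k.
  by apply: cell_mass_ge0; case: wnu.
have HK' := HK o delta N delta0 (fun k => weight_cell_lty o delta wnu k).
apply: le_trans (sum_cells_le p0 hps hp hyoung hw wnu delta0 f0 C0 HC' (ltW q1) K0 HK' njlt) _.
rewrite (eq_bigr (fun j => (fine (normp j) `^ (p / ps j))%:E)); last first.
  by move=> j _; rewrite -poweR_EFin fineK// ge0_fin_numE.
rewrite prodEFin -EFinM lee_fin.
rewrite (eq_bigr (fun j => C j `^ (p / ps j) * fine (normp j) `^ (p / ps j))); last first.
  by move=> j _; apply: powRM; [exact: C0 | exact/fine_ge0/normp0].
rewrite big_split/= mulrA ler_wpM2r//; last by rewrite lerDl.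
by apply: prodr_ge0 => j _; exact: powR_ge0.
Qed.

End grid_bound.

(** * Luxemburg norms on an enlarged box *)

Section luxemburg_enlarge.
Context {R : realType} {n : nat}.
Local Notation T := (euclidean R n).

(** Convexity compensates the growth of the volume: dividing the argument of [Phi] by [M] divides
    its value by at least [M], so if [l] is admissible on the large box then [M * l] is on the small
    one. *)
Lemma luxemburg_enlarge (p : R) (Phi : \bar R -> \bar R) (f : T -> R)
    (a b a' b' : 'rV[R]_n) (M : R) :
  young Phi -> strong_Bp n p Phi ->
  measurable_fun [set: T] f -> (forall x, 0 <= f x) ->
  Defs.nondegenerate a b -> Defs.nondegenerate a' b' ->
  rectangle a b `<=` half_open_box a' b' -> 1 <= M ->
  volume a' b' <= M * volume a b ->
  (luxemburg Phi f (rectangle a b) <= M%:E * luxemburg Phi f (half_open_box a' b'))%E.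
Proof.
move=> yPhi bPhi mf f0 ab ab' AA' M1 volM.
have M0 : 0 < M := lt_le_trans ltr01 M1.
have va : 0 < volume a b by apply: prodr_gt0 => i _; rewrite subr_gt0.
have va' : 0 < volume a' b' by apply: prodr_gt0 => i _; rewrite subr_gt0.
rewrite -lee_pdivrMl//; apply: le_ereal_inf_tmp => _ [l [l0 avg1] <-].
rewrite lee_pdivrMl// -EFinM; apply: ereal_inf_lbound; exists (M * l) => //.
split; first exact: mulr_gt0.
have fl x t : 0 < t -> 0 <= `|f x| / t by move=> t0; rewrite divr_ge0// ltW.
have phiE x t : 0 < t -> Phi (`|f x| / t)%:E = (young_fine Phi (`|f x| / t))%:E.
  by move=> t0; rewrite (young_fineE yPhi bPhi)// fl.
have mphi t : 0 < t ->
    measurable_fun [set: T] (fun x => (young_fine Phi (`|f x| / t))%:E).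
  move=> t0; apply/measurable_EFinP.
  have mono : measurable_fun [set: R] (young_fine Phi).
    by apply: nondecreasing_measurable => //; exact: (young_fine_mono yPhi bPhi).
  apply: (measurableT_comp mono); apply: measurable_funM; last exact: measurable_cst.
  exact: (measurableT_comp (@normr_measurable R setT) mf).
have Ml0 : 0 < M * l by exact: mulr_gt0.
apply: le_trans avg1; rewrite /average.
rewrite lebesgue_rectangle// lebesgue_half_open_box// !inver !gt_eqF//.
set J := (\int[lebesgue]_(x in half_open_box a' b') _)%E.
have J0 : (0 <= J)%E.
  by apply: integral_ge0 => x _; rewrite phiE// lee_fin (young_fine_ge0 yPhi).
apply: (@le_trans _ _ (((volume a b)^-1)%:E * ((M^-1)%:E * J))%E); last first.
  rewrite muleA -EFinM; apply: lee_wpmul2r => //.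
  by rewrite lee_fin -invfM lef_pV2 ?posrE ?mulr_gt0// mulrC.
apply: lee_wpmul2l; first by rewrite lee_fin invr_ge0 ltW.
rewrite /J; under [in leRHS]eq_integral do rewrite phiE//.
rewrite -ge0_integralZl_EFin; last 4 first.
- exact: measurable_half_open_box.
- by move=> x _; rewrite lee_fin (young_fine_ge0 yPhi).
- by apply: measurable_funTS; exact: mphi.
- by rewrite invr_ge0 ltW.
apply: le_integral_ge0 => // x Ax.
- by rewrite phiE// lee_fin (young_fine_ge0 yPhi).
- by rewrite -EFinM lee_fin mulr_ge0 ?(young_fine_ge0 yPhi)// invr_ge0 ltW.
rewrite phiE// -EFinM lee_fin (_ : `|f x| / (M * l) = M^-1 * (`|f x| / l)).
  apply: (young_fine_scale yPhi bPhi); last exact: fl.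
  by rewrite invr_ge0 ltW//= invf_le1.
by rewrite invfM mulrCA.
Qed.

End luxemburg_enlarge.

(** * Refining the grid *)

Section grid_approximation.
Context {R : realType} {n : nat}.
Local Notation T := (euclidean R n).

(** Rounding outwards lengthens a side by at most [2 * delta], which is at most the side itself. The
    upper corner is rounded strictly up because the grid box is half-open. *)
Lemma rectangle_sub_grid_box (o delta : R) (N : nat) (a b : 'rV[R]_n) : 0 < delta ->
  (forall i, o <= a ord0 i) -> (forall i, b ord0 i < o + N.+1%:R * delta) ->
  (forall i, 2 * delta <= b ord0 i - a ord0 i) ->
  exists i : @box_index n N,
    [/\ forall j, (box_lo i j < box_hi i j)%N,
        rectangle a b `<=` box_set o delta i &
        volume (grid_point o delta (box_lo i)) (grid_point o delta (box_hi i)) <=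
        2 ^+ n * volume a b].
Proof.
move=> delta0 oa bN ab2.
pose u j := Num.truncn ((a ord0 j - o) / delta).
pose v j := (Num.truncn ((b ord0 j - o) / delta)).+1.
have ab j : a ord0 j < b ord0 j.
  by rewrite -subr_gt0; apply: lt_le_trans (ab2 j); rewrite mulr_gt0.
have aE j : (u j)%:R * delta <= a ord0 j - o < (u j).+1%:R * delta.
  rewrite -ler_pdivlMr// -ltr_pdivrMr//; apply: truncn_itv.
  by rewrite divr_ge0 ?(ltW delta0)// subr_ge0.
have b0 j : 0 <= (b ord0 j - o) / delta.
  by rewrite divr_ge0 ?(ltW delta0)// subr_ge0 (le_trans (oa j))// ltW.
have bE j : (v j).-1%:R * delta <= b ord0 j - o < (v j)%:R * delta.
  by rewrite -ler_pdivlMr// -ltr_pdivrMr//; exact: truncn_itv (b0 j).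
have uv j : (u j < v j)%N.
  rewrite -(ltr_nat R) -(ltr_pM2r delta0).
  have /andP[h1 _] := aE j; have /andP[_ h2] := bE j; have := ab j; lra.
have vN j : (v j < N.+2)%N.
  rewrite ltnS /v truncn_lt_nat// ltr_pdivrMr//; have := bN j; lra.
have uN j : (u j < N.+2)%N by exact: ltn_trans (uv j) (vN j).
exists ([ffun j => Ordinal (uN j)], [ffun j => Ordinal (vN j)]).
have loE j : box_lo (N := N) ([ffun j => Ordinal (uN j)], [ffun j => Ordinal (vN j)]) j = u j.
  by rewrite /box_lo ffunE.
have hiE j : box_hi (N := N) ([ffun j => Ordinal (uN j)], [ffun j => Ordinal (vN j)]) j = v j.
  by rewrite /box_hi ffunE.
split; first by move=> j; rewrite loE hiE.
  move=> x abx; apply/grid_boxP => j; rewrite loE hiE.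
  have := abx j; rewrite in_itv/= => /andP[ax xb].
  by have /andP[h1 _] := aE j; have /andP[_ h2] := bE j; apply/andP; split; lra.
have -> : 2 ^+ n * volume a b = \prod_(j < n) (2 * (b ord0 j - a ord0 j)).
  by rewrite big_split/= prodr_const card_ord.
apply: ler_prod => j _; rewrite !mxE loE hiE.
have /andP[h1 h1'] := aE j; have /andP[h2' h2] := bE j.
move: h1' h2'; rewrite -natr1 (_ : (v j)%:R = (v j).-1%:R + 1 :> R) ?natr1//.
have := ab2 j; have : (u j)%:R * delta < (v j)%:R * delta by rewrite ltr_pM2r// ltr_nat.
rewrite -[(v j)%:R]natr1 => h3 h4 h5 h6.
by apply/andP; split; lra.
Qed.

Lemma orlicz_rectangle_le_cell m (ps : 'I_m -> R) (Psi : 'I_m -> \bar R -> \bar R)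
    (f : 'I_m -> T -> R) (o delta : R) (N : nat) (a b : 'rV[R]_n) (x : T) :
  (forall j, young (Psi j)) -> (forall j, strong_Bp n (ps j) (Psi j)) ->
  (forall j, measurable_fun [set: T] (f j)) -> (forall j x, 0 <= f j x) ->
  0 < delta ->
  (forall i, o <= a ord0 i) -> (forall i, b ord0 i < o + N.+1%:R * delta) ->
  (forall i, 2 * delta <= b ord0 i - a ord0 i) -> rectangle a b x ->
  exists2 k : {ffun 'I_n -> 'I_N.+1}, cell o delta k x &
    (\prod_j luxemburg (Psi j) (f j) (rectangle a b) <=
     ((2 ^+ n) ^+ m)%:E * orlicz_cell_maximal Psi o delta f k)%E.
Proof.
move=> yPsi bPsi mf f0 delta0 oa bN ab2 abx.
have [i [lohi abi voli]] := rectangle_sub_grid_box delta0 oa bN ab2.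
have ab : Defs.nondegenerate a b.
  by move=> j; rewrite -subr_gt0; apply: lt_le_trans (ab2 j); rewrite mulr_gt0.
have [k ki kx] := grid_box_cell delta0 (box_hiN i) (abi _ abx).
exists k => //.
apply: (@le_trans _ _ (\prod_j ((2 ^+ n)%:E * luxemburg (Psi j) (f j) (box_set o delta i)))%E).
  apply: (big_ind2 (fun s t : \bar R => 0 <= s /\ s <= t)%E _ _ _).2 => //.
    by move=> s s' t t' [s0 ss'] [t0 tt']; rewrite mule_ge0// lee_pmul.
  move=> j _; split; first exact: luxemburg_ge0.
  apply: (luxemburg_enlarge (yPsi j) (bPsi j)) => //.
    exact: grid_point_lt.
  by rewrite exprn_ege1// ler1n.
rewrite big_split/= prodEFin prodr_const card_ord.
apply: lee_wpmul2l; first by rewrite lee_fin !exprn_ge0.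
exact: (@le_bigmax_cond _ _ _ _ _ _ (fun i => \prod_j luxemburg (Psi j) (f j) (box_set o delta i))%E).
Qed.

End grid_approximation.

Lemma le_limn_einf {R : realType} (u : (\bar R)^nat) (c : \bar R) (N : nat) :
  (forall k, (N <= k)%N -> (c <= u k)%E) -> (c <= limn_einf u)%E.
Proof.
move=> cu; rewrite limn_einf_lim; apply: lime_ge; first exact: is_cvg_einfs.
exists N => // k /= Nk; apply: le_ereal_inf_tmp => _ [l /= kl <-].
exact/cu/(leq_trans Nk).
Qed.

Lemma limn_einf_le {R : realType} (u : (\bar R)^nat) (c : \bar R) :
  (forall k, (u k <= c)%E) -> (limn_einf u <= c)%E.
Proof.
move=> uc; rewrite limn_einf_lim; apply: lime_le; first exact: is_cvg_einfs.
near=> k; apply: le_trans (uc k).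
by apply: ereal_inf_lbound; exists k => /=.
Unshelve. all: by end_near. Qed.

Section cell_majorant.
Context {R : realType} {n : nat}.
Local Notation T := (euclidean R n).
Variables (o delta : R) (N : nat).
Notation Z := {ffun 'I_n -> 'I_N.+1}.
Hypothesis delta0 : 0 < delta.
Variables (c : Z -> \bar R) (w : T -> R).
Hypotheses (c0 : forall k, (0 <= c k)%E) (ww : weight w).

Let w0 x : 0 <= w x. Proof. by case: ww. Qed.
Let mw : measurable_fun [set: T] (fun x => (w x)%:E).
Proof. by case: ww => _ [? _]; exact/measurable_EFinP. Qed.

(** On the cell [k] this is [c k * w x]: a measurable function whose integral is a finite sum over
    cells, fit for Fatou's lemma. The values [c k] may be infinite. *)
Definition cell_majorant (x : T) : \bar R :=
  (\sum_k c k * ((fun x => (w x)%:E) \_ (cell o delta k)) x)%E.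

Let restrict0 (k : Z) x : (0 <= ((fun x => (w x)%:E) \_ (cell o delta k)) x)%E.
Proof. by rewrite patchE; case: ifP => // _; rewrite lee_fin. Qed.

Let measurable_restrict_cell (k : Z) :
  measurable_fun [set: T] ((fun x => (w x)%:E) \_ (cell o delta k)).
Proof.
apply/(measurable_restrictT _ (measurable_cell o delta k)).
exact: measurable_funTS.
Qed.

Lemma cell_majorant_ge0 x : (0 <= cell_majorant x)%E.
Proof. by apply: sume_ge0 => k _; exact: mule_ge0. Qed.

Lemma measurable_cell_majorant : measurable_fun [set: T] cell_majorant.
Proof.
apply: emeasurable_sum => k; apply: measurable_funeM.
exact: measurable_restrict_cell.
Qed.

Lemma le_cell_majorant k x : cell o delta k x -> (c k * (w x)%:E <= cell_majorant x)%E.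
Proof.
move=> kx; rewrite /cell_majorant (bigD1 k)//= patchE mem_set//.
apply: leeDl; apply: sume_ge0 => k' _; exact: mule_ge0.
Qed.

Lemma integral_cell_majorant : (\int[lebesgue]_x cell_majorant x =
  \sum_k c k * (cell_mass o delta w k)%:E)%E.
Proof.
rewrite /cell_majorant ge0_integral_sum; last 3 first.
- exact: measurableT.
- by move=> k; apply: measurable_funeM; exact: measurable_restrict_cell.
- by move=> k x _; exact: mule_ge0.
apply: eq_bigr => k _; rewrite ge0_integralZl; last 4 first.
- exact: measurableT.
- exact: measurable_restrict_cell.
- by move=> x _; exact: restrict0.
- exact: c0.
rewrite -integral_mkcond cell_massE//.
by move=> k'; exact: weight_cell_lty.
Qed.

End cell_majorant.

Lemma exists_fine_grid {R : realType} {n : nat} (a b : 'rV[R]_n) :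
  Defs.nondegenerate a b -> exists L0, forall L, (L0 <= L)%N ->
    [/\ forall i, - L.+1%:R <= a ord0 i, forall i, b ord0 i < L.+1%:R &
        forall i, 2 * L.+1%:R^-1 <= b ord0 i - a ord0 i].
Proof.
move=> ab.
(* Once [L.+1] exceeds [B i], the grid contains both endpoints and two mesh widths fit into the
   side. *)
pose B i := `|a ord0 i| + `|b ord0 i| + 2 / (b ord0 i - a ord0 i).
have ab0 i : 0 < b ord0 i - a ord0 i by rewrite subr_gt0.
have d0 i : 0 < 2 / (b ord0 i - a ord0 i) by rewrite divr_gt0.
have B0 i : 0 <= B i by rewrite !addr_ge0// ltW.
exists (Num.truncn (\sum_i B i)) => L LL.
have BL i : B i < L.+1%:R.
  apply: (@le_lt_trans _ _ (\sum_i B i)).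
    by rewrite (bigD1 i)//= lerDl sumr_ge0.
  have /truncn_itv/andP[_ /lt_le_trans] : 0 <= \sum_i B i by exact: sumr_ge0.
  by apply; rewrite ler_nat.
have [na nb] : (forall i, 0 <= `|a ord0 i|) /\ (forall i, 0 <= `|b ord0 i|) by [].
split=> i; have := BL i; rewrite /B; have := d0 i; have := na i; have := nb i.
- have := ler_norm (- a ord0 i); rewrite normrN; lra.
- have := ler_norm (b ord0 i); lra.
- move=> h1 h2 h3 h4; rewrite ler_pdivrMr// mulrC -ler_pdivrMr//; lra.
Qed.

Theorem theorem1p1 (R : realType) (m n : nat) (hm : (0 < m)%N) (hn : (0 < n)%N)
    (p : R) (ps : 'I_m -> R) (hps : forall j, 1 < ps j)
    (hp : p^-1 = \sum_(j < m) (ps j)^-1)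
    (Psi : 'I_m -> \bar R -> \bar R)
    (hyoung : forall j, young (Psi j))
    (hPsi : forall j, strong_Bp n (ps j) (Psi j))
    (w : 'I_m -> euclidean R n -> R)
    (hw : forall j, weight (w j))
    (nu := fun x => \prod_(j < m) w j x `^ (p / ps j))
    (hnu : muckenhoupt_oo nu) :
  exists C : R, 0 < C /\
    forall f : 'I_m -> euclidean R n -> R,
      (forall j x, 0 <= f j x) ->
      (forall j, locally_integrable_Rn (f j)) ->
      (\int[lebesgue]_y (orlicz_maximal Psi f y `^ p * (nu y)%:E) <=
       C%:E * \prod_(j < m)
         weighted_norm (ps j) (strong_maximal (w j)) (f j) `^ p)%E.
Proof.
have ps0 j : 0 < ps j by exact: lt_trans (hps j).
have p0 : 0 < p.
  rewrite -invr_gt0 hp (bigD1 (Ordinal hm))//= ltr_wpDr ?invr_gt0//.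
  by apply: sumr_ge0 => j _; rewrite invr_ge0 ltW.
have [C C0 HC] := sum_cells_bound hn p0 hps hp hyoung hPsi hw hnu.
have wnu : weight nu by case: hnu => q [_ []].
have nu0 x : 0 <= nu x by case: wnu.
pose D : R := (2 ^+ n) ^+ m.
have D0 : 0 < D by rewrite !exprn_gt0.
have Dp0 : 0 < D `^ p by exact: powR_gt0.
exists (D `^ p * C); split; first exact: mulr_gt0.
move=> f f0 lf; have mf j : measurable_fun [set: euclidean R n] (f j) by case: (lf j).
(* The [L]-th grid starts at [- L.+1] with mesh [1 / L.+1]; [N L] steps have length [2 * L.+1], so
   it reaches beyond [L.+1]. *)
pose o L : R := - L.+1%:R.
pose delta L : R := L.+1%:R^-1.
pose N L := (2 * L.+1 ^ 2)%N.
have delta0 L : 0 < delta L by rewrite invr_gt0.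
have oN L : o L + (N L).+1%:R * delta L >= L.+1%:R.
  rewrite -[(N L).+1%:R]natr1 mulrDl mul1r /N natrM natrX expr2 -!mulrA mulfV// mulr1.
  by have := delta0 L; rewrite /o; lra.
pose mx L (k : {ffun 'I_n -> 'I_(N L).+1}) := orlicz_cell_maximal Psi (o L) (delta L) f k.
have mx0 L k : (0 <= @mx L k)%E by exact: bigmax_ge_id.
pose c L (k : {ffun 'I_n -> 'I_(N L).+1}) := ((D `^ p)%:E * mx L k `^ p)%E.
have c0 L k : (0 <= @c L k)%E by rewrite mule_ge0 ?poweR_ge0// lee_fin ltW.
pose G L := cell_majorant (o L) (delta L) (@c L) nu.
have G0 L x : (0 <= G L x)%E by exact: cell_majorant_ge0.
have pointwise x :
    (orlicz_maximal Psi f x `^ p * (nu x)%:E <= limn_einf (G ^~ x))%E.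
  have lim0 : (0 <= limn_einf (G ^~ x))%E by exact: (le_limn_einf (N := 0%N)).
  (* Only points with [nu x] positive matter. Dividing by [nu x] and taking p-th roots leaves a
     bound on the supremum, checked one rectangle at a time. *)
  have := nu0 x; rewrite le_eqVlt => /predU1P[<-|nux]; first by rewrite mule0.
  rewrite -lee_pdivlMr//.
  set l := (limn_einf _ * _)%E.
  have l0 : (0 <= l)%E by rewrite mule_ge0// lee_fin invr_ge0.
  have -> : l = ((l `^ p^-1) `^ p)%E by rewrite -poweRrM mulVf ?gt_eqF// poweRe1.
  apply: le_poweR2r; first exact: ltW.
    have [A rA Ax] := rectangles_cover x.
    apply: (@le_trans _ _ (\prod_j luxemburg (Psi j) (f j) A)%E).
      by apply: prode_ge0 => j _; exact: luxemburg_ge0.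
    by apply: ereal_sup_ubound; exists A.
  apply: ge_ereal_sup => _ [_ [[a [b [ab ->]]] abx] <-].
  set A := (\prod_j _)%E.
  have A0 : (0 <= A)%E by apply: prode_ge0 => j _; exact: luxemburg_ge0.
  have -> : A = ((A `^ p) `^ p^-1)%E by rewrite -poweRrM mulfV ?gt_eqF// poweRe1.
  apply: le_poweR2r; [by rewrite invr_ge0 ltW|exact: poweR_ge0|].
  rewrite /l lee_pdivlMr//.
  have [L0 HL] := exists_fine_grid ab.
  apply: (le_limn_einf (N := L0)) => L /HL[oa bL ab2].
  have [k kx Ak] := orlicz_rectangle_le_cell hyoung hPsi mf f0 (delta0 L) oa
    (fun i => lt_le_trans (bL i) (oN L)) ab2 abx.
  apply: le_trans (le_cell_majorant (delta := delta L) (@c0 L) wnu kx).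
  apply: lee_wpmul2r; first by rewrite lee_fin.
  rewrite /c -poweR_EFin -poweRM ?lee_fin ?(ltW D0)//.
  by apply: le_poweR2r => //; exact: ltW.
have integralG L : (\int[lebesgue]_x G L x <= (D `^ p * C)%:E *
    \prod_j weighted_norm (ps j) (strong_maximal (w j)) (f j) `^ p)%E.
  rewrite (integral_cell_majorant _ _ (@c0 L) wnu) EFinM -muleA.
  under eq_bigr do rewrite /c -muleA.
  rewrite -ge0_sume_distrr; last first.
    move=> k _; rewrite mule_ge0 ?poweR_ge0// lee_fin.
    by apply: cell_mass_ge0.
  apply: lee_wpmul2l; first by rewrite lee_fin ltW.
  exact: HC.
(* Successive grids are not nested, so [G L] need not be monotone in [L], and a given rectangle is
   handled only from some [L] on: the lower limit is what is available. *)
apply: (@le_trans _ _ (\int[lebesgue]_x limn_einf (G ^~ x))%E).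
  apply: le_integral_ge0 => // x _.
    by rewrite mule_ge0 ?poweR_ge0// lee_fin.
  exact: (le_limn_einf (N := 0%N)).
apply: le_trans (fatou _ measurableT _ (fun L x _ => G0 L x)) _.
  by move=> L; exact: measurable_cell_majorant.
exact: limn_einf_le.
Qed.
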